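(* Let $(M^4,g_0)$ be a closed connected four-dimensional Riemannian manifold whose Weyl tensor vanishes nowhere, let $a,c\in C^\infty(M)$ with $a>0$ on $M$, put $Lv=-\operatorname{div}(a\nabla v)+c\,v$, and assume that the first eigenvalue $\lambda_1$ of $L$ satisfies $\lambda_1\ge0$. Then every critical point of the functional $u\mapsto\mathfrak D(u)$, defined in $H(M)$, is a minimum point of $\mathfrak D$ on $H(M)$.
   Context: All geometric quantities ($\nabla$, $\operatorname{div}$, norms, $dV$) refer to $g_0$. The first eigenvalue is $$\lambda_1=\inf_{u\in H^1(M),\,u\not\equiv0}\frac{\int_M(a|\nabla u|^2+c\,u^2)\,dV}{\int_Mu^2\,dV}.$$ Set $$H(M)=\left\{u\in H^1(M): u>0\text{ a.e. and }\int_Mu^{-4}\,dV<\infty\right\},\qquad \mathfrak D(u)=\left(\int_Mu^{-4}\,dV\right)^{\frac12}\int_M(a|\nabla u|^2+c\,u^2)\,dV.$$ A critical point of $\mathfrak D$ is a function $w\in H(M)$ that solves the Euler–Lagrange equation $$Lw=\mathfrak D(w)\left(\int_Mw^{-4}\,dV\right)^{-\frac32}w^{-5}\quad\text{in } M,$$ in the weak sense: $w^{-5}\in L^1(M)$ and $\int_M\left(a\langle\nabla w,\nabla\varphi\rangle+c\,w\varphi\right)dV=\mathfrak D(w)\left(\int_Mw^{-4}dV\right)^{-3/2}\int_Mw^{-5}\varphi\,dV$ for all $\varphi\in C^1(M)$. *)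

(* Defs.v *)
From HB Require Import structures.
From mathcomp Require Import all_boot all_order all_algebra.
From mathcomp Require Import all_classical all_reals all_analysis.

Set Implicit Arguments.
Unset Strict Implicit.
Unset Printing Implicit Defensive.

Import Order.TTheory GRing.Theory Num.Theory.
Import numFieldNormedType.Exports.

Local Open Scope classical_set_scope.
Local Open Scope ring_scope.

Definition partial (R : realType) (b : 'I_4) (f : 'rV[R]_4 -> R)
    (p : 'rV[R]_4) : R :=
  'D_(delta_mx 0 b) f p.

Definition partials (R : realType) (s : seq 'I_4) (f : 'rV[R]_4 -> R) :
    'rV[R]_4 -> R :=
  foldr (@partial R) f s.

(* Meant for open sets W: there the iterated partial derivatives at the points
   of W depend only on the restriction of f to W. *)
Definition Ck_on (R : realType) (k : nat) (W : set 'rV[R]_4)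
    (f : 'rV[R]_4 -> R) : Prop :=
  forall (s : seq 'I_4) (p : 'rV[R]_4), W p ->
    ((size s <= k)%N -> {for p, continuous (partials s f)}) /\
    ((size s < k)%N ->
       forall b : 'I_4, derivable (partials s f) p (delta_mx 0 b)).

Definition smooth_on (R : realType) (W : set 'rV[R]_4) (f : 'rV[R]_4 -> R) :
    Prop :=
  forall k : nat, Ck_on k W f.

(* Row-vector convention: the differential of f at p is v |-> v *m jac f p. *)
Definition jac (R : realType) (f : 'rV[R]_4 -> 'rV[R]_4) (p : 'rV[R]_4) :
    'M[R]_4 :=
  \matrix_(b, d) partial b (fun q => f q 0 d) p.

(* A smooth structure of dimension 4 on M, given by an atlas that need not be
   maximal. The functions chart i and inv_chart i are total, but only their
   values on dom i and on chart i @` dom i are meaningful. As in a charted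
   space, chart_at selects a chart around each point. *)
Record smooth_atlas (R : realType) (M : topologicalType) := SmoothAtlas {
  chart_index : Type;
  dom : chart_index -> set M;
  chart : chart_index -> M -> 'rV[R]_4;
  inv_chart : chart_index -> 'rV[R]_4 -> M;
  chart_at : M -> chart_index;
  mem_chart_at : forall x : M, dom (chart_at x) x;
  open_dom : forall i, open (dom i);
  open_codom : forall i, open (chart i @` dom i);
  chartK : forall i x, dom i x -> inv_chart i (chart i x) = x;
  continuous_chart : forall i x, dom i x -> {for x, continuous (chart i)};
  continuous_inv_chart : forall i p, (chart i @` dom i) p ->
    {for p, continuous (inv_chart i)};
  smooth_transition : forall i j (b : 'I_4),
    smooth_on (chart i @` (dom i `&` dom j))
      (fun p => chart j (inv_chart i p) 0 b)
}.

Definition transition_jac (R : realType) (M : topologicalType)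
    (A : smooth_atlas R M) (i j : chart_index A) (x : M) : 'M[R]_4 :=
  jac (fun p => chart j (inv_chart i p)) (chart i x).

Definition Ck_fun (R : realType) (M : topologicalType) (A : smooth_atlas R M)
    (k : nat) (f : M -> R) : Prop :=
  forall i : chart_index A, Ck_on k (chart i @` dom i) (f \o inv_chart i).

Definition smooth_fun (R : realType) (M : topologicalType)
    (A : smooth_atlas R M) (f : M -> R) : Prop :=
  forall k : nat, Ck_fun A k f.

Record riemannian_metric (R : realType) (M : topologicalType)
    (A : smooth_atlas R M) := RiemannianMetric {
  gmx : chart_index A -> 'rV[R]_4 -> 'M[R]_4;
  smooth_gmx : forall i (b d : 'I_4),
    smooth_on (chart i @` dom i) (fun p => gmx i p b d);
  sym_gmx : forall i p, (chart i @` dom i) p -> (gmx i p)^T = gmx i p;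
  pos_gmx : forall i p, (chart i @` dom i) p ->
    forall v : 'rV[R]_4, v != 0 -> 0 < (v *m gmx i p *m v^T) 0 0;
  gmx_transition : forall i j x, dom i x -> dom j x ->
    gmx i (chart i x) =
      transition_jac i j x *m gmx j (chart j x) *m (transition_jac i j x)^T
}.

(* Curvature of a metric G given in coordinates. *)
Section curvature.
Variables (R : realType) (G : 'rV[R]_4 -> 'M[R]_4).
Implicit Types (b d e f k l : 'I_4) (p : 'rV[R]_4).

Definition ginv p : 'M[R]_4 := invmx (G p).

(* Gamma^k_{b d} *)
Definition christoffel k b d p : R :=
  2^-1 * \sum_l ginv p k l *
    (partial b (fun q => G q d l) p + partial d (fun q => G q b l) p
     - partial l (fun q => G q b d) p).

(* R^k_{d e f}, where R(d_e, d_f) d_d = R^k_{d e f} d_k *)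
Definition riemann13 k d e f p : R :=
  partial e (christoffel k f d) p - partial f (christoffel k e d) p
  + \sum_l (christoffel k e l p * christoffel l f d p
            - christoffel k f l p * christoffel l e d p).

Definition riemann b d e f p : R := \sum_k G p b k * riemann13 k d e f p.

Definition ricci d f p : R := \sum_k riemann13 k d k f p.

Definition scalar_curvature p : R := \sum_d \sum_f ginv p d f * ricci d f p.

(* The coefficients are 1 / (n - 2) and 1 / ((n - 1) (n - 2)) for n = 4. *)
Definition weyl b d e f p : R :=
  riemann b d e f p
  - 2^-1 * (ricci b e p * G p d f - ricci b f p * G p d e
            + G p b e * ricci d f p - G p b f * ricci d e p)
  + 6^-1 * scalar_curvature p * (G p b e * G p d f - G p b f * G p d e).

End curvature.

(* The vanishing of a tensor at x does not depend on the chart around x. *)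
Definition weyl_nonzero_at (R : realType) (M : topologicalType)
    (A : smooth_atlas R M) (g : riemannian_metric A) (x : M) : Prop :=
  let i := chart_at A x in
  exists b d e f : 'I_4, weyl (gmx g i) b d e f (chart i x) <> 0.

Notation borel M := (g_sigma_algebraType (@open M)).

Definition row4 (R : realType) (q : R * R * R * R) : 'rV[R]_4 :=
  let: (x0, x1, x2, x3) := q in \row_(b < 4) nth 0 [:: x0; x1; x2; x3] b.

Definition lebesgue4 (R : realType) :
    {measure set (measurableTypeR R * measurableTypeR R * measurableTypeR R
                  * measurableTypeR R) -> \bar R} :=
  (@lebesgue_measure R \x @lebesgue_measure R \x @lebesgue_measure R
   \x @lebesgue_measure R)%E.

(* dV = sqrt (det g) dx in every chart; this determines the Borel measure vol,
   which is the measure of integration against the Riemannian density. *)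
Definition is_riemannian_measure (R : realType) (M : ptopologicalType)
    (A : smooth_atlas R M) (g : riemannian_metric A)
    (vol : {measure set (borel M) -> \bar R}) : Prop :=
  forall (i : chart_index A) (B : set (borel M)),
    measurable B -> B `<=` dom i ->
    vol B = (\int[@lebesgue4 R]_(q in @row4 R @^-1` (chart i @` B))
               (Num.sqrt (\det (gmx g i (row4 q))))%:E)%E.

(* A vector field is given by its components X i x in each chart i with
   dom i x; the values X i x at the other points are irrelevant. *)
Definition is_vector_field (R : realType) (M : topologicalType)
    (A : smooth_atlas R M) (X : chart_index A -> M -> 'rV[R]_4) : Prop :=
  forall i j x, dom i x -> dom j x -> X j x = X i x *m transition_jac i j x.

Definition measurable_vector_field (R : realType) (M : ptopologicalType)
    (A : smooth_atlas R M) (X : chart_index A -> M -> 'rV[R]_4) : Prop :=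
  forall i (b : 'I_4),
    measurable_fun (dom i : set (borel M)) (fun x : borel M => X i x 0 b).

Section sobolev.
Variables (R : realType) (M : ptopologicalType) (A : smooth_atlas R M).
Variables (g : riemannian_metric A) (vol : {measure set (borel M) -> \bar R}).
Implicit Types (X Y : chart_index A -> M -> 'rV[R]_4) (u : M -> R).

Definition inner X Y (x : M) : R :=
  let i := chart_at A x in (X i x *m gmx g i (chart i x) *m (Y i x)^T) 0 0.

Definition grad u : chart_index A -> M -> 'rV[R]_4 :=
  fun i x => (\row_b partial b (u \o inv_chart i) (chart i x))
               *m ginv (gmx g i) (chart i x).

(* H^1(M) is the completion of C^oo(M) for the norm
   (\int u^2 + |grad u|^2 dV)^(1/2), realized in L^2(M): u belongs to it, with
   gradient X, when (u, X) is the L^2-limit of (u_n, grad u_n) for a sequence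
   of smooth functions u_n. *)
Definition is_weak_grad u X : Prop :=
  [/\ is_vector_field X, measurable_vector_field X &
    exists v : nat -> M -> R,
      [/\ forall n, smooth_fun A (v n),
          (\int[vol]_x ((v n x - u x) ^+ 2)%:E)%E @[n --> \oo] --> 0%E &
          let Z n := fun i x => grad (v n) i x - X i x in
          (\int[vol]_x (inner (Z n) (Z n) x)%:E)%E @[n --> \oo] --> 0%E]].

Definition H1 u : Prop :=
  [/\ measurable_fun setT (u : borel M -> R),
      (\int[vol]_x ((u x) ^+ 2)%:E < +oo)%E &
      exists X, is_weak_grad u X].

(* The weak gradient is unique up to null sets; xget selects a version, with 0
   as a dummy value when u has no weak gradient. *)
Definition wgrad u : chart_index A -> M -> 'rV[R]_4 :=
  xget (fun=> fun=> 0) [set X | is_weak_grad u X].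

Variables (a c : M -> R).

Definition energy u : R :=
  \int[vol]_x (a x * inner (wgrad u) (wgrad u) x + c x * u x ^+ 2).

Definition lambda1 : \bar R :=
  ereal_inf [set (energy u / \int[vol]_x (u x ^+ 2))%:E
            | u in [set u | H1 u /\ ~ {ae vol, forall x, u x = 0}]].

Definition HM u : Prop :=
  [/\ H1 u, {ae vol, forall x, 0 < u x} &
      (\int[vol]_x (u x ^- 4)%:E < +oo)%E].

Definition DD u : R := Num.sqrt (\int[vol]_x (u x ^- 4)) * energy u.

(* (\int w^-4)^(-3/2) is written as ((\int w^-4)^(1/2))^(-3). *)
Definition critical_point (w : M -> R) : Prop :=
  [/\ HM w, vol.-integrable setT (fun x => (w x ^- 5)%:E) &
      forall phi : M -> R, Ck_fun A 1 phi ->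
        \int[vol]_x (a x * inner (wgrad w) (grad phi) x + c x * w x * phi x) =
        DD w * Num.sqrt (\int[vol]_x (w x ^- 4)) ^- 3
          * \int[vol]_x (w x ^- 5 * phi x)].

Definition minimum_point (w : M -> R) : Prop :=
  HM w /\ forall u : M -> R, HM u -> DD w <= DD u.

End sobolev.

(* Main.v *)
Require Import Defs.
From HB Require Import structures.
From mathcomp Require Import all_boot all_order all_algebra.
From mathcomp Require Import all_classical all_reals all_analysis.
From mathcomp Require Import measurable_realfun ring lra.
Import Order.TTheory GRing.Theory Num.Theory.
Import numFieldNormedType.Exports.
Local Open Scope classical_set_scope.
Local Open Scope ring_scope.
Set Implicit Arguments.
Unset Strict Implicit.
Unset Printing Implicit Defensive.

(** Let E(u) = \int (a |grad u|^2 + c u^2) be the energy. It is nonnegative on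
    H^1 because lambda_1 >= 0, hence satisfies the Cauchy-Schwarz inequality. Let
    w be critical, P = \int w^-4, and let u be another element of H(M). If E(w)
    or P vanishes, then D(w) = 0 <= D(u). Otherwise the Euler-Lagrange equation
    says that the energy form of w and phi is (E(w) / P) \int w^-5 phi, so that
      ((E(w) / P) \int w^-5 phi)^2 <= E(w) E(phi)
    for every smooth phi ([energy_CS]). Approximating u in H^1 by positive smooth
    functions phi ([approx_pos]) extends this to u ([critical_bound]):
      \int w^-5 u <= P sqrt (E(u) / E(w)).
    On the other hand, integrating the arithmetic-geometric inequality
    5 w^-4 <= 4 t w^-5 u + t^-4 u^-4 and optimizing the constant t > 0 gives
    P^5 <= (\int w^-5 u)^4 \int u^-4 ([amgm_integral]). Both together yield
    P E(w)^2 <= E(u)^2 \int u^-4, which is the square of D(w) <= D(u).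

    Two points require work. First, w^-5 is merely integrable, while phi tends to
    u in L^1 rather than uniformly; the limit is therefore taken with
    min (w^-5, K) in place of w^-5, and K tends to infinity by monotone
    convergence ([truncated_integral_le]).

    Second, E is defined with a chosen weak gradient, so the expansion of
    E(w + s phi) as a quadratic polynomial in s rests on the uniqueness of weak
    gradients ([weak_grad_unique]). Suppose that smooth v_n tend to 0 in L^2 and
    that grad v_n tends to Z in L^2. Work in a cube contained in a chart, let d_n
    be the partial derivative of v_n in the direction b, let z be the component b
    of the covector dual to Z, and let eta be a quadratic polynomial, positive in
    the cube, that vanishes on the two faces orthogonal to the direction b.
    Integration by parts gives
      \int eta d_n d_m = - \int (eta d_n)_b v_m,
    where the subscript denotes the partial derivative. Letting m tend to
    infinity, \int eta d_n z = 0; letting n tend to infinity, \int eta z^2 = 0.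
    Hence z = 0 almost everywhere. Integrals in the cube and on the manifold are
    compared through the bounds of the Riemannian density ([le_integral_chart]). *)

(** * Calculus of C^k functions on open sets of R^4 *)

Section calculus.
Context {R : realType}.
Notation V := 'rV[R]_4.
Implicit Types (f g : V -> R) (W : set V) (p q h : V) (b d : 'I_4).

Lemma norm_coord_le h b : `|h 0 b| <= `|h|.
Proof.
rewrite [leRHS]/Num.Def.normr /= mx_normrE.
exact: (le_bigmax _ (fun ij : 'I_1 * 'I_4 => `|h ij.1 ij.2|) (0, b)).
Qed.

Lemma norm_row_le h (r : R) : 0 <= r -> (forall b, `|h 0 b| <= r) -> `|h| <= r.
Proof.
move=> r0 hr; rewrite [leLHS]/Num.Def.normr /= mx_normrE bigmax_le// => -[i j] _.
by rewrite ord1.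
Qed.

Lemma open_near_eq W f g p : open W -> W p -> (forall q, W q -> f q = g q) ->
  {near p, f =1 g}.
Proof.
move=> oW Wp fg; have : nbhs p W by rewrite nbhsE; exists W.
by move=> nW; near=> q; apply: fg; near: q; exact: nW.
Unshelve. all: by end_near.
Qed.

Lemma partial_eq_on W f g b : open W -> (forall q, W q -> f q = g q) ->
  forall q, W q -> partial b f q = partial b g q.
Proof. by move=> oW fg q Wq; apply/near_eq_derive/(open_near_eq oW Wq fg). Qed.

Lemma partials_rcons (s : seq 'I_4) b f :
  partials (rcons s b) f = partials s (partial b f).
Proof. by rewrite /partials foldr_rcons. Qed.

Lemma partials_eq_on W f g s : open W -> (forall q, W q -> f q = g q) ->
  forall q, W q -> partials s f q = partials s g q.
Proof. by move=> oW fg; elim: s => //= b s IH; exact: partial_eq_on. Qed.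

Lemma near_eq_continuous (T : topologicalType) (f g : T -> R) (p : T) : {near p, f =1 g} ->
  {for p, continuous f} -> {for p, continuous g}.
Proof.
move=> fg fp; rewrite /prop_for /continuous_at -(nbhs_singleton fg).
exact: cvg_trans (near_eq_cvg fg) fp.
Qed.

Lemma Ck_on_eq k W f g : open W -> (forall q, W q -> f q = g q) ->
  Ck_on k W f -> Ck_on k W g.
Proof.
move=> oW fg fk s p Wp; have [c1 d1] := fk s p Wp.
have fgs := open_near_eq oW Wp (partials_eq_on s oW fg).
split=> [sk|sk b]; first exact: near_eq_continuous (c1 sk).
exact: near_eq_derivable (d1 sk b).
Qed.

Lemma Ck_on0 W f : Ck_on 0 W f <-> forall p, W p -> {for p, continuous f}.
Proof.
split=> [f0 p Wp|cf [|//] p Wp]; first by have [/(_ isT)] := f0 [::] p Wp.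
by split=> // _; exact: cf.
Qed.

(** The induction step of all the closure properties below: [Ck_on] speaks of
    iterated derivatives, which are regrouped by the innermost one. *)
Lemma Ck_onS k W f : Ck_on k.+1 W f <->
  [/\ forall p, W p -> {for p, continuous f},
      forall p, W p -> forall b, derivable f p (delta_mx 0 b) &
      forall b, Ck_on k W (partial b f)].
Proof.
split=> [fk|[cf df fk] s p Wp].
  split=> [p Wp|p Wp b|b s p Wp]; first by have [/(_ isT)] := fk [::] p Wp.
    by have [_ /(_ isT)] := fk [::] p Wp.
  have := fk (rcons s b) p Wp; rewrite partials_rcons size_rcons => -[c1 d1].
  by split.
case/lastP: s => [|s b]; first by split=> _; [exact: cf|exact: df].
by have := fk b s p Wp; rewrite partials_rcons size_rcons !ltnS.
Qed.

Lemma Ck_on_leq k l W f : (k <= l)%N -> Ck_on l W f -> Ck_on k W f.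
Proof.
move=> kl fl s p Wp; have [c1 d1] := fl s p Wp.
by split=> sk; [apply: c1|apply: d1]; apply: leq_trans sk kl.
Qed.

Lemma Ck_on_continuous k W f p : Ck_on k W f -> W p -> {for p, continuous f}.
Proof. by move=> /(Ck_on_leq (leq0n k))/Ck_on0; apply. Qed.

Lemma Ck_on_derivable k W f p b : Ck_on k.+1 W f -> W p ->
  derivable f p (delta_mx 0 b).
Proof. by case/Ck_onS => _ /[swap] _ df Wp; exact: df. Qed.

Lemma Ck_on_partial k W f b : Ck_on k.+1 W f -> Ck_on k W (partial b f).
Proof. by case/Ck_onS. Qed.

Lemma partial_cst (r : R) b : partial b (fun=> r : R) = (fun=> 0) :> (V -> R).
Proof. by apply/funext => p; rewrite /partial derive_cst. Qed.

Lemma Ck_on_cst k W (r : R) : Ck_on k W (fun=> r).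
Proof.
elim: k r => [|k IH] r; first by apply/Ck_on0 => p _; exact: cst_continuous.
apply/Ck_onS; split=> [p _|p _ b|b]; [exact: cst_continuous|exact: derivable_cst|].
by rewrite partial_cst.
Qed.

Lemma Ck_onD k W f g : open W -> Ck_on k W f -> Ck_on k W g ->
  Ck_on k W (fun p => f p + g p).
Proof.
move=> oW; elim: k f g => [|k IH] f g.
  by move=> /Ck_on0 cf /Ck_on0 cg; apply/Ck_on0 => p Wp; apply: continuousD; auto.
move=> /Ck_onS[cf df pf] /Ck_onS[cg dg pg]; apply/Ck_onS; split=> [p Wp|p Wp b|b].
- by apply: continuousD; auto.
- by apply: derivableD; auto.
- apply: (Ck_on_eq oW) (IH _ _ (pf b) (pg b)) => q Wq.
  by rewrite /partial -deriveD; auto.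
Qed.

Lemma Ck_onM k W f g : open W -> Ck_on k W f -> Ck_on k W g ->
  Ck_on k W (fun p => f p * g p).
Proof.
move=> oW; elim: k f g => [|k IH] f g.
  by move=> /Ck_on0 cf /Ck_on0 cg; apply/Ck_on0 => p Wp; apply: continuousM; auto.
move=> fS gS; move: (fS) (gS) => /Ck_onS[cf df pf] /Ck_onS[cg dg pg].
have fk := Ck_on_leq (leqnSn k) fS; have gk := Ck_on_leq (leqnSn k) gS.
apply/Ck_onS; split=> [p Wp|p Wp b|b].
- by apply: continuousM; auto.
- by apply: derivableM; auto.
- apply: (Ck_on_eq oW) (Ck_onD oW (IH _ _ fk (pg b)) (IH _ _ gk (pf b))) => q Wq.
  by rewrite /partial deriveM; auto.
Qed.

(** Restricting f to the line through p with direction h reduces this to the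
    chain rule in one variable. *)
Lemma derive_comp1 (g : R -> R) f p h (dg : R) :
  derivable f p h -> is_derive (f p) 1 g dg ->
  is_derive p h (g \o f) (dg * 'D_h f p).
Proof.
move=> df dgE; pose F (t : R) := f (t *: h + p).
have dF : derivable F 0 1 by exact: (derivable1P _ _ _).1 df.
have F0 : F 0 = f p by rewrite /F scale0r add0r.
have DE (k : V -> R) : 'D_1 (fun t : R => k (t *: h + p)) 0 = 'D_h k p.
  rewrite /derive; suff -> : (fun t : R => t^-1 *: (((fun t : R =>
      k (t *: h + p)) \o shift 0) (t%:A) - k (0 *: h + p))) =
    (fun t : R => t^-1 *: ((k \o shift p) (t *: h) - k p)) by [].
  by apply/funext => t /=; rewrite scale0r add0r addr0 [_%:A]mulr1.
have dgF : is_derive (F 0) 1 g dg by rewrite F0.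
have dFi : is_derive (0 : R) 1 F ('D_h f p) by rewrite -DE; exact: derivableP.
have [H1 H2] := is_derive1_comp dgF dFi.
apply: DeriveDef; first exact: (derivable1P _ _ _).2 H1.
by rewrite -H2 -DE.
Qed.

(** Regularization of the absolute value. The reciprocal [r] of
    sqrt (f^2 + e^2) satisfies d r = - f (d f) r^3, so that its regularity
    climbs one derivative at a time. *)
Definition rabs (e t : R) : R := Num.sqrt (t ^+ 2 + e ^+ 2).

Lemma rabs_arg_gt0 (e t : R) : 0 < e -> 0 < t ^+ 2 + e ^+ 2.
Proof. by move=> e0; rewrite ltr_wpDl ?sqr_ge0// exprn_gt0. Qed.

Lemma rabs_gt0 (e t : R) : 0 < e -> 0 < rabs e t.
Proof. by move=> e0; rewrite sqrtr_gt0 rabs_arg_gt0. Qed.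

Lemma is_derive_rabs (e t : R) : 0 < e ->
  is_derive t 1 (rabs e) (t * (rabs e t)^-1).
Proof.
move=> e0; have a0 := rabs_arg_gt0 t e0.
have d1 : is_derive t 1 (fun t : R => t ^+ 2 + e ^+ 2) (2 * t).
  by apply: is_derive_eq; rewrite addr0 -mulr_natl /GRing.scale /= mulr1; ring.
have d2 := is_derive1_sqrt a0.
have H := @is_derive1_comp _ Num.sqrt (fun t => t ^+ 2 + e ^+ 2) _ _ _ d2 d1; apply: (is_derive_eq H).
by rewrite -/(rabs e t); field; rewrite (gt_eqF (rabs_gt0 t e0)).
Qed.

Lemma is_derive_rabsV (e t : R) : 0 < e ->
  is_derive t 1 (fun t => (rabs e t)^-1) (- t * (rabs e t)^-1 ^+ 3).
Proof.
move=> e0; have r0 := rabs_gt0 t e0; have d1 := is_derive_rabs t e0.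
have d2 := is_deriveV (lt0r_neq0 r0) d1.
apply: (is_derive_eq d2); rewrite /GRing.scale /=.
by field; rewrite (gt_eqF r0).
Qed.

Lemma Ck_on_rabsV (e : R) k W f : 0 < e -> open W -> Ck_on k W f ->
  Ck_on k W (fun p => (rabs e (f p))^-1).
Proof.
move=> e0 oW; elim: k => [|k IH] fk.
  apply/Ck_on0 => p /(Ck_on_continuous fk) fp.
  apply: (continuous_comp (g := fun t => (rabs e t)^-1)) => //.
  apply/differentiable_continuous/derivable1_diffP.
  by have [] := is_derive_rabsV (f p) e0.
have dr p b : W p -> is_derive p (delta_mx 0 b) (fun p => (rabs e (f p))^-1)
    (- f p * (rabs e (f p))^-1 ^+ 3 * partial b f p).
  move=> Wp; have := is_derive_rabsV (f p) e0.
  by apply: derive_comp1 => //; exact: Ck_on_derivable fk Wp.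
have fk' := Ck_on_leq (leqnSn k) fk; have rk := IH fk'.
apply/Ck_onS; split=> [p Wp|p Wp b|b].
- apply: (continuous_comp (g := fun t => (rabs e t)^-1)).
    exact: Ck_on_continuous fk Wp.
  apply/differentiable_continuous/derivable1_diffP.
  by have [] := is_derive_rabsV (f p) e0.
- by have [] := dr p b Wp.
- pose G p := -1 * f p * ((rabs e (f p))^-1 * ((rabs e (f p))^-1 *
      (rabs e (f p))^-1)) * partial b f p.
  apply: (@Ck_on_eq k W G) => // [q Wq|].
    have [_] := dr q b Wq; rewrite /partial => ->.
    by rewrite /G /partial; ring.
  have pk := Ck_on_partial b fk.
  exact (Ck_onM oW (Ck_onM oW (Ck_onM oW (Ck_on_cst k (-1)) fk')
    (Ck_onM oW rk (Ck_onM oW rk rk))) pk).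
Qed.

(** A smooth approximation of the positive part that is positive everywhere and
    has slope at most 1: composing with it makes the smooth approximants of a
    positive function positive without enlarging their gradients. *)
Definition rpos (e t : R) : R := 2^-1 * (t + rabs e t).

Lemma Ck_on_rpos (e : R) k W f : 0 < e -> open W -> Ck_on k W f ->
  Ck_on k W (fun p => rpos e (f p)).
Proof.
move=> e0 oW fk.
(* rabs is the product of its square, a polynomial, and its reciprocal. *)
pose G p := 2^-1 * (f p + (f p * f p + e ^+ 2) * (rabs e (f p))^-1).
apply: (@Ck_on_eq k W G) => // [q Wq|].
  rewrite /G /rpos; congr (_ * (_ + _)).
  rewrite -expr2 -[X in X / _]sqr_sqrtr ?ltW ?rabs_arg_gt0// -/(rabs e (f q)).
  by field; rewrite (gt_eqF (rabs_gt0 (f q) e0)).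
have rk := Ck_on_rabsV e0 oW fk.
exact (Ck_onM oW (Ck_on_cst k _) (Ck_onD oW fk (Ck_onM oW
  (Ck_onD oW (Ck_onM oW fk fk) (Ck_on_cst k _)) rk))).
Qed.

Definition drpos (e t : R) : R := 2^-1 * (1 + t * (rabs e t)^-1).

Lemma partial_rpos (e : R) f p b : 0 < e -> derivable f p (delta_mx 0 b) ->
  partial b (fun p => rpos e (f p)) p = drpos e (f p) * partial b f p.
Proof.
move=> e0 df; have d1 : is_derive (f p) 1 (rpos e) (drpos e (f p)).
  have d0 := is_derive_rabs (f p) e0.
  apply: is_derive_eq; rewrite /drpos /GRing.scale /=. by [].
by have [_] := derive_comp1 df d1.
Qed.

Lemma rabs_ge (e t : R) : `|t| <= rabs e t.
Proof. by rewrite -sqrtr_sqr ler_wsqrtr// lerDl sqr_ge0. Qed.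

Lemma rabs_le (e t : R) : 0 < e -> rabs e t <= `|t| + e.
Proof.
move=> e0; rewrite -[leRHS]ger0_norm ?addr_ge0 ?(ltW e0)// -sqrtr_sqr ler_wsqrtr//.
by rewrite sqrrD -normrX ger0_norm ?sqr_ge0// lerD2r lerDl mulrn_wge0// mulr_ge0// ltW.
Qed.

Lemma drpos_bound (e t : R) : 0 < e -> 0 <= drpos e t <= 1.
Proof.
move=> e0; have r0 := rabs_gt0 t e0.
have : `|t * (rabs e t)^-1| <= 1.
  by rewrite normrM normfV (gtr0_norm r0) ler_pdivrMr// mul1r rabs_ge.
by rewrite /drpos ler_norml => /andP[? ?]; apply/andP; split; lra.
Qed.

Lemma rpos_gt0 (e t : R) : 0 < e -> 0 < rpos e t.
Proof.
move=> e0; rewrite /rpos mulr_gt0 ?invr_gt0//.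
have : `|t| < rabs e t.
  by rewrite -sqrtr_sqr ltr_sqrt ?rabs_arg_gt0// ltrDl exprn_gt0.
by rewrite ltr_norml => /andP[h _]; rewrite -ltrBlDl sub0r ltrNl.
Qed.

(** For t < 0 the value of [rpos] is at most e / 2, and s is nonnegative. *)
Lemma rpos_dist (e t s : R) : 0 < e -> 0 <= s -> `|rpos e t - s| <= e + `|t - s|.
Proof.
move=> e0 s0; move: (rabs_le t e0) (rabs_ge e t); rewrite /rpos.
have [t0|t0] := lerP 0 t.
  move=> h1 h2; rewrite (ger0_norm t0) in h1 h2.
  have [ts|ts] := lerP 0 (t - s); rewrite ?(ger0_norm ts) ?(ltr0_norm ts);
    by rewrite ler_norml; apply/andP; split; lra.
have ts : t - s < 0 by lra.
move=> h1 h2; rewrite (ltr0_norm t0) in h1 h2.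
by rewrite (ltr0_norm ts) ler_norml; apply/andP; split; lra.
Qed.

End calculus.

(** * The chain rule in several variables *)

Section chain_rule.
Context {R : realType}.
Notation V := 'rV[R]_4.
Implicit Types (f : V -> R) (W : set V) (p q h : V) (b d : 'I_4).

Lemma cont_sum (T : topologicalType) (I : Type) (r : seq I) (P : pred I)
    (F : I -> T -> R) (x : T) : (forall i, {for x, continuous (F i)}) ->
  {for x, continuous (fun y => \sum_(i <- r | P i) F i y)}.
Proof.
move=> cF; elim: r => [|i r IH].
  rewrite (_ : (fun y => _) = fun=> 0); first exact: cst_continuous.
  by apply/funext => y; rewrite big_nil.
case Pi: (P i); last first.
  rewrite (_ : (fun y => _) = fun y => \sum_(j <- r | P j) F j y) //.
  by apply/funext => y; rewrite big_cons Pi.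
rewrite (_ : (fun y => _) = fun y => F i y + \sum_(j <- r | P j) F j y); last first.
  by apply/funext => y; rewrite big_cons Pi.
exact: (continuousD (cF i) IH).
Qed.

Lemma cont_prod (T : topologicalType) (I : Type) (r : seq I) (P : pred I)
    (F : I -> T -> R) (x : T) : (forall i, {for x, continuous (F i)}) ->
  {for x, continuous (fun y => \prod_(i <- r | P i) F i y)}.
Proof.
move=> cF; elim: r => [|i r IH].
  rewrite (_ : (fun y => _) = fun=> 1); first exact: cst_continuous.
  by apply/funext => y; rewrite big_nil.
case Pi: (P i); last first.
  rewrite (_ : (fun y => _) = fun y => \prod_(j <- r | P j) F j y) //.
  by apply/funext => y; rewrite big_cons Pi.
rewrite (_ : (fun y => _) = fun y => F i y * \prod_(j <- r | P j) F j y); last first.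
  by apply/funext => y; rewrite big_cons Pi.
exact: (continuousM (cF i) IH).
Qed.

Lemma mvt_from0 (F : R -> R) (x : R) :
  (forall t, `|t| <= `|x| -> derivable F t 1) ->
  exists2 c, `|c| <= `|x| & F x - F 0 = 'D_1 F c * x.
Proof.
move=> dF; have cF (i : interval R) : {subset i <= `[(- `|x|), `|x|]} ->
    {within [set` i], continuous F}.
  move=> ix; apply: derivable_within_continuous => t /ix; rewrite in_itv /= => xt.
  by apply: dF; rewrite ler_norml.
have [x0|x0] := lerP 0 x.
  have [||c] := @MVT_segment R F ('D_1 F) 0 x x0.
  - move=> t; rewrite in_itv /= => /andP[t0 tx]; apply: derivableP; apply: dF.
    by rewrite (ger0_norm x0) (ger0_norm (ltW t0)) ltW.
  - apply: cF => t; rewrite !in_itv /= (ger0_norm x0) => /andP[t0 tx].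
    by apply/andP; split=> //; apply: le_trans t0; rewrite oppr_le0.
  - rewrite in_itv /= => /andP[c0 cx] ->; exists c; last by rewrite subr0.
    by rewrite !ger0_norm.
have [||c] := @MVT_segment R F ('D_1 F) x 0 (ltW x0).
- move=> t; rewrite in_itv /= => /andP[xt t0]; apply: derivableP; apply: dF.
  by rewrite (ltr0_norm x0) (ltr0_norm t0) lerN2 ltW.
- apply: cF => t; rewrite !in_itv /= (ltr0_norm x0) opprK => /andP[xt t0].
  by apply/andP; split=> //; apply: le_trans t0 _; rewrite oppr_ge0 ltW.
- rewrite in_itv /= => /andP[xc c0]; rewrite sub0r mulrN => E; exists c.
    by rewrite (ltr0_norm x0) (ler0_norm c0) lerN2.
  by rewrite -opprB E opprK.
Qed.

Lemma derive_line f p v (t : R) :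
  'D_1 (fun s : R => f (s *: v + p)) t = 'D_v f (t *: v + p).
Proof.
rewrite /derive; suff -> : (fun h : R => h^-1 *: (((fun s : R =>
    f (s *: v + p)) \o shift t) (h%:A) - f (t *: v + p))) =
  (fun h : R => h^-1 *: ((f \o shift (t *: v + p)) (h *: v) - f (t *: v + p))) by [].
by apply/funext => h /=; rewrite [_%:A]mulr1 scalerDl addrA.
Qed.

Lemma derivable_line f p v (t : R) :
  derivable f (t *: v + p) v -> derivable (fun s : R => f (s *: v + p)) t 1.
Proof.
rewrite /derivable; suff -> : (fun h : R => h^-1 *: (((fun s : R =>
    f (s *: v + p)) \o shift t) (h%:A) - f (t *: v + p))) =
  (fun h : R => h^-1 *: ((f \o shift (t *: v + p)) (h *: v) - f (t *: v + p))) by [].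
by apply/funext => h /=; rewrite [_%:A]mulr1 scalerDl addrA.
Qed.

(** First-order expansion of a C^1 function: going from p to p + h one
    coordinate at a time, the mean value theorem applies on each of the four
    edges, and all of them stay in the ball of radius |h| around p. *)
Lemma C1_expansion W f p (e : R) : open W -> Ck_on 1 W f -> W p -> 0 < e ->
  \forall h \near (0 : V),
    `|f (p + h) - f p - \sum_b h 0 b * partial b f p| <= e * `|h|.
Proof.
move=> oW f1 Wp e0; have e4 : 0 < e / 4 by rewrite divr_gt0.
have : \forall q \near p, W q /\
    forall b, `|partial b f p - partial b f q| <= e / 4.
  apply: filterI; first by rewrite nbhsE; exists W.
  apply: (@filter_forall _ _ (fun b q => `|partial b f p - partial b f q| <= e / 4)
    (nbhs p) (nbhs_filter p)) => b.
  have /cvgrPdist_le := Ck_on_continuous (Ck_on_partial b f1) Wp.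
  exact.
move=> /nbhs_normP[r /= r0 rP]; apply/nbhs_normP; exists r => //= h hr.
have {}hr : `|h| < r by rewrite -normrN -[- h]sub0r.
pose S k : V := \row_b (if (b < k)%N then h 0 b else 0).
have S0 : S 0%N = 0 by apply/rowP => b; rewrite !mxE.
have S4 : S 4%N = h by apply/rowP => b; rewrite !mxE ltn_ord.
have SS b : S b.+1 = h 0 b *: delta_mx 0 b + S b.
  apply/rowP => d; rewrite !mxE eqxx /= ltnS leq_eqVlt.
  have [/val_inj->|db] := eqVneq (val d) (val b); first by rewrite eqxx ltnn mulr1 addr0.
  have -> : (d == b) = false by apply/negbTE; apply: contraNneq db => ->.
  by rewrite mulr0 add0r.
have -> : f (p + h) - f p = \sum_(b < 4) (f (p + S b.+1) - f (p + S b)).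
  rewrite -(big_mkord xpredT (fun k => f (p + S k.+1) - f (p + S k))).
  by rewrite (telescope_sumr (fun k => f (p + S k)))// S4 S0 addr0.
rewrite -sumrB; apply: le_trans (ler_norm_sum _ _ _) _.
have -> : e * `|h| = \sum_(b < 4) (e / 4 * `|h|).
  by rewrite sumr_const card_ord -mulr_natl; field.
apply: ler_sum => b _.
have inball (c : R) : `|c| <= `|h 0 b| ->
    `|p - (c *: delta_mx 0 b + (p + S b))| < r.
  move=> ch; apply: le_lt_trans hr; rewrite addrCA opprD addNKr normrN.
  apply: norm_row_le => // d; rewrite !mxE eqxx /=.
  have [->|db] := eqVneq d b; first by rewrite ltnn addr0 mulr1 (le_trans ch)// norm_coord_le.
  by rewrite mulr0 add0r; case: ifP => _; rewrite ?normr0 ?norm_coord_le.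
have [t tb|c cb] := @mvt_from0 (fun t => f (t *: delta_mx 0 b + (p + S b))) (h 0 b).
  apply: (derivable_line (f := f)); have [Wt _] := rP _ (inball t tb).
  exact: Ck_on_derivable b f1 Wt.
rewrite derive_line scale0r add0r addrCA -SS => ->.
rewrite mulrC -mulrBr normrM mulrC distrC.
apply: ler_pM => //; last exact: norm_coord_le.
by have [_ /(_ b)] := rP _ (inball c cb).
Qed.

(** By the expansion above, the linear form given by the partial derivatives is
    the differential. *)
Lemma C1_differentiable W f p : open W -> Ck_on 1 W f -> W p ->
  differentiable f p /\
  forall h, 'd f p h = \sum_b h 0 b * partial b f p.
Proof.
move=> oW f1 Wp; pose L (h : V) : R := \sum_b h 0 b * partial b f p.
have L_lin : linear L.
  move=> c u v; rewrite /L scaler_sumr -big_split; apply: eq_bigr => b _ /=.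
  by rewrite !mxE mulrDl /GRing.scale /= mulrA.
pose Lm := GRing.isLinear.Build _ _ _ _ _ L_lin.
pose Ll : {linear V -> R} := HB.pack L Lm.
have cL : continuous (Ll : V -> R).
  move=> h; apply: cont_sum => b.
  by apply: continuousM; [exact: coord_continuous|exact: cst_continuous].
have fE : f \o shift p = cst (f p) + Ll +o_ (0 : V) id.
  apply/eqaddoP => e e0; have := C1_expansion oW f1 Wp e0.
  apply: filterS => h; rewrite /= => H; rewrite opprD addrA.
  rewrite -[X in `|X|]/(f (h + p) - f p - L h) [h + p]addrC.
  exact: H.
have dE := diff_unique cL fE.
split; last by move=> h; rewrite dE.
by apply/diff_locallyP; rewrite dE; split.
Qed.

Lemma partial_comp W f p b (k : V -> V) : open W -> Ck_on 1 W f -> W (k p) ->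
  (forall d, derivable (fun q => k q 0 d) p (delta_mx 0 b)) ->
  partial b (f \o k) p = \sum_d partial b (fun q => k q 0 d) p * partial d f (k p).
Proof.
move=> oW f1 Wk dk; have [df dfE] := C1_differentiable oW f1 Wk.
pose g (t : R) : V := k (t *: delta_mx 0 b + p).
have g0 : g 0 = k p by rewrite /g scale0r add0r.
have dk' : derivable k p (delta_mx 0 b).
  by apply/derivable_mxP => i j; rewrite ord1.
have dg : derivable g 0 1 by apply: (derivable1P _ _ _).1.
have Dg : 'D_1 g 0 = \row_d partial b (fun q => k q 0 d) p.
  rewrite derive_mx//; apply/rowP => d; rewrite !mxE.
  by rewrite (derive_line (fun q => k q 0 d)) scale0r add0r.
rewrite /partial -{1}[p]add0r -{1}(scale0r (delta_mx 0 b)) -(derive_line (f \o k)).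
rewrite -derive1E -[(fun s : R => _)]/(f \o g).
have dg' : differentiable g 0 by apply/derivable1_diffP.
rewrite -g0 in df dfE; rewrite derive1E'; last exact: differentiable_comp.
rewrite diff_comp//= dfE; apply: eq_bigr => d _; rewrite g0.
by rewrite -derive1E' // derive1E Dg mxE.
Qed.

End chain_rule.

(** * Symmetric positive definite matrices *)

Section posdef.
Context {R : realType} {n : nat}.
Implicit Types (G : 'M[R]_n) (u v w : 'rV[R]_n).

Definition bil G u v : R := (u *m G *m v^T) 0 0.

Lemma bilDl G u v w : bil G (u + v) w = bil G u w + bil G v w.
Proof. by rewrite /bil !mulmxDl mxE. Qed.

Lemma bilDr G u v w : bil G u (v + w) = bil G u v + bil G u w.
Proof. by rewrite /bil linearD mulmxDr mxE. Qed.

Lemma bilZl G s u v : bil G (s *: u) v = s * bil G u v.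
Proof. by rewrite /bil -!scalemxAl mxE. Qed.

Lemma bilZr G s u v : bil G u (s *: v) = s * bil G u v.
Proof. by rewrite /bil linearZ -scalemxAr mxE. Qed.

Lemma bilBl G u v w : bil G (u - v) w = bil G u w - bil G v w.
Proof. by rewrite -scaleN1r bilDl bilZl mulN1r. Qed.

Lemma bilBr G u v w : bil G u (v - w) = bil G u v - bil G u w.
Proof. by rewrite -scaleN1r bilDr bilZr mulN1r. Qed.

Lemma bilC G u v : G^T = G -> bil G u v = bil G v u.
Proof.
move=> Gs; rewrite /bil -[in LHS](trmxK (u *m G *m v^T)) mxE.
by rewrite !trmx_mul trmxK Gs mulmxA.
Qed.

Definition posdef G := forall v, v != 0 -> 0 < bil G v v.

Lemma posdef_ge0 G v : posdef G -> 0 <= bil G v v.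
Proof.
move=> Gp; have [->|v0] := eqVneq v 0; last exact/ltW/Gp.
by rewrite /bil !mul0mx mxE.
Qed.

Lemma posdef_eq0 G v : posdef G -> bil G v v = 0 -> v = 0.
Proof. by move=> Gp; apply: contra_eq => /Gp/gt_eqF ->. Qed.

Lemma posdef_CS G u v : G^T = G -> posdef G ->
  bil G u v ^+ 2 <= bil G u u * bil G v v.
Proof.
move=> Gs Gp; have [->|v0] := eqVneq v 0.
  by rewrite /bil trmx0 !mulmx0 mxE mulr0 expr0n.
have qv := Gp _ v0; pose s := bil G u v / bil G v v.
have := posdef_ge0 (u - s *: v) Gp.
rewrite bilBl !bilBr !bilZl !bilZr (bilC v u Gs).
have -> : s * (s * bil G v v) = s * bil G u v by rewrite /s; field; rewrite gt_eqF.
rewrite subrr subr0 subr_ge0 /s => H.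
by rewrite expr2 -ler_pdivrMr// -mulrAC.
Qed.

Lemma idmx_posdef : posdef (1%:M).
Proof.
move=> v v0; rewrite /bil mulmx1 mxE.
have [i vi] : exists i, v 0 i != 0.
  apply/existsP; apply: contraNT v0 => /existsPn H; apply/eqP/rowP => i.
  by have := H i; rewrite negbK mxE => /eqP.
rewrite (bigD1 i)//= mxE -expr2 ltr_wpDr ?exprn_even_gt0 ?vi//.
by apply: sumr_ge0 => j _; rewrite mxE -expr2 sqr_ge0.
Qed.

Lemma posdef_det_neq0 G : posdef G -> \det G != 0.
Proof.
move=> Gp; apply/det0P => -[v v0 vG]; have := Gp v v0.
by rewrite /bil vG mul0mx mxE ltxx.
Qed.

(** The determinant does not vanish along the segment from the identity to G,
    so it keeps the sign that it has at the identity. *)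
Lemma posdef_det_gt0 G : posdef G -> 0 < \det G.
Proof.
move=> Gp; pose A : 'M[{poly R}]_n :=
  \matrix_(i, j) ((i == j)%:R%:P * (1 - 'X) + (G i j)%:P * 'X).
have AE t : (\det A).[t] = \det ((1 - t)%:M + t *: G).
  rewrite -horner_evalE -det_map_mx; congr (\det _); apply/matrixP => i j.
  rewrite !mxE /= /horner_eval !hornerE eq_sym mulrC [t * _]mulrC.
  by rewrite mulr_natr.
have pos t : 0 <= t <= 1 -> \det ((1 - t)%:M + t *: G) != 0.
  move=> /andP[t0 t1]; apply: posdef_det_neq0 => v v0.
  have -> : bil ((1 - t)%:M + t *: G) v v = (1 - t) * bil 1%:M v v + t * bil G v v.
    rewrite /bil mulmxDr mulmxDl mxE -scalemx1 -!scalemxAr -!scalemxAl.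
    by congr (_ + _); rewrite mxE.
  have := Gp v v0; have := idmx_posdef v0; nra.
rewrite ltNge; apply/negP => G0.
have [||t t01 /eqP rt] := @poly_ivt R (- \det A) 0 1.
- by [].
- rewrite !hornerN !AE subr0 scale0r addr0 det1 subrr scale1r.
  by rewrite raddf0 add0r oppr_le0 ler01 oppr_ge0.
- have := pos t t01; rewrite -AE; move: rt; rewrite hornerN => /eqP.
  by rewrite oppr_eq0 => ->.
Qed.

Lemma posdef_unit G : posdef G -> G \in unitmx.
Proof. by move=> Gp; rewrite unitmxE unitfE posdef_det_neq0. Qed.

End posdef.

Section matrix_continuity.
Context {R : realType} {T : topologicalType}.

Lemma cont_det n (A : T -> 'M[R]_n) x :
  (forall i j, {for x, continuous (fun y => A y i j)}) ->
  {for x, continuous (fun y => \det (A y))}.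
Proof.
move=> cA; rewrite /determinant; apply: cont_sum => s.
by apply: continuousM; [exact: cst_continuous|apply: cont_prod => i].
Qed.

(** Cramer's rule. *)
Lemma cont_invmx n (A : T -> 'M[R]_n) x i j : A x \in unitmx ->
  (\forall y \near x, A y \in unitmx) ->
  (forall i j, {for x, continuous (fun y => A y i j)}) ->
  {for x, continuous (fun y => invmx (A y) i j)}.
Proof.
move=> Ax uA cA.
apply: (near_eq_continuous (f := fun y => (\det (A y))^-1 * cofactor (A y) j i)).
  by apply: filterS uA => y uy; rewrite /invmx uy !mxE.
have cd := cont_det cA.
apply: continuousM.
  by apply: continuousV => //; rewrite -unitfE -unitmxE.
rewrite /cofactor; apply: continuousM; first exact: cst_continuous.
apply: cont_det => k l.
rewrite (_ : (fun y => _) = (fun y => A y (lift j k) (lift i l))); first exact: cA.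
by apply/funext => y; rewrite !mxE.
Qed.

End matrix_continuity.

(** * Gradients and inner products on a manifold *)

Section manifold.
Context {R : realType} {M : ptopologicalType} {A : smooth_atlas R M}.
Implicit Types (i j : chart_index A) (x y : M) (v : M -> R).
Notation codom i := (chart i @` dom i).

Lemma dom_nbhs i x : dom i x -> nbhs x (dom i).
Proof. by move=> ix; rewrite nbhsE; exists (dom i) => //; split=> //; exact: open_dom. Qed.

Lemma codom_nbhs i p : codom i p -> nbhs p (codom i).
Proof. by move=> ip; rewrite nbhsE; exists (codom i) => //; split=> //; exact: open_codom. Qed.

Lemma mem_codom i x : dom i x -> codom i (chart i x).
Proof. by move=> ix; exists x. Qed.

Lemma inv_chart_dom i p : codom i p -> dom i (inv_chart i p).
Proof. by case=> x ix <-; rewrite chartK. Qed.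

Lemma inv_chartK i p : codom i p -> chart i (inv_chart i p) = p.
Proof. by case=> x ix <-; rewrite chartK. Qed.

Lemma overlapE i j : chart i @` (dom i `&` dom j) =
  codom i `&` [set p | dom j (inv_chart i p)].
Proof.
apply/seteqP; split=> [_ [x [ix jx] <-]|p [ip jp]].
  by split; [exact: mem_codom|rewrite /= chartK].
by exists (inv_chart i p); [split=> //; exact: inv_chart_dom|exact: inv_chartK].
Qed.

Lemma open_overlap i j : open (chart i @` (dom i `&` dom j)).
Proof.
rewrite overlapE openE => p [ip jp]; apply: filterI; first exact: codom_nbhs.
exact: (continuous_inv_chart ip) (dom_nbhs jp).
Qed.

Lemma Ck_fun_continuous k v : Ck_fun A k v -> continuous v.
Proof.
move=> vk x; pose i := chart_at A x; have ix : dom i x := mem_chart_at A x.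
apply: (near_eq_continuous (f := (v \o inv_chart i) \o chart i)).
  by apply: filterS (dom_nbhs ix) => y iy /=; rewrite chartK.
apply: continuous_comp; first exact: continuous_chart.
exact: Ck_on_continuous (vk i) (mem_codom ix).
Qed.

Lemma Ck_fun_cst k (r : R) : Ck_fun A k (fun=> r).
Proof. by move=> i; exact: Ck_on_cst. Qed.

Lemma Ck_funD k v w : Ck_fun A k v -> Ck_fun A k w -> Ck_fun A k (fun x => v x + w x).
Proof. by move=> vk wk i; apply: Ck_onD (vk i) (wk i); exact: open_codom. Qed.

Lemma Ck_funM k v w : Ck_fun A k v -> Ck_fun A k w -> Ck_fun A k (fun x => v x * w x).
Proof. by move=> vk wk i; apply: Ck_onM (vk i) (wk i); exact: open_codom. Qed.

Lemma smooth_fun_lin v w (s : R) : smooth_fun A v -> smooth_fun A w ->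
  smooth_fun A (fun x => v x + s * w x).
Proof.
by move=> vk wk k; apply: (Ck_funD (vk k)); apply: Ck_funM (wk k); exact: Ck_fun_cst.
Qed.

Lemma smooth_fun_rpos e v : 0 < e -> smooth_fun A v -> smooth_fun A (fun x => rpos e (v x)).
Proof. by move=> e0 vk k i; apply: Ck_on_rpos (vk k i) => //; exact: open_codom. Qed.

(** The components in the chart i of the differential of v. *)
Definition cov v i x : 'rV[R]_4 := \row_b partial b (v \o inv_chart i) (chart i x).

Lemma cov_lin v w (s : R) i x : smooth_fun A v -> smooth_fun A w -> dom i x ->
  cov (fun x => v x + s * w x) i x = cov v i x + s *: cov w i x.
Proof.
move=> vk wk ix; apply/rowP => b; rewrite !mxE.
have dv := Ck_on_derivable (b := b) (vk 1%N i) (mem_codom ix).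
have dw := Ck_on_derivable (b := b) (wk 1%N i) (mem_codom ix).
have := deriveD dv (derivableZ (k := s) dw).
by rewrite deriveZ.
Qed.

Lemma cov_rpos e v i x : 0 < e -> smooth_fun A v -> dom i x ->
  cov (fun x => rpos e (v x)) i x = drpos e (v x) *: cov v i x.
Proof.
move=> e0 vk ix; apply/rowP => b; rewrite !mxE.
have dv := Ck_on_derivable (b := b) (vk 1%N i) (mem_codom ix).
by have := partial_rpos e0 dv; rewrite /= chartK.
Qed.

(** Differentials are covariant: the chain rule for the change of charts. *)
Lemma cov_transition v i j x : smooth_fun A v -> dom i x -> dom j x ->
  cov v i x = cov v j x *m (transition_jac i j x)^T.
Proof.
move=> vk ix jx; apply/rowP => b; rewrite !mxE.
pose k p := chart j (inv_chart i p).
have px : (chart i @` (dom i `&` dom j)) (chart i x) by exists x.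
have kE : k (chart i x) = chart j x by rewrite /k chartK.
rewrite (@partial_eq_on _ _ _ ((v \o inv_chart j) \o k) b (@open_overlap i j) _ _ px).
  rewrite (@partial_comp _ (codom j)).
  - by apply: eq_bigr => d _; rewrite !mxE kE mulrC.
  - exact: open_codom.
  - exact: vk.
  - by rewrite kE; exact: mem_codom.
  - by move=> d; exact: (Ck_on_derivable (@smooth_transition _ _ A i j d 1%N) px).
by move=> q; rewrite overlapE => -[iq jq] /=; rewrite /k chartK.
Qed.

Variable g : riemannian_metric A.
Notation G i x := (gmx g i (chart i x)).
Implicit Types X Y : chart_index A -> M -> 'rV[R]_4.

Lemma gmx_posdef i x : dom i x -> posdef (G i x).
Proof. by move=> ix; exact: pos_gmx (mem_codom ix). Qed.

Lemma gmx_sym i x : dom i x -> (G i x)^T = G i x.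
Proof. by move=> ix; exact: sym_gmx (mem_codom ix). Qed.

Lemma gmx_unit i x : dom i x -> G i x \in unitmx.
Proof. by move=> ix; exact/posdef_unit/gmx_posdef. Qed.

Lemma cont_gmx i b d p : codom i p -> {for p, continuous (fun q => gmx g i q b d)}.
Proof. by move=> ip; exact: Ck_on_continuous (@smooth_gmx _ _ _ g i b d 0%N) ip. Qed.

Lemma cont_ginv i b d p : codom i p ->
  {for p, continuous (fun q => ginv (gmx g i) q b d)}.
Proof.
move=> ip; have unit q : codom i q -> gmx g i q \in unitmx.
  by move=> iq; apply/posdef_unit; exact: pos_gmx.
apply: cont_invmx; first exact: unit.
  by apply: filterS (codom_nbhs ip) => q; exact: unit.
by move=> k l; exact: cont_gmx.
Qed.

Lemma gradE v i x : grad g v i x = cov v i x *m ginv (gmx g i) (chart i x).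
Proof. by []. Qed.

Lemma grad_gmx v i x : dom i x -> grad g v i x *m G i x = cov v i x.
Proof. by move=> ix; rewrite gradE -mulmxA mulVmx ?mulmx1 ?gmx_unit. Qed.

Lemma grad_lin v w (s : R) i x : smooth_fun A v -> smooth_fun A w -> dom i x ->
  grad g (fun x => v x + s * w x) i x = grad g v i x + s *: grad g w i x.
Proof. by move=> *; rewrite !gradE cov_lin// mulmxDl scalemxAl. Qed.

Lemma grad_rpos e v i x : 0 < e -> smooth_fun A v -> dom i x ->
  grad g (fun x => rpos e (v x)) i x = drpos e (v x) *: grad g v i x.
Proof. by move=> *; rewrite !gradE cov_rpos// scalemxAl. Qed.

Lemma grad_vector_field v : smooth_fun A v -> is_vector_field (grad g v).
Proof.
move=> vk i j x ix jx; set J := transition_jac i j x.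
have GE : G i x = J *m G j x *m J^T := gmx_transition g ix jx.
have Ju : J \in unitmx.
  have := gmx_unit ix; rewrite GE !unitmx_mul unitmx_tr => /andP[/andP[]//].
(* The two sides have the same differential: multiply on the right by the
   invertible matrix G j J^T. *)
have GJu : G j x *m J^T \in unitmx by rewrite unitmx_mul gmx_unit// unitmx_tr.
apply: (can_inj (mulmxK GJu)); rewrite mulmxA grad_gmx//.
by rewrite -[RHS]mulmxA [J *m (_ *m _)]mulmxA -GE grad_gmx// (cov_transition vk ix jx).
Qed.

Lemma vector_field_lin X Y (s : R) : is_vector_field X -> is_vector_field Y ->
  is_vector_field (fun i x => X i x + s *: Y i x).
Proof.
by move=> Xv Yv i j x ix jx; rewrite (Xv i j x)// (Yv i j x)// mulmxDl scalemxAl.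
Qed.

(** The Jacobians in the transformation laws of the metric and of the two fields
    cancel. *)
Lemma innerE X Y i x : is_vector_field X -> is_vector_field Y -> dom i x ->
  inner g X Y x = bil (G i x) (X i x) (Y i x).
Proof.
move=> Xv Yv ix; rewrite /inner; set k := chart_at A x.
have kx : dom k x := mem_chart_at A x.
rewrite (gmx_transition g ix kx) /bil -/k (Xv i k x ix kx) (Yv i k x ix kx).
by rewrite trmx_mul !mulmxA.
Qed.

Lemma inner_bil X Y x :
  inner g X Y x = bil (G (chart_at A x) x) (X (chart_at A x) x) (Y (chart_at A x) x).
Proof. by []. Qed.

Let dx x : dom (chart_at A x) x := mem_chart_at A x.

Lemma inner_ge0 X x : 0 <= inner g X X x.
Proof. by rewrite inner_bil posdef_ge0//; exact: gmx_posdef. Qed.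

Lemma inner_sqr_lin X Y (s : R) x :
  inner g (fun i x => X i x + s *: Y i x) (fun i x => X i x + s *: Y i x) x =
  inner g X X x + s * 2 * inner g X Y x + s ^+ 2 * inner g Y Y x.
Proof.
rewrite !inner_bil !(bilDl, bilDr, bilZl, bilZr).
by rewrite (bilC (X _ _) (Y _ _) (gmx_sym (dx x))); ring.
Qed.

Lemma innerZZ X (s : M -> R) x :
  inner g (fun i x => s x *: X i x) (fun i x => s x *: X i x) x =
  s x ^+ 2 * inner g X X x.
Proof. by rewrite !inner_bil bilZl bilZr; ring. Qed.

Lemma eq_inner X X' Y Y' x :
  X (chart_at A x) x = X' (chart_at A x) x -> Y (chart_at A x) x = Y' (chart_at A x) x ->
  inner g X Y x = inner g X' Y' x.
Proof. by rewrite !inner_bil => -> ->. Qed.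

Lemma inner_CS X Y x : inner g X Y x ^+ 2 <= inner g X X x * inner g Y Y x.
Proof. by rewrite !inner_bil posdef_CS ?gmx_sym//; exact: gmx_posdef. Qed.

Lemma inner_le X Y x : `|inner g X Y x| <= inner g X X x + inner g Y Y x.
Proof.
have := inner_CS X Y x; have := inner_ge0 X x; have := inner_ge0 Y x.
set a := inner g X X x; set b := inner g Y Y x; set c := inner g X Y x => a0 b0 h.
rewrite -(@ler_pXn2r _ 2) ?nnegrE ?addr_ge0// -normrX ger0_norm ?sqr_ge0//.
by apply: le_trans h _; nra.
Qed.

(** The Cauchy-Schwarz inequality with the coordinate vector b. It turns
    convergence of fields in norm into convergence of covector components. *)
Lemma inner_component X i x b : is_vector_field X -> dom i x ->
  (X i x *m G i x) 0 b ^+ 2 <= G i x b b * inner g X X x.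
Proof.
move=> Xv ix; rewrite (innerE Xv Xv ix) mulrC.
have E u : (u *m G i x) 0 b = bil (G i x) u (delta_mx 0 b).
  by rewrite /bil trmx_delta -colE !mxE.
have <- : bil (G i x) (delta_mx 0 b) (delta_mx 0 b) = G i x b b.
  by rewrite -E -rowE mxE.
by rewrite E; apply: posdef_CS; [exact: gmx_sym|exact: gmx_posdef].
Qed.

End manifold.

(** * Square-integrable functions *)

Section square_integrable.
Context d (T : measurableType d) (R : realType) (mu : {measure set T -> \bar R}).
Variables (D : set T) (mD : measurable D).
Implicit Types f g h : T -> R.
Notation intble f := (mu.-integrable D (fun x => (f x)%:E)).

Lemma integrable_dom f g : measurable_fun D f -> (forall x, D x -> `|f x| <= g x) ->
  intble g -> intble f.
Proof.
move=> mf fg ig; apply: (le_integrable mD _ _ ig); first exact/measurable_EFinP.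
by move=> x Dx; rewrite /= lee_fin (le_trans (fg x Dx))// ler_norm.
Qed.

Lemma integrable_bounded f (C : R) : (mu D < +oo)%E -> measurable_fun D f ->
  (forall x, D x -> `|f x| <= C) -> intble f.
Proof.
move=> muD mf fC; apply: measurable_bounded_integrable => //.
exists C; split; first exact: num_real.
by move=> y Cy x Dx /=; rewrite (le_trans (fC x Dx))// ltW.
Qed.

Lemma ge0_integrableP f : measurable_fun D f -> (forall x, D x -> 0 <= f x) ->
  (\int[mu]_(x in D) (f x)%:E < +oo)%E -> intble f.
Proof.
move=> mf f0 fy; apply/integrableP; split; first exact/measurable_EFinP.
rewrite (eq_integral (fun x => (f x)%:E))// => x /set_mem Dx.
by rewrite /= ger0_norm// f0.
Qed.

Lemma integral_EFin f : intble f ->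
  (\int[mu]_(x in D) (f x)%:E)%E = (\int[mu]_(x in D) f x)%:E.
Proof. by move=> fi; rewrite /Rintegral fineK//; exact: integrable_fin_num. Qed.

Lemma integrable_add f g : intble f -> intble g -> intble (fun x => f x + g x).
Proof. by move=> fi gi; apply: (integrableD mD fi gi). Qed.

Lemma integrable_scale f (c : R) : intble f -> intble (fun x => c * f x).
Proof. by move=> fi; apply: (integrableZl mD c fi). Qed.

Lemma integrable_mul f g : measurable_fun D f -> measurable_fun D g ->
  intble (fun x => f x ^+ 2) -> intble (fun x => g x ^+ 2) ->
  intble (fun x => f x * g x).
Proof.
move=> mf mg f2 g2; apply: integrable_dom (integrable_add f2 g2).
  exact: measurable_funM.
move=> x _; rewrite normrM -(real_normK (num_real (f x))) -(real_normK (num_real (g x))).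
by have := normr_ge0 (f x); have := normr_ge0 (g x); nra.
Qed.

Lemma integrable_sqrD f g : measurable_fun D f -> measurable_fun D g ->
  intble (fun x => f x ^+ 2) -> intble (fun x => g x ^+ 2) ->
  intble (fun x => (f x + g x) ^+ 2).
Proof.
move=> mf mg f2 g2.
have := integrable_scale 2 (integrable_add f2 g2); apply: integrable_dom.
  by apply: measurable_funX; exact: measurable_funD.
by move=> x _; rewrite ger0_norm ?sqr_ge0//; have := sqr_ge0 (f x - g x); nra.
Qed.

(** Bounds an integral of a product by integrals of squares; the free parameter
    t replaces the square roots of the Cauchy-Schwarz inequality. *)
Lemma integral_young f g (t : R) : 0 < t ->
  measurable_fun D f -> measurable_fun D g ->
  intble (fun x => f x ^+ 2) -> intble (fun x => g x ^+ 2) ->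
  `|\int[mu]_(x in D) (f x * g x)| <=
    t * \int[mu]_(x in D) (f x ^+ 2) + t^-1 * \int[mu]_(x in D) (g x ^+ 2).
Proof.
move=> t0 mf mg f2 g2; have fg := integrable_mul mf mg f2 g2.
have ft := integrable_scale t f2; have gt := integrable_scale t^-1 g2.
apply: (le_trans (le_normr_Rintegral mD fg)).
rewrite -!RintegralZl// -RintegralD//; apply: le_Rintegral => //.
- exact: integrable_norm.
- exact: integrable_add.
- move=> x _; rewrite normrM -(real_normK (num_real (f x))) -(real_normK (num_real (g x))).
  set a := `|f x|; set b := `|g x|; have a0 : 0 <= a := normr_ge0 _.
  have b0 : 0 <= b := normr_ge0 _; have ti : 0 < t^-1 by rewrite invr_gt0.
  have tt : t * t^-1 = 1 by rewrite mulfV// gt_eqF.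
  have := mulr_ge0 (ltW ti) (sqr_ge0 (t * a - b)); set s := t^-1 in ti tt *.
  have -> : s * (t * a - b) ^+ 2 = t * (t * s) * a ^+ 2 - 2 * (t * s) * (a * b) + s * b ^+ 2.
    by ring.
  by rewrite tt; have := mulr_ge0 a0 b0; lra.
Qed.

Lemma Rintegral_eq0_ae f : measurable_fun D f -> (forall x, D x -> 0 <= f x) ->
  intble f -> \int[mu]_(x in D) f x = 0 -> {ae mu, forall x, D x -> f x = 0}.
Proof.
move=> mf f0 fi If; have mfE : measurable_fun D (fun x => (f x)%:E) by exact/measurable_EFinP.
have : ae_eq mu D (fun x => (f x)%:E) (cst 0%E).
  apply/(ae_eq_integral_abs mu mD mfE).
  rewrite (eq_integral (fun x => (f x)%:E)); first by rewrite integral_EFin// If.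
  by move=> x /set_mem Dx; rewrite /= ger0_norm ?f0.
by apply: filterS => x /= fx Dx; have [] := fx Dx.
Qed.

(** Integration against f is continuous in L^2 at 0: apply [integral_young] with
    t so small that the first term is at most e / 2. *)
Lemma integral_mul_small f (e : R) : 0 < e -> measurable_fun D f ->
  intble (fun x => f x ^+ 2) ->
  exists2 del : R, 0 < del & forall g, measurable_fun D g ->
    intble (fun x => g x ^+ 2) -> \int[mu]_(x in D) (g x ^+ 2) <= del ->
    `|\int[mu]_(x in D) (f x * g x)| <= e.
Proof.
move=> e0 mf f2; set F := \int[mu]_(x in D) (f x ^+ 2).
have F0 : 0 <= F by apply: Rintegral_ge0 => x _; exact: sqr_ge0.
pose t := e / (2 * (F + 1)).
have t0 : 0 < t by rewrite divr_gt0// mulr_gt0// ltr_pwDr.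
exists (t * (e / 2)); first by rewrite mulr_gt0// divr_gt0.
move=> g mg g2 gd; apply: le_trans (integral_young t0 mf mg f2 g2) _.
have -> : e = e / 2 + e / 2 by field.
apply: lerD.
  have -> : e / 2 = t * (F + 1) by rewrite /t; field; rewrite gt_eqF// ltr_pwDr.
  by rewrite ler_pM2l// lerDl.
by rewrite ler_pdivrMl.
Qed.

Lemma cvg0_small (F : nat -> T -> R) (e : R) : 0 < e ->
  (forall n x, D x -> 0 <= F n x) ->
  (\int[mu]_(x in D) (F n x)%:E)%E @[n --> \oo] --> 0%E ->
  \forall n \near \oo, (\int[mu]_(x in D) (F n x)%:E < +oo)%E /\
    \int[mu]_(x in D) F n x <= e.
Proof.
move=> e0 F0 /fine_cvgP[fin /cvgrPdist_le/(_ e e0) cv].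
apply: filterS2 fin cv => n Ffin; rewrite sub0r normrN => Fe; split.
  by rewrite ltey_eq Ffin.
by apply: le_trans Fe; exact: ler_norm.
Qed.

End square_integrable.

(** * Lebesgue measure on cubes of R^4 *)

Lemma product_measure_lty d1 d2 (T1 : measurableType d1) (T2 : measurableType d2)
    (R : realType) (m1 : {measure set T1 -> \bar R})
    (m2 : {sigma_finite_measure set T2 -> \bar R}) (A1 : set T1) (A2 : set T2) :
  measurable A1 -> measurable A2 -> (m1 A1 < +oo)%E -> (m2 A2 < +oo)%E ->
  ((m1 \x m2) (A1 `*` A2) < +oo)%E.
Proof.
move=> mA1 mA2 fA1 fA2.
by rewrite [X in (X < _)%E]product_measure1E// lte_mul_pinfty// ge0_fin_numE.
Qed.

Section product_sigma_finite.
Context d1 d2 (T1 : measurableType d1) (T2 : measurableType d2) (R : realType).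
Variables (m1 : {sigma_finite_measure set T1 -> \bar R}).
Variables (m2 : {sigma_finite_measure set T2 -> \bar R}).

(** Carries the sigma-finite structure that Fubini's theorem requires of the
    inner factors when it is iterated over the four coordinates. *)
Definition sigma_finite_product := (m1 \x m2)%E.

HB.instance Definition _ := Measure.on sigma_finite_product.

Let sigma_finite_productT : sigma_finite setT sigma_finite_product.
Proof.
have [F1 F1T F1P] := sigma_finiteT m1; have [F2 F2T F2P] := sigma_finiteT m2.
pose k n : nat * nat := odflt (0, 0)%N (unpickle n).
exists (fun n => F1 (k n).1 `*` F2 (k n).2); last first.
  move=> n; have [mF1 lF1] := F1P (k n).1; have [mF2 lF2] := F2P (k n).2.
  by split; [exact: measurableX|exact: product_measure_lty].
apply/seteqP; split=> // -[x y] _.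
have : setT x by []; rewrite F1T => -[i _ xi].
have : setT y by []; rewrite F2T => -[j _ yj].
by exists (pickle (i, j)) => //; rewrite /k pickleK.
Qed.

HB.instance Definition _ := Measure_isSigmaFinite.Build _ _ _ sigma_finite_product
  sigma_finite_productT.

End product_sigma_finite.

(** Fubini's theorem for functions that are bounded with support in a product
    of sets of finite measure: the two lemmas integrate one factor first. *)
Section fubini_zero.
Context d1 d2 (T1 : measurableType d1) (T2 : measurableType d2) (R : realType).
Variables (m1 : {sigma_finite_measure set T1 -> \bar R}).
Variables (m2 : {sigma_finite_measure set T2 -> \bar R}).
Variables (A1 : set T1) (A2 : set T2) (C : R) (f : T1 * T2 -> R).
Hypotheses (mA1 : measurable A1) (mA2 : measurable A2).
Hypotheses (fA1 : (m1 A1 < +oo)%E) (fA2 : (m2 A2 < +oo)%E).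
Hypotheses (mf : measurable_fun setT f).
Hypothesis f_supp : forall z, `|f z| <= C * \1_(A1 `*` A2) z.

Let fi : (m1 \x m2)%E.-integrable setT (EFin \o f).
Proof.
have mA : measurable (A1 `*` A2) by exact: measurableX.
have Ai : (m1 \x m2)%E.-integrable setT (fun z => (\1_(A1 `*` A2) z)%:E).
  apply/integrableP; split; first exact/measurable_EFinP/measurable_indic.
  rewrite (eq_integral (fun z => (\1_(A1 `*` A2) z)%:E)).
    by rewrite integral_indic// setIT; exact: product_measure_lty.
  by move=> z _; rewrite /= ger0_norm.
apply: (le_integrable measurableT _ _ (integrableZl measurableT C Ai)).
  exact/measurable_EFinP.
by move=> z _; rewrite /= lee_fin (le_trans (f_supp z))// ler_norm.
Qed.

Lemma integral_prod_eq0_fst :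
  (forall y, \int[m1]_x (f (x, y))%:E = 0)%E -> (\int[m1 \x m2]_z (f z)%:E = 0)%E.
Proof.
move=> f0; rewrite -(integral21_prod_meas1 fi) integral0_eq// => y _.
exact: f0.
Qed.

Lemma integral_prod_eq0_snd :
  (forall x, \int[m2]_y (f (x, y))%:E = 0)%E -> (\int[m1 \x m2]_z (f z)%:E = 0)%E.
Proof.
move=> f0; rewrite -(integral12_prod_meas1 fi) integral0_eq// => x _.
exact: f0.
Qed.

End fubini_zero.

Section cubes.
Context {R : realType}.
Notation V := 'rV[R]_4.
Notation T1 := (measurableTypeR R).
Notation T4 := (T1 * T1 * T1 * T1)%type.
Notation leb := (@lebesgue_measure R).
Notation leb4 := (@lebesgue4 R).
Implicit Types (a p : V) (r : R) (b : 'I_4) (q : T4).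

Lemma row4_coord q b : row4 q 0 b =
  nth 0 [:: q.1.1.1; q.1.1.2; q.1.2; q.2] b.
Proof. by case: q => [[[x0 x1] x2] x3]; rewrite /row4 mxE. Qed.

Lemma measurable_row4_coord b : measurable_fun setT (fun q : T4 => row4 q 0 b).
Proof.
under eq_fun do rewrite row4_coord.
case: b => -[|[|[|[|//]]]] ? /=.
- by do ?apply: measurableT_comp => //.
- by do ?apply: measurableT_comp => //.
- by do ?apply: measurableT_comp => //.
- by do ?apply: measurableT_comp => //.
Qed.

(** Balls of the maximum norm. The radius may be any real number, and both
    notions are coordinatewise so that they split as products of intervals. *)
Definition cube a r : set V := [set p | forall b, `|a 0 b - p 0 b| < r].
Definition ccube a r : set V := [set p | forall b, `|a 0 b - p 0 b| <= r].

Lemma measurable_cube a r : measurable (@row4 R @^-1` cube a r : set T4).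
Proof.
have -> : (@row4 R @^-1` cube a r : set T4) =
    \bigcap_(b in [set: 'I_4]) [set q | `|a 0 b - row4 q 0 b| < r].
  by apply/seteqP; split=> [q H b _|q H b]; exact: H.
apply: fin_bigcap_measurable => // b _.
have mb : measurable_fun setT (fun q : T4 => `|a 0 b - row4 q 0 b|).
  apply: measurableT_comp => //; apply: measurable_funB => //.
  exact: measurable_row4_coord.
rewrite (_ : [set q | _] = setT `&` (fun q : T4 => `|a 0 b - row4 q 0 b|) @^-1` `]-oo, r[).
  by apply: mb => //.
by apply/seteqP; split=> [q|q [_]] /=; rewrite in_itv /=.
Qed.

Lemma open_cube_sub (O : set V) p : open O -> O p ->
  exists2 r, 0 < r & cube p r `<=` O.
Proof.
rewrite openE => Oo Op; have /nbhs_ballP[r /= r0 rO] := Oo _ Op.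
exists r => // q pq; apply: rO; split=> // i j; rewrite ord1.
exact: pq.
Qed.

(** An open set is the countable union of the cubes with rational center and
    radius 1 / (n + 1) that it contains. *)
Lemma measurable_row4_open (O : set V) : open O -> measurable (@row4 R @^-1` O : set T4).
Proof.
move=> oO; pose F (c : 'rV[rat]_4 * nat) : set V :=
  cube (map_mx ratr c.1) (c.2.+1%:R^-1).
pose G (c : 'rV[rat]_4 * nat) : set V := if `[< F c `<=` O >] then F c else set0.
have -> : (@row4 R @^-1` O : set T4) = \bigcup_(c in [set: 'rV[rat]_4 * nat]) (@row4 R @^-1` G c).
  apply/seteqP; split=> [q Oq|q [c _]]; last first.
    by rewrite /G /=; case: asboolP => // FO; exact: FO.
  have [r r0 rO] := open_cube_sub oO Oq.
  have [n rn] : exists n : nat, n.+1%:R^-1 + n.+1%:R^-1 < r.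
    have /= := @ltr_add_invr _ 0 (r / 2); rewrite divr_gt0// => /(_ isT)[n].
    by rewrite add0r => nr; exists n; rewrite [ltRHS](splitr r) ltrD.
  pose s : R := n.+1%:R^-1; have s0 : 0 < s by rewrite invr_gt0.
  have cb b : exists c : rat, `|ratr c - row4 q 0 b| < s.
    have [c] := @rat_in_itvoo _ (row4 q 0 b - s) (row4 q 0 b + s) ltac:(lra).
    rewrite in_itv /= => /andP[c1 c2]; exists c; rewrite ltr_norml.
    by apply/andP; split; lra.
  pose c : 'rV[rat]_4 := \row_b projT1 (cid (cb b)).
  exists (c, n) => //=; rewrite /G /=.
  have Fq : F (c, n) (row4 q).
    by move=> b; rewrite !mxE; exact: (projT2 (cid (cb b))).
  rewrite ifT//; apply/asboolP => p Fp; apply: rO => b.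
  rewrite -(subrKA (ratr (c 0 b))) (le_lt_trans (ler_normD _ _))//.
  apply: lt_trans rn; apply: ltrD; last by have := Fp b; rewrite !mxE.
  by rewrite distrC; have := Fq b; rewrite !mxE.
apply: countable_bigcupT_measurable; first exact: countableP.
by move=> c; rewrite /G; case: ifP => _; [exact: measurable_cube|rewrite preimage_set0].
Qed.

Lemma cubeE a r : (@row4 R @^-1` cube a r : set T4) =
  `]a 0 0 - r, a 0 0 + r[ `*` `]a 0 1 - r, a 0 1 + r[ `*`
  `]a 0 2 - r, a 0 2 + r[ `*` `]a 0 3 - r, a 0 3 + r[.
Proof.
have E (x y : R) : (`|x - y| < r) = (y \in `]x - r, x + r[).
  by rewrite distrC ltr_distl in_itv.
apply/seteqP; split=> [[[[x0 x1] x2] x3] H|[[[x0 x1] x2] x3]] /=.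
  have := H 0; have := H 1; have := H 2; have := H 3.
  by rewrite !mxE /= !E.
move=> [[[H0 H1] H2] H3] b; rewrite mxE E.
case: b => -[|[|[|[|//]]]] i /=.
- by rewrite (_ : Ordinal i = 0); last exact/val_inj.
- by rewrite (_ : Ordinal i = 1); last exact/val_inj.
- by rewrite (_ : Ordinal i = 2); last exact/val_inj.
- by rewrite (_ : Ordinal i = 3); last exact/val_inj.
Qed.

Lemma leb_itv_lty (x y : R) : (leb `]x, y[ < +oo)%E.
Proof. by rewrite lebesgue_measure_itv /=; case: ifP => // _; rewrite ltry. Qed.

Lemma leb4_cube_lty a r : (leb4 (@row4 R @^-1` cube a r : set T4) < +oo)%E.
Proof.
rewrite cubeE /lebesgue4.
have mi (x y : R) : measurable (`]x, y[ : set T1) by exact: measurable_itv.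
have H2 := product_measure_lty (mi _ _) (mi _ _) (leb_itv_lty _ _) (leb_itv_lty _ _).
have H3 := product_measure_lty (measurableX (mi _ _) (mi _ _)) (mi _ _) (H2 _ _ _ _) (leb_itv_lty _ _).
exact: product_measure_lty (measurableX (measurableX (mi _ _) (mi _ _)) (mi _ _)) (mi _ _) (H3 _ _ _ _ _ _) (leb_itv_lty _ _).
Qed.

Lemma compact_ccube a r : compact (ccube a r).
Proof.
have := @rV_compact R 4 (fun b => `[a 0 b - r, a 0 b + r]%classic)
  (fun b => @segment_compact _ _ _).
rewrite (_ : [set v : V | _] = ccube a r)//.
by apply/seteqP; split=> v H b; have := H b; rewrite /= in_itv /= distrC ler_distl.
Qed.

Lemma cube_sub_ccube a r : cube a r `<=` ccube a r.
Proof. by move=> p H b; exact/ltW/H. Qed.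

Lemma open_cube a r : open (cube a r).
Proof.
have [r0|r0] := ltP 0 r.
  rewrite (_ : cube a r = ball a r); first exact: ball_open.
  apply/seteqP; split=> [p H|p [_ H] b]; last exact: H.
  by split=> // i j; rewrite ord1; exact: H.
rewrite (_ : cube a r = set0); first exact: open0.
apply/seteqP; split=> // p /(_ 0) H; have := le_lt_trans (normr_ge0 _) H.
by rewrite ltNge r0.
Qed.

Lemma bounded_on_ccube a r (f : V -> R) : 
  (forall p, ccube a r p -> {for p, continuous f}) ->
  exists C, forall p, ccube a r p -> `|f p| <= C.
Proof.
move=> cf; have [C0|C0] := pselect (ccube a r !=set0); last first.
  by exists 0 => p Cp; exfalso; apply: C0; exists p.
have [|c _ cm] := compact_EVT_max C0 (@compact_ccube a r) (f := fun p => `|f p|).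
  apply: continuous_in_subspaceT => p /set_mem Cp.
  by apply: continuous_comp; [exact: cf|exact: norm_continuous].
by exists `|f c| => p Cp; apply: cm; exact/mem_set.
Qed.

End cubes.

(** * The integral of a partial derivative over a cube *)

(** Stated for a map phi under which open sets have measurable preimages: it is
    used both for the Borel sets of the manifold and for [row4], whose target
    carries a topology but no sigma-algebra. *)
Lemma measurable_fun_cont d (T : measurableType d) (S : topologicalType) (R : realType)
    (phi : T -> S) (D : set T) (O : set S) (f : S -> R) :
  (forall U, open U -> measurable (phi @^-1` U)) -> measurable D ->
  (forall x, D x -> O (phi x)) -> open O ->
  (forall s, O s -> {for s, continuous f}) ->
  measurable_fun D (f \o phi).
Proof.
move=> mphi mD DO oO cf; apply: (measurability _ (RGenOpens.measurableE R)) => //.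
move=> _ [_ [a [b ->] <-]].
have oU : open (O `&` f @^-1` `]a, b[).
  rewrite openE => s [Os fs]; apply: filterI; first by rewrite nbhsE; exists O.
  by apply: (cf s Os); rewrite nbhsE; exists `]a, b[%classic => //; split=> //; exact: interval_open.
rewrite (_ : D `&` _ = D `&` phi @^-1` (O `&` f @^-1` `]a, b[)).
  by apply: measurableI => //; exact: mphi.
by apply/seteqP; split=> x [Dx]; [move=> H; split=> //; split=> //; exact: DO|case].
Qed.

Section integration_by_parts.
Context {R : realType}.
Notation V := 'rV[R]_4.
Notation T1 := (measurableTypeR R).
Notation T4 := (T1 * T1 * T1 * T1)%type.
Notation leb := (@lebesgue_measure R).
Notation leb4 := (@lebesgue4 R).
Variables (a : V) (r : R) (W : set V) (H : V -> R) (b : 'I_4).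
Hypotheses (r0 : 0 < r) (oW : open W) (aW : ccube a r `<=` W) (H1 : Ck_on 1 W H).
Hypothesis H0 : forall p, ccube a r p -> `|a 0 b - p 0 b| = r -> H p = 0.

Let D := partial b H.
Let g p : R := D p * \1_(cube a r) p.
Let Q : set T4 := @row4 R @^-1` cube a r.

Let D_cont p : ccube a r p -> {for p, continuous D}.
Proof. by move=> /aW; apply: Ck_on_continuous; exact: Ck_on_partial H1. Qed.

(** The line meets the open cube either not at all or in an interval whose
    endpoints lie on the two faces where H vanishes; the fundamental theorem of
    calculus applies on this interval. *)
Lemma integral_line_eq0 (p : V) : p 0 b = 0 ->
  (\int[leb]_t (g (t *: delta_mx 0 b + p))%:E = 0)%E.
Proof.
move=> pb; pose l (t : R) : V := t *: delta_mx 0 b + p.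
have lb t : l t 0 b = t by rewrite !mxE !eqxx mulr1 pb addr0.
have ld t d : d != b -> l t 0 d = p 0 d.
  by move=> db; rewrite !mxE eqxx (negbTE db) mulr0 add0r.
have [pin|pout] := pselect (forall d, d != b -> `|a 0 d - p 0 d| < r); last first.
  apply: integral0_eq => t _; rewrite /g indicE memNset ?mulr0// => lc.
  by apply: pout => d db; have := lc d; rewrite ld.
set al := a 0 b - r; set be := a 0 b + r.
have albe : al < be by rewrite /al /be ltrD2l (lt_trans _ r0)// oppr_lt0.
have cubel t : cube a r (l t) <-> t \in `]al, be[.
  have -> : (t \in `]al, be[) = (`|a 0 b - t| < r) by rewrite distrC ltr_distl in_itv.
  split=> [/(_ b)|tb d]; first by rewrite lb.
  by have [->|db] := eqVneq d b; [rewrite lb|rewrite ld//; exact: pin].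
have ccubel t : t \in `[al, be] -> ccube a r (l t).
  move=> tb d; have [->|db] := eqVneq d b; last by rewrite ld// ltW// pin.
  by rewrite lb distrC ler_distl; move: tb; rewrite in_itv.
have lc : continuous l.
  by move=> t; apply: cvgD; [exact: scalel_continuous|exact: cvg_cst].
have Dl t : t \in `[al, be] -> {for t, continuous (D \o l)}.
  by move=> /ccubel tc; apply: continuous_comp; [exact: lc|exact: D_cont].
rewrite (_ : (fun t => _) = (fun t => ((D \o l) t)%:E) \_ `]al, be[%classic); last first.
  apply/funext => t; rewrite patchE /g indicE; have [tb|tb] := boolP (t \in `]al, be[).
    by rewrite !mem_set ?mulr1//; exact/cubel.
  rewrite !memNset ?mulr0//; first by apply/negP.
  by move/cubel; exact/negP.
rewrite -integral_mkcond -(integral_itv_bndoo true false); last first.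
  apply/measurable_EFinP; apply: open_continuous_measurable_fun; first exact: interval_open.
  by move=> t /set_mem /= tb; apply: Dl; exact: subset_itv_oo_cc.
pose F t := H (l t).
have dF t : t \in `[al, be] -> derivable F t 1.
  move=> /ccubel/aW tW; apply: (derivable_line (f := H)).
  exact: Ck_on_derivable H1 tW.
have cF t : t \in `[al, be] -> {for t, continuous F}.
  by move=> /dF/derivable1_diffP/differentiable_continuous.
have ale : al \in `[al, be] by rewrite in_itv /= lexx ltW.
have bee : be \in `[al, be] by rewrite in_itv /= lexx ltW.
rewrite (@continuous_FTC2 R (D \o l) F)//.
- have Fend t : `|a 0 b - t| = r -> t \in `[al, be] -> F t = 0.
    by move=> tr tb; apply: H0; [exact: ccubel|rewrite lb].
  rewrite !Fend ?sube0// /al /be.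
    by rewrite subKr gtr0_norm.
  by rewrite opprD addNKr normrN gtr0_norm.
- by apply: continuous_in_subspaceT => t /set_mem /= tb; exact: Dl.
- split.
  + by move=> t tb; apply: dF; exact: subset_itv_oo_cc.
  + by apply: cvg_at_right_filter; exact: cF.
  + by apply: cvg_at_left_filter; exact: cF.
- by move=> t _; rewrite derive1E /F /l derive_line.
Qed.

Let mQ : measurable Q. Proof. exact: measurable_cube. Qed.

Let mDQ : measurable_fun Q (D \o @row4 R).
Proof.
apply: (measurable_fun_cont (O := cube a r)) => //.
- by move=> U oU; exact: measurable_row4_open.
- exact: open_cube.
- by move=> s /cube_sub_ccube; exact: D_cont.
Qed.

Let mg : measurable_fun setT (g \o @row4 R : T4 -> R).
Proof.
rewrite (_ : g \o _ = (D \o @row4 R) \_ Q); first (have := (measurable_restrictT (D \o @row4 R) mQ).1 mDQ; exact).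
apply/funext => q; rewrite patchE /= /g indicE.
have [qQ|qQ] := boolP (q \in Q).
  by rewrite mem_set ?mulr1//; exact: set_mem qQ.
by rewrite memNset ?mulr0// => /mem_set; exact/negP.
Qed.

(** Fubini's theorem, integrating first in the direction b, where each line
    integral is 0 by [integral_line_eq0]. The position of this direction in the
    iterated product measure is different in the four cases for b. *)
Lemma integral_partial_cube : (\int[leb4]_(q in Q) (D (row4 q))%:E = 0)%E.
Proof.
have [C gC] := bounded_on_ccube D_cont.
pose I d : set T1 := `]a 0 d - r, a 0 d + r[%classic.
have mI d : measurable (I d) by exact: measurable_itv.
have fI d : (leb (I d) < +oo)%E := leb_itv_lty _ _.
have C0 : 0 <= C by apply: le_trans (gC a _); rewrite // => d; rewrite subrr normr0 ltW.
have gs q : `|g (row4 q)| <= C * \1_(I 0 `*` I 1 `*` I 2 `*` I 3) q.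
  rewrite /g normrM -cubeE indicE indicE.
  rewrite (_ : (q \in _) = (row4 q \in cube a r)); last exact/idP/idP.
  have [/set_mem/cube_sub_ccube qc|qc] := boolP (row4 q \in cube a r).
    by rewrite normr1 ler_pM2r// gC.
  by rewrite normr0 !mulr0.
rewrite integral_mkcond (_ : _ \_ _ = fun q => (g (row4 q))%:E); last first.
  apply/funext => q; rewrite patchE /= /g indicE.
  have [qQ|qQ] := boolP (q \in Q).
    by rewrite mem_set ?mulr1//; exact: set_mem qQ.
  by rewrite memNset ?mulr0// => /mem_set; exact/negP.
have m1 (z : T1) : measurable_fun setT (fun q => g (row4 (q, z))).
  exact: (measurableT_comp mg (measurable_pair2 z)).
have m2 (y z : T1) : measurable_fun setT (fun q => g (row4 (q, y, z))).
  exact: (measurableT_comp (m1 z) (measurable_pair2 y)).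
have indX (X Y : Type) (A : set X) (B : set Y) z :
    C * \1_(A `*` B) z <= C * \1_A z.1 :> R.
  rewrite ler_wpM2l// !indicE; case: z => x y.
  have [/set_mem[/mem_set Ax _]|_] := boolP ((x, y) \in _); first by rewrite Ax.
  by rewrite ler0n.
have s2 z q : `|g (row4 (q, z))| <= C * \1_(I 0 `*` I 1 `*` I 2) q.
  exact: le_trans (gs _) (indX _ _ _ _ _).
have s1 y z q : `|g (row4 (q, y, z))| <= C * \1_(I 0 `*` I 1) q.
  exact: le_trans (s2 _ _) (indX _ _ _ _ _).
pose leb2 : {sigma_finite_measure set (T1 * T1)%type -> \bar R} :=
  sigma_finite_product leb leb.
pose leb3 : {sigma_finite_measure set (T1 * T1 * T1)%type -> \bar R} :=
  sigma_finite_product leb2 leb.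
have mI2 := measurableX (mI 0) (mI 1); have mI3 := measurableX mI2 (mI 2).
have fI2 : (leb2 (I 0%R `*` I 1%R) < +oo)%E := product_measure_lty (mI 0) (mI 1) (fI 0) (fI 1).
have fI3 : (leb3 (I 0%R `*` I 1%R `*` I 2%R) < +oo)%E := product_measure_lty mI2 (mI 2) fI2 (fI 2).
have line (phi : R -> T4) p : (forall t, row4 (phi t) = t *: delta_mx 0 b + p) ->
    p 0 b = 0 -> (\int[leb]_t (g (row4 (phi t)))%:E = 0)%E.
  by move=> phiE pb; under eq_integral do rewrite phiE; exact: integral_line_eq0.
have rowE (x : T1 * T1 * T1 * T1) d (t : R) (y : T4) :
    (forall d', row4 x 0 d' = if d' == d then t else row4 y 0 d') -> row4 y 0 d = 0 ->
    row4 x = t *: delta_mx 0 d + row4 y.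
  move=> xy yd; apply/rowP => d'; rewrite xy !mxE eqxx /=.
  by case: eqVneq => [->|_]; rewrite ?mulr1 ?mulr0 ?add0r// -/(row4 _ 0 d) yd addr0.
have bcase : [\/ b = 0, b = 1, b = 2 | b = 3].
  case: (b) => -[|[|[|[|//]]]] i; [apply: Or41|apply: Or42|apply: Or43|apply: Or44];
  exact/val_inj.
have row0 (x0 x1 x2 x3 : R) d : row4 (x0, x1, x2, x3) 0 d = nth 0 [:: x0; x1; x2; x3] d.
  by rewrite mxE.
have row_line (phi : R -> T4) : (forall t d, row4 (phi t) 0 d =
      if d == b then t else row4 (phi 0) 0 d) ->
    (\int[leb]_t (g (row4 (phi t)))%:E = 0)%E.
  move=> phiE; have phib : row4 (phi 0) 0 b = 0 by rewrite phiE eqxx.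
  by apply: (line phi (row4 (phi 0))) => // t; apply: rowE.
have ordcase (P : 'I_4 -> Prop) : P 0 -> P 1 -> P 2 -> P 3 -> forall d, P d.
  move=> P0 P1 P2 P3 [[|[|[|[|//]]]] i].
  - by rewrite (_ : Ordinal i = 0)//; exact/val_inj.
  - by rewrite (_ : Ordinal i = 1)//; exact/val_inj.
  - by rewrite (_ : Ordinal i = 2)//; exact/val_inj.
  - by rewrite (_ : Ordinal i = 3)//; exact/val_inj.
rewrite /lebesgue4; case: bcase => bE.
- apply: (@integral_prod_eq0_fst _ _ _ _ _ leb3 leb _ _ _ _ mI3 (mI 3) fI3 (fI 3) mg gs) => z.
  apply: (@integral_prod_eq0_fst _ _ _ _ _ leb2 leb _ _ _ _ mI2 (mI 2) fI2 (fI 2) (m1 z) (s2 z)) => y.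
  apply: (integral_prod_eq0_fst (mI 0) (mI 1) (fI 0) (fI 1) (m2 y z) (s1 y z)) => x.
  apply: (row_line (fun t => (t, x, y, z))) => t.
  by apply: ordcase; rewrite bE !row0.
- apply: (@integral_prod_eq0_fst _ _ _ _ _ leb3 leb _ _ _ _ mI3 (mI 3) fI3 (fI 3) mg gs) => z.
  apply: (@integral_prod_eq0_fst _ _ _ _ _ leb2 leb _ _ _ _ mI2 (mI 2) fI2 (fI 2) (m1 z) (s2 z)) => y.
  apply: (integral_prod_eq0_snd (mI 0) (mI 1) (fI 0) (fI 1) (m2 y z) (s1 y z)) => x.
  apply: (row_line (fun t => (x, t, y, z))) => t.
  by apply: ordcase; rewrite bE !row0.
- apply: (@integral_prod_eq0_fst _ _ _ _ _ leb3 leb _ _ _ _ mI3 (mI 3) fI3 (fI 3) mg gs) => z.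
  apply: (@integral_prod_eq0_snd _ _ _ _ _ leb2 leb _ _ _ _ mI2 (mI 2) fI2 (fI 2) (m1 z) (s2 z)) => -[x y].
  apply: (row_line (fun t => (x, y, t, z))) => t.
  by apply: ordcase; rewrite bE !row0.
- apply: (@integral_prod_eq0_snd _ _ _ _ _ leb3 leb _ _ _ _ mI3 (mI 3) fI3 (fI 3) mg gs) => -[[x y] z].
  apply: (row_line (fun t => (x, y, z, t))) => t.
  by apply: ordcase; rewrite bE !row0.
Qed.

End integration_by_parts.

(** * The Riemannian measure in a chart *)

(** The image under T of the restriction of mu to Q is a measure; comparing it
    with nu on sets is enough to compare the integrals. *)
Lemma le_integral_image d1 d2 (X : measurableType d1) (Y : measurableType d2)
    (R : realType) (mu : {measure set X -> \bar R}) (nu : {measure set Y -> \bar R})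
    (Q : set X) (T : X -> Y) (m : R) (f : Y -> \bar R) :
  measurable Q -> measurable_fun Q T -> 0 < m ->
  (forall B, measurable B -> (m%:E * mu (Q `&` T @^-1` B) <= nu B)%E) ->
  measurable_fun setT f -> (forall y, 0 <= f y)%E ->
  (m%:E * \int[mu]_(x in Q) f (T x) <= \int[nu]_y f y)%E.
Proof.
move=> mQ mT m0 mn mf f0; pose phi x : Y := if x \in Q then T x else point.
have phiE (B : set Y) : Q `&` phi @^-1` B = Q `&` T @^-1` B.
  by apply/seteqP; split=> x [Qx]; rewrite /= /phi mem_set.
have mphi : measurable_fun setT phi.
  move=> _ B mB; rewrite setTI.
  rewrite (_ : phi @^-1` B = (Q `&` T @^-1` B) `|` (~` Q `&` [set _ | B point])).
    apply: measurableU; first exact: mT.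
    apply: measurableI; first exact: measurableC.
    by rewrite -[X in measurable X]setTI; exact: (measurable_cst (point : Y) measurableT mB).
  apply/seteqP; split=> x; rewrite /= /phi.
    by case: ifPn => [/set_mem Qx Bx|/negP Qx Bx]; [left|right; split=> // /mem_set].
  by move=> [[Qx]|[Qx]]; [rewrite mem_set|rewrite memNset].
pose nu' : {measure set Y -> \bar R} :=
  measure_function_pushforward__canonical__measure_function_Measure (mrestr mu mQ) mphi.
have {}mn (B : set Y) : measurable B -> (mscale (NngNum (ltW m0)) nu' B <= nu B)%E.
  by move=> mB; rewrite /mscale /= /nu' /= /pushforward /mrestr setIC phiE mn.
apply: le_trans (ge0_le_measure_integral mn measurableT f0 mf).
rewrite ge0_integral_mscale//= lee_pmul2l// [leRHS](ge0_integral_pushforward mphi)//.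
rewrite preimage_setT.
have mfphi : measurable_fun setT (f \o phi) by exact: measurableT_comp.
rewrite (eq_integral (f \o phi)); last by move=> x xQ; rewrite /= /phi xQ.
rewrite -(@eq_measure_integral _ _ _ Q mu (mrestr mu mQ)); last first.
  by move=> B _ BQ; rewrite /= /mrestr setIidl.
by apply: (@ge0_subset_integral _ _ _ (mrestr mu mQ)) => // x _; exact: f0.
Qed.

Section chart_measure.
Context {R : realType} {M : ptopologicalType} {A : smooth_atlas R M}.
Notation V := 'rV[R]_4.
Notation T1 := (measurableTypeR R).
Notation T4 := (T1 * T1 * T1 * T1)%type.
Notation leb4 := (@lebesgue4 R).
Notation codom i := (chart i @` dom i).

Lemma measurable_borel_open (O : set M) : open O -> measurable (O : set (borel M)).
Proof. by move=> oO; exact: sub_sigma_algebra. Qed.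

Lemma measurable_fun_borel (D : set (borel M)) (f : M -> R) : open (D : set M) ->
  (forall x, D x -> {for x, continuous f}) -> measurable_fun D (f : borel M -> R).
Proof.
move=> oD cf; apply: (@measurable_fun_cont _ _ _ _ (fun x : borel M => x : M) _ D) => //.
- by move=> U oU; exact: measurable_borel_open.
- exact: measurable_borel_open.
Qed.

Variables (g : riemannian_metric A) (vol : {measure set (borel M) -> \bar R}).
Hypothesis volP : is_riemannian_measure g vol.
Variables (i : chart_index A) (a : V) (r : R).
Hypotheses (r0 : 0 < r) (acodom : ccube a r `<=` codom i).

Let Q : set T4 := @row4 R @^-1` cube a r.
Let T (q : T4) : borel M := inv_chart i (row4 q).

Definition chart_cube : set (borel M) := [set x | dom i x /\ cube a r (chart i x)].

Lemma open_chart_cube : open (chart_cube : set M).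
Proof.
rewrite openE => x [ix xc]; apply: filterI; first exact: dom_nbhs.
by apply: continuous_chart ix _ _; rewrite nbhsE; exists (cube a r) => //; split=> //; exact: open_cube.
Qed.

Let mQ : measurable Q. Proof. exact: measurable_cube. Qed.

Let Qcodom q : Q q -> codom i (row4 q).
Proof. by move=> /cube_sub_ccube/acodom. Qed.

Lemma measurable_inv_chart_row4 : measurable_fun Q T.
Proof.
apply: (@measurability _ _ _ _ Q T (@open M)) => // Y [U oU <-].
rewrite (_ : _ `&` _ = @row4 R @^-1` (cube a r `&` inv_chart i @^-1` U)).
  apply: measurable_row4_open; rewrite openE => p [pc pU]; apply: filterI.
    by rewrite nbhsE; exists (cube a r) => //; split=> //; exact: open_cube.
  apply: (@continuous_inv_chart _ _ _ i p); first exact/acodom/cube_sub_ccube.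
  by rewrite nbhsE; exists U.
by apply/seteqP; split.
Qed.

Lemma measurable_preimage_chart (B : set (borel M)) : measurable B ->
  measurable (Q `&` T @^-1` B).
Proof. by move=> mB; exact: measurable_inv_chart_row4. Qed.

Lemma preimage_chart (B : set (borel M)) : B `<=` chart_cube ->
  @row4 R @^-1` (chart i @` B) = Q `&` T @^-1` B.
Proof.
move=> BU; apply/seteqP; split=> [q [x Bx xq]|q [Qq TB]].
  have [ix xc] := BU x Bx; rewrite /= in xq.
  by split; [rewrite /Q /= -xq|rewrite /T /= -xq chartK].
by exists (T q) => //; rewrite inv_chartK//; exact: Qcodom.
Qed.

Lemma chart_cube_T q : Q q -> chart_cube (T q).
Proof.
by move=> Qq; have c := Qcodom Qq; split; [exact: inv_chart_dom|rewrite inv_chartK].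
Qed.

Let del p : R := Num.sqrt (\det (gmx g i p)).

Let del_cont p : codom i p -> {for p, continuous del}.
Proof.
move=> ip; apply: continuous_comp; last exact: sqrt_continuous.
by apply: cont_det => b d; exact: cont_gmx.
Qed.

Let del_gt0 p : codom i p -> 0 < del p.
Proof. by move=> ip; rewrite sqrtr_gt0; apply: posdef_det_gt0; exact: pos_gmx. Qed.

(** The density and its reciprocal are continuous on the compact closed cube. *)
Lemma density_bounds : exists m C : R, [/\ 0 < m, 0 < C &
  forall p, cube a r p -> m <= del p <= C].
Proof.
have ac : ccube a r a by move=> b; rewrite subrr normr0 ltW.
have [C CP] := bounded_on_ccube (fun p pc => del_cont (acodom pc)).
have [c cP] : exists c, forall p, ccube a r p -> `|(del p)^-1| <= c.
  apply: bounded_on_ccube => p /acodom ip.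
  by apply: continuousV; [exact/lt0r_neq0/del_gt0|exact: del_cont].
have c0 : 0 < c.
  by apply: lt_le_trans (cP a ac); rewrite normr_gt0 invr_eq0 gt_eqF// del_gt0//; exact: acodom.
exists c^-1, C; split=> [||p /cube_sub_ccube pc].
- by rewrite invr_gt0.
- by apply: lt_le_trans (CP a ac); rewrite normr_gt0 gt_eqF// del_gt0//; exact: acodom.
have d0 : 0 < del p by exact/del_gt0/acodom.
apply/andP; split; last exact: le_trans (ler_norm _) (CP p pc).
rewrite -[leRHS]invrK lef_pV2 ?posrE ?invr_gt0//.
exact: le_trans (ler_norm _) (cP p pc).
Qed.

Lemma vol_bounds (m C : R) : 0 < m -> 0 < C ->
    (forall p, cube a r p -> m <= del p <= C) ->
  forall B : set (borel M), measurable B -> B `<=` chart_cube ->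
    (m%:E * leb4 (Q `&` T @^-1` B) <= vol B <= C%:E * leb4 (Q `&` T @^-1` B))%E.
Proof.
move=> m0 C0 mC B mB BU; have mS := measurable_preimage_chart mB.
set S := Q `&` T @^-1` B in mS *.
have volE := volP; rewrite /is_riemannian_measure in volE.
rewrite (volE i B mB) => [|x /BU[]//]; rewrite (preimage_chart BU) -/S.
have md : measurable_fun S (fun q : T4 => (del (row4 q))%:E).
  apply/measurable_EFinP; apply: (measurable_fun_cont (O := cube a r)) => //.
  - by move=> U oU; exact: measurable_row4_open.
  - by move=> q [].
  - exact: open_cube.
  - by move=> p /cube_sub_ccube/acodom; exact: del_cont.
rewrite -!(integral_cst leb4 mS); apply/andP; split.
  apply: ge0_le_integral => // [q _|q [Qq _]]; first by rewrite lee_fin ltW.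
  by rewrite lee_fin; case/andP: (mC _ Qq).
apply: ge0_le_integral => // q [Qq _].
by rewrite lee_fin; case/andP: (mC _ Qq).
Qed.

Lemma vol_chart_cube_lty : (vol chart_cube < +oo)%E.
Proof.
have [m [C [m0 C0 mC]]] := density_bounds.
have mU : measurable chart_cube by exact: measurable_borel_open open_chart_cube.
have /andP[_ h] := vol_bounds m0 C0 mC mU (@subset_refl _ _).
apply: le_lt_trans h _; rewrite lte_mul_pinfty ?lee_fin ?ltW//.
apply: le_lt_trans (leb4_cube_lty a r); apply: le_measure; rewrite ?inE//.
exact: measurable_preimage_chart.
Qed.

(** The density is bounded above. *)
Lemma vol_null (B : set (borel M)) : measurable B -> B `<=` chart_cube ->
  leb4 (Q `&` T @^-1` B) = 0%E -> vol B = 0%E.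
Proof.
move=> mB BU B0; have [m [C [m0 C0 mC]]] := density_bounds.
have := vol_bounds m0 C0 mC mB BU; rewrite B0 !mule0 => /andP[_ h].
by apply/eqP; rewrite eq_le h measure_ge0.
Qed.

(** The density is bounded below. *)
Lemma le_integral_chart : exists2 m : R, 0 < m &
  forall f : borel M -> \bar R, measurable_fun setT f -> (forall x, 0 <= f x)%E ->
    (m%:E * \int[leb4]_(q in Q) f (T q) <= \int[vol]_x f x)%E.
Proof.
have [m [C [m0 C0 mC]]] := density_bounds; exists m => // f mf f0.
apply: le_integral_image => // [|B mB]; first exact: measurable_inv_chart_row4.
have mU : measurable chart_cube by exact: measurable_borel_open open_chart_cube.
have mB' : measurable (B `&` chart_cube) by exact: measurableI.
apply: (@le_trans _ _ (vol (B `&` chart_cube))); last first.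
  by apply: le_measure; rewrite ?inE//; exact: subIsetl.
have /andP[+ _] := vol_bounds m0 C0 mC mB' (@subIsetr _ _ _).
apply: le_trans; rewrite lee_pmul2l//; apply: le_measure; rewrite ?inE.
- exact: measurable_preimage_chart.
- exact: measurable_preimage_chart.
- by move=> q [Qq Bq]; split=> //; split=> //; exact: chart_cube_T.
Qed.

End chart_measure.

(** * Measurability and integrability on a compact manifold *)

(** The passage from local to global statements: the open sets of a finite
    subcover are joined one at a time. *)
Lemma compact_open_ind (M : ptopologicalType) (P : set M -> Prop) :
  compact [set: M] -> P set0 ->
  (forall U U', open U -> open U' -> P U -> P U' -> P (U `|` U')) ->
  (forall x, exists U, [/\ open U, U x & P U]) -> P setT.
Proof.
rewrite compact_cover => cM P0 PU Ploc.
pose U x := projT1 (cid (Ploc x)).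
have UP x : [/\ open (U x), U x x & P (U x)] := projT2 (cid (Ploc x)).
have [||D _ DT] := cM M setT U; [by move=> x _; have [] := UP x|by move=> x _; exists x => //; have [] := UP x|].
have -> : [set: M] = \big[setU/set0]_(x <- finmap.enum_fset D) U x.
  apply/seteqP; split=> // x _; have [y yD xy] := DT x I.
  by rewrite -bigcup_seq; exists y.
suff [] : open (\big[setU/set0]_(x <- finmap.enum_fset D) U x) /\
    P (\big[setU/set0]_(x <- finmap.enum_fset D) U x) by [].
elim/big_ind : _ => [|V V' [oV PV] [oV' PV']|x _].
- by split=> //; exact: open0.
- by split; [exact: openU|exact: PU].
- by have [] := UP x.
Qed.

Section compact_manifold.
Context {R : realType} {M : ptopologicalType} {A : smooth_atlas R M}.
Variables (g : riemannian_metric A) (vol : {measure set (borel M) -> \bar R}).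
Hypotheses (volP : is_riemannian_measure g vol) (cM : compact [set: M]).
Notation codom i := (chart i @` dom i).
Notation G i x := (gmx g i (chart i x)).
Implicit Types (i : chart_index A) (x : M) (v : M -> R).
Implicit Types X Y : chart_index A -> M -> 'rV[R]_4.

Lemma cube_chart_at x : exists r : R, [/\ 0 < r,
  ccube (chart (chart_at A x) x) r `<=` codom (chart_at A x) &
  chart_cube (chart_at A x) (chart (chart_at A x) x) r x].
Proof.
set i := chart_at A x; have ix : dom i x := mem_chart_at A x.
have [r r0 rO] := open_cube_sub (@open_codom _ _ A i) (mem_codom ix).
exists (r / 2); split; first by rewrite divr_gt0.
  move=> p pc; apply: rO => b; apply: le_lt_trans (pc b) _.
  by rewrite ltr_pdivrMr// ltr_pMr// ltr1n.
by split=> // b; rewrite subrr normr0 divr_gt0.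
Qed.

Lemma vol_lty : (vol setT < +oo)%E.
Proof.
pose P (U : set M) := (vol (U : set (borel M)) < +oo)%E.
apply: (@compact_open_ind M P) => //.
- by rewrite /P measure0.
- move=> U U' oU oU' PU PU'; apply: le_lt_trans (lte_add_pinfty PU PU').
  by apply: measureU2; exact: measurable_borel_open.
- move=> x; have [r [r0 rc xr]] := cube_chart_at x.
  exists (chart_cube (chart_at A x) (chart (chart_at A x) x) r); split=> //.
    exact: open_chart_cube.
  exact: (vol_chart_cube_lty volP r0 rc).
Qed.

Lemma vol_local_null (N : set (borel M)) : measurable N ->
  (forall i a r, 0 < r -> ccube a r `<=` codom i ->
    vol (N `&` chart_cube i a r) = 0%E) -> vol N = 0%E.
Proof.
move=> mN N0; rewrite -(setIT N).
apply: (@compact_open_ind M (fun U => vol (N `&` (U : set (borel M))) = 0%E)) => //.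
- by rewrite setI0 measure0.
- move=> U U' /measurable_borel_open mU /measurable_borel_open mU' PU PU'.
  rewrite setIUr; apply/eqP; rewrite eq_le measure_ge0 andbT.
  apply: le_trans (measureU2 _ _ _) _; [exact: measurableI|exact: measurableI|].
  by rewrite [X in (X + _)%E]PU [X in (_ + X)%E]PU' adde0.
- move=> x; have [r [r0 rc xr]] := cube_chart_at x.
  exists (chart_cube (chart_at A x) (chart (chart_at A x) x) r); split=> //.
    exact: open_chart_cube.
  exact: N0.
Qed.

Lemma measurable_fun_charts (f : borel M -> R) :
  (forall i, measurable_fun (dom i : set (borel M)) f) -> measurable_fun setT f.
Proof.
move=> mf; apply: (@compact_open_ind M (fun U => measurable_fun (U : set (borel M)) f)) => //.
- exact: measurable_fun_set0.
- move=> U U' /measurable_borel_open mU /measurable_borel_open mU' PU PU'.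
  exact/measurable_funU.
- by move=> x; exists (dom (chart_at A x)); split=> //; [exact: open_dom|exact: mem_chart_at].
Qed.

Lemma measurable_dom i : measurable (dom i : set (borel M)).
Proof. by apply: measurable_borel_open; exact: open_dom. Qed.

Lemma measurable_smooth v : smooth_fun A v -> measurable_fun setT (v : borel M -> R).
Proof.
move=> vs; apply: measurable_fun_borel => [|x _]; first exact: openT.
exact: Ck_fun_continuous (vs 0%N) x.
Qed.

Lemma bounded_continuous (f : M -> R) : continuous f -> exists C, forall x, `|f x| <= C.
Proof.
move=> cf; have [|c _ cm] := compact_EVT_max (ex_intro _ point I) cM (f := fun x => `|f x|).
  apply: continuous_subspaceT => x.
  by apply: continuous_comp; [exact: cf|exact: norm_continuous].
by exists `|f c| => x; apply: cm; exact/mem_set.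
Qed.

Lemma cont_cov v i x b : smooth_fun A v -> dom i x ->
  {for x, continuous (fun y => cov v i y 0 b)}.
Proof.
move=> vs ix; rewrite (_ : (fun y => _) = partial b (v \o inv_chart i) \o chart i); last first.
  by apply/funext => y; rewrite mxE.
apply: continuous_comp; first exact: continuous_chart.
exact: (Ck_on_continuous (Ck_on_partial b (vs 1%N i)) (mem_codom ix)).
Qed.

Lemma cont_grad v i x b : smooth_fun A v -> dom i x ->
  {for x, continuous (fun y => grad g v i y 0 b)}.
Proof.
move=> vs ix; rewrite (_ : (fun y => _) =
    fun y => \sum_d cov v i y 0 d * ginv (gmx g i) (chart i y) d b); last first.
  by apply/funext => y; rewrite gradE mxE.
apply: cont_sum => d; apply: continuousM; first exact: cont_cov.
apply: (@continuous_comp _ _ _ (chart i) (fun p => ginv (gmx g i) p d b)).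
  exact: continuous_chart.
by apply: cont_ginv; exact: mem_codom.
Qed.

Lemma measurable_grad v : smooth_fun A v -> measurable_vector_field (grad g v).
Proof.
move=> vs i b; apply: measurable_fun_borel => [|x]; first exact: open_dom.
exact: cont_grad.
Qed.

Lemma measurable_vector_field_lin X Y (s : R) :
  measurable_vector_field X -> measurable_vector_field Y ->
  measurable_vector_field (fun i x => X i x + s *: Y i x).
Proof.
move=> mX mY i b; rewrite (_ : (fun x => _) = fun x => X i x 0 b + s * Y i x 0 b); last first.
  by apply/funext => x; rewrite !mxE.
by apply: measurable_funD; [exact: mX|apply: measurable_funM; [exact: measurable_cst|exact: mY]].
Qed.

Lemma measurable_gmx i b d : measurable_fun (dom i : set (borel M)) (fun x => G i x b d).
Proof.
apply: measurable_fun_borel => [|x ix]; first exact: open_dom.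
apply: (@continuous_comp _ _ _ (chart i) (fun p => gmx g i p b d)).
  exact: continuous_chart.
by apply: cont_gmx; exact: mem_codom.
Qed.

Lemma measurable_lower X i b : measurable_vector_field X ->
  measurable_fun (dom i : set (borel M)) (fun x => (X i x *m G i x) 0 b).
Proof.
move=> mX; under eq_fun do rewrite mxE.
by apply: measurable_sum => d; apply: measurable_funM; [exact: mX|exact: measurable_gmx].
Qed.

Lemma measurable_inner X Y : is_vector_field X -> is_vector_field Y ->
  measurable_vector_field X -> measurable_vector_field Y ->
  measurable_fun setT (inner g X Y : borel M -> R).
Proof.
move=> Xv Yv mX mY; apply: measurable_fun_charts => i.
apply: (eq_measurable_fun (fun x : borel M => \sum_b (X i x *m G i x) 0 b * Y i x 0 b)).
  move=> x /set_mem ix; rewrite (innerE g Xv Yv ix) /bil mxE.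
  by apply: eq_bigr => b _; rewrite [_^T b 0]mxE.
by apply: measurable_sum => b; apply: measurable_funM; [exact: measurable_lower|exact: mY].
Qed.

Lemma cont_inner_grad v : smooth_fun A v -> continuous (inner g (grad g v) (grad g v)).
Proof.
move=> vs x; set i := chart_at A x; have ix : dom i x := mem_chart_at A x.
have gv := grad_vector_field g vs.
apply: (near_eq_continuous (f := fun y => \sum_b cov v i y 0 b * grad g v i y 0 b)).
  apply: filterS (dom_nbhs ix) => y iy; rewrite (innerE g gv gv iy) /bil grad_gmx// mxE.
  by apply: eq_bigr => b _; rewrite [_^T b 0]mxE.
by apply: cont_sum => b; apply: continuousM; [exact: cont_cov|exact: cont_grad].
Qed.

Notation intble f := (vol.-integrable setT (fun x => (f x)%:E)).

Lemma integrable_continuous (f : M -> R) : continuous f -> intble f.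
Proof.
move=> cf; have [C fC] := bounded_continuous cf.
apply: (integrable_bounded measurableT (C := C)) => //; first exact: vol_lty.
by apply: measurable_fun_borel => [|x _]; [exact: openT|exact: cf].
Qed.

Lemma integrable_smooth_sqr v : smooth_fun A v -> intble (fun x => v x ^+ 2).
Proof.
move=> vs; apply: integrable_continuous => x; rewrite (_ : (fun x => v x ^+ 2) = fun x => v x * v x); last first.
  by apply/funext => y; rewrite expr2.
by apply: continuousM; exact: Ck_fun_continuous (vs 0%N) x.
Qed.

Lemma integrable_grad_sqr v : smooth_fun A v -> intble (inner g (grad g v) (grad g v)).
Proof. by move=> vs; apply: integrable_continuous; exact: cont_inner_grad. Qed.

End compact_manifold.

(** * Uniqueness of the weak gradient *)

Lemma partial_coord (R : realType) (d b : 'I_4) (p : 'rV[R]_4) :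
  derivable (fun q : 'rV[R]_4 => q 0 b) p (delta_mx 0 d) /\
  partial d (fun q : 'rV[R]_4 => q 0 b) p = (b == d)%:R.
Proof.
have did : derivable (id : 'rV[R]_4 -> 'rV[R]_4) p (delta_mx 0 d) by exact: derivable_id.
split; first by have /derivable_mxP := did; exact.
have := derive_mx did; rewrite derive_id => /matrixP/(_ 0 b) H.
transitivity ((delta_mx 0 d : 'rV[R]_4) 0 b); last by rewrite mxE eqxx.
by rewrite H mxE.
Qed.

Lemma Ck_on_coord (R : realType) k (W : set 'rV[R]_4) (b : 'I_4) :
  Ck_on k W (fun p => p 0 b).
Proof.
have cc p : {for p, continuous (fun p : 'rV[R]_4 => p 0 b)} by exact: coord_continuous.
case: k => [|k]; first by apply/Ck_on0.
apply/Ck_onS; split=> // [p _ d|d]; first by case: (partial_coord d b p).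
rewrite (_ : partial d _ = fun=> (b == d)%:R); first exact: Ck_on_cst.
by apply/funext => p; case: (partial_coord d b p).
Qed.

Lemma eq0_small_norm (R : realType) (x : R) : (forall e, 0 < e -> `|x| <= e) -> x = 0.
Proof.
move=> xe; apply/eqP; rewrite -normr_le0; apply/ler_addgt0Pl => e e0.
by rewrite addr0 xe.
Qed.

Section fields.
Context {R : realType} {M : ptopologicalType} {A : smooth_atlas R M}.
Implicit Types X Y : chart_index A -> M -> 'rV[R]_4.

Lemma vector_fieldB X Y : is_vector_field X -> is_vector_field Y ->
  is_vector_field (fun i x => X i x - Y i x).
Proof.
by move=> Xv Yv i j x ix jx; rewrite (Xv i j x)// (Yv i j x)// mulmxBl.
Qed.

Lemma measurable_vector_fieldB X Y : measurable_vector_field X ->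
  measurable_vector_field Y -> measurable_vector_field (fun i x => X i x - Y i x).
Proof.
move=> mX mY i b; rewrite (_ : (fun x => _) = fun x => X i x 0 b - Y i x 0 b); last first.
  by apply/funext => x; rewrite !mxE.
by apply: measurable_funB; [exact: mX|exact: mY].
Qed.

End fields.

(** The smooth functions v n tend to 0 while their gradients tend to Z. In the
    cube of center a and radius r of the chart i, this forces the component b of
    the covector of Z to vanish. *)
Section local_uniqueness.
Context {R : realType} {M : ptopologicalType} {A : smooth_atlas R M}.
Variables (g : riemannian_metric A) (vol : {measure set (borel M) -> \bar R}).
Hypotheses (volP : is_riemannian_measure g vol) (cM : compact [set: M]).
Notation V := 'rV[R]_4.
Notation T1 := (measurableTypeR R).
Notation T4 := (T1 * T1 * T1 * T1)%type.
Notation leb4 := (@lebesgue4 R).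
Notation codom i := (chart i @` dom i).
Notation G i x := (gmx g i (chart i x)).
Variables (Z : chart_index A -> M -> 'rV[R]_4) (v : nat -> M -> R).
Hypotheses (Zv : is_vector_field Z) (mZ : measurable_vector_field Z).
Hypothesis vs : forall n, smooth_fun A (v n).
Hypothesis v0 : (\int[vol]_x ((v n x) ^+ 2)%:E)%E @[n --> \oo] --> 0%E.
Let W n : chart_index A -> M -> 'rV[R]_4 := fun i x => grad g (v n) i x - Z i x.
Hypothesis W0 : (\int[vol]_x (inner g (W n) (W n) x)%:E)%E @[n --> \oo] --> 0%E.

Let Wv n : is_vector_field (W n).
Proof. by apply: vector_fieldB => //; exact: grad_vector_field. Qed.

Let mW n : measurable_vector_field (W n).
Proof. by apply: measurable_vector_fieldB => //; exact: measurable_grad. Qed.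

Variables (i : chart_index A) (a : V) (r : R) (b : 'I_4).
Hypotheses (r0 : 0 < r) (acodom : ccube a r `<=` codom i).
Let Q : set T4 := @row4 R @^-1` cube a r.
Let T (q : T4) : borel M := inv_chart i (row4 q).
Notation intble f := (leb4.-integrable Q (fun q => (f q)%:E)).

Let mQ : measurable Q. Proof. exact: measurable_cube. Qed.
Let fQ : (leb4 Q < +oo)%E. Proof. exact: leb4_cube_lty. Qed.
Let mT : measurable_fun Q T.
Proof. exact: (measurable_inv_chart_row4 acodom). Qed.
Let Tdom q : Q q -> dom i (T q).
Proof. by move=> /cube_sub_ccube/acodom; exact: inv_chart_dom. Qed.
Let chartT q : Q q -> chart i (T q) = row4 q.
Proof. by move=> /cube_sub_ccube/acodom; exact: inv_chartK. Qed.

Let mcompT (F : borel M -> R) : measurable_fun (dom i : set (borel M)) F ->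
  measurable_fun Q (F \o T).
Proof.
move=> mF; apply: (measurable_comp _ _ mF mT); first exact: measurable_dom.
by move=> _ [q Qq <-]; exact: Tdom.
Qed.

(** Smallness in the mean on the manifold is inherited by the cube, at the cost
    of the lower bound m of the density. *)
Lemma chart_small (F : nat -> M -> R) (e : R) : 0 < e ->
  (forall n, measurable_fun setT (F n : borel M -> R)) ->
  (forall n x, 0 <= F n x) ->
  (\int[vol]_x (F n x)%:E)%E @[n --> \oo] --> 0%E ->
  \forall n \near \oo, intble (F n \o T) /\ \int[leb4]_(q in Q) F n (T q) <= e.
Proof.
move=> e0 mF F0 Fcv; have [m m0 mP] := le_integral_chart volP r0 acodom.
have := @cvg0_small _ _ _ vol setT F (m * e) (mulr_gt0 m0 e0) (fun n x _ => F0 n x) Fcv.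
apply: filterS => n [Flty Fe].
have Fi := ge0_integrableP (mF n) (fun x _ => F0 n x) Flty.
have mFn : measurable_fun setT (fun x : borel M => (F n x)%:E) by exact/measurable_EFinP.
have H := mP _ mFn (fun x => F0 n x).
rewrite (integral_EFin measurableT Fi) in H.
have {}H : (\int[leb4]_(q in Q) (F n (T q))%:E <= e%:E)%E.
  by rewrite -(@lee_pmul2l _ m%:E)//; apply: le_trans H _; rewrite -EFinM lee_fin.
have mFT : measurable_fun Q (F n \o T).
  by apply: mcompT; apply: measurable_funS (mF n).
have FTi : intble (F n \o T).
  by apply: ge0_integrableP => //=; apply: le_lt_trans H (ltry _).
by split=> //; move: H; rewrite (integral_EFin mQ FTi) lee_fin.
Qed.

Let fn n : V -> R := v n \o inv_chart i.
Let dn n : V -> R := partial b (fn n).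
(* Vanishes exactly where the coordinate b is at distance r from that of a. *)
Let eta (p : V) : R := r ^+ 2 - (a 0 b - p 0 b) ^+ 2.
Let en n : V -> R := partial b (fun p => eta p * dn n p).
Let z (x : borel M) : R := (Z i x *m G i x) 0 b.

Let dn_cov n q : Q q -> dn n (row4 q) = cov (v n) i (T q) 0 b.
Proof. by move=> Qq; rewrite /cov mxE (chartT Qq). Qed.

Let eta_smooth k : Ck_on k (codom i) eta.
Proof.
have oc := @open_codom _ _ A i.
have cst (c : R) : Ck_on k (codom i) (fun=> c) by exact: Ck_on_cst.
have coord := @Ck_on_coord R k (codom i) b.
have -> : eta = fun p : V => r ^+ 2 + -1 * ((a 0 b + -1 * p 0 b) * (a 0 b + -1 * p 0 b)).
  by apply/funext => p; rewrite /eta; ring.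
have H := Ck_onD oc (cst (a 0 b)) (Ck_onM oc (cst (-1)) coord).
exact (Ck_onD oc (cst (r ^+ 2)) (Ck_onM oc (cst (-1)) (Ck_onM oc H H))).
Qed.

Let fn_smooth n k : Ck_on k (codom i) (fn n). Proof. exact: vs. Qed.
Let dn_smooth n k : Ck_on k (codom i) (dn n).
Proof. exact: Ck_on_partial (fn_smooth n k.+1). Qed.
Let en_smooth n k : Ck_on k (codom i) (en n).
Proof.
apply: Ck_on_partial; apply: Ck_onM; first exact: open_codom.
  exact: eta_smooth.
exact: dn_smooth.
Qed.

Let smooth_Q (h : V -> R) : Ck_on 0 (codom i) h ->
  measurable_fun Q (h \o @row4 R) /\ exists C, forall q, Q q -> `|h (row4 q)| <= C.
Proof.
move=> /Ck_on0 ch; split.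
  apply: (measurable_fun_cont (O := cube a r)) => //.
  - by move=> U oU; exact: measurable_row4_open.
  - exact: open_cube.
  - by move=> s /cube_sub_ccube/acodom; exact: ch.
have [C CP] := bounded_on_ccube (fun p pc => ch p (acodom pc)).
by exists C => q /cube_sub_ccube; exact: CP.
Qed.

Let smooth_Q_int (h : V -> R) : Ck_on 0 (codom i) h ->
  intble (h \o @row4 R) /\ intble (fun q => h (row4 q) ^+ 2).
Proof.
move=> hs; have [mh [C CP]] := smooth_Q hs; split.
  exact: integrable_bounded CP.
apply: (integrable_bounded mQ (C := C ^+ 2)) => //; first exact: measurable_funX.
by move=> q Qq; rewrite normrX lerXn2r ?nnegrE ?(le_trans _ (CP q Qq))// CP.
Qed.

(** No boundary terms appear, because eta vanishes on the two faces orthogonal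
    to the direction b. *)
Let by_parts n m : \int[leb4]_(q in Q) (en n (row4 q) * fn m (row4 q)) =
  - \int[leb4]_(q in Q) (eta (row4 q) * dn n (row4 q) * dn m (row4 q)).
Proof.
pose H p := eta p * dn n p * fn m p.
have oc := @open_codom _ _ A i.
have ed k := Ck_onM oc (eta_smooth k) (dn_smooth n k).
have H1 : Ck_on 1 (codom i) H by exact: Ck_onM oc (ed 1%N) (fn_smooth m 1).
have Hface p : ccube a r p -> `|a 0 b - p 0 b| = r -> H p = 0.
  by move=> _ pr; rewrite /H /eta -(real_normK (num_real (a 0 b - p 0 b))) pr subrr !mul0r.
have := integral_partial_cube r0 acodom H1 Hface.
rewrite (eq_integral (fun q : T4 => (en n (row4 q) * fn m (row4 q) +
    eta (row4 q) * dn n (row4 q) * dn m (row4 q))%:E)); last first.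
  move=> q /set_mem /cube_sub_ccube/acodom Qq; congr (_%:E).
  have := deriveM (Ck_on_derivable (b := b) (ed 1%N) Qq)
    (Ck_on_derivable (b := b) (fn_smooth m 1) Qq).
  by rewrite /partial => ->; rewrite /en /dn /partial /GRing.scale /=; ring.
have i1 : intble (fun q => en n (row4 q) * fn m (row4 q)).
  by have [] := smooth_Q_int (Ck_onM oc (en_smooth n 0) (fn_smooth m 0)).
have i2 : intble (fun q => eta (row4 q) * dn n (row4 q) * dn m (row4 q)).
  by have [] := smooth_Q_int (Ck_onM oc (ed 0%N) (dn_smooth m 0)).
have i3 : intble (fun q => en n (row4 q) * fn m (row4 q) +
    eta (row4 q) * dn n (row4 q) * dn m (row4 q)) by exact: integrable_add.
rewrite (integral_EFin mQ i3) => -[].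
by rewrite RintegralD// => /eqP; rewrite addr_eq0 => /eqP.
Qed.

Let mz : measurable_fun Q (z \o T).
Proof. by apply: mcompT; exact: measurable_lower. Qed.

Let mdn n : measurable_fun Q (dn n \o @row4 R).
Proof. by have [] := smooth_Q (dn_smooth n 0). Qed.

Let fn_small e : 0 < e -> \forall m \near \oo,
  intble (fun q => fn m (row4 q) ^+ 2) /\ \int[leb4]_(q in Q) (fn m (row4 q) ^+ 2) <= e.
Proof.
move=> e0; apply: (@chart_small (fun n x => v n x ^+ 2)) => // [n|n x].
  by apply: measurable_funX; exact: measurable_smooth.
exact: sqr_ge0.
Qed.

(** The components of the gradients converge: [inner_component] bounds them by
    the norms, and the diagonal entries of the metric are bounded in the cube. *)
Let dn_small e : 0 < e -> \forall m \near \oo,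
  intble (fun q => (z (T q) - dn m (row4 q)) ^+ 2) /\
  \int[leb4]_(q in Q) ((z (T q) - dn m (row4 q)) ^+ 2) <= e.
Proof.
move=> e0; have [C0 CP] := bounded_on_ccube (fun p pc => @cont_gmx _ _ _ g i b b p (acodom pc)).
pose C := `|C0| + 1; have Cgt : 0 < C by rewrite ltr_pwDr.
have GC q : Q q -> G i (T q) b b <= C.
  move=> Qq; rewrite chartT//; apply: le_trans (ler_norm _) _.
  apply: le_trans (CP _ (cube_sub_ccube Qq)) _; apply: le_trans (ler_norm _) _.
  by rewrite lerDl.
have mI n : measurable_fun setT (inner g (W n) (W n) : borel M -> R).
  exact: measurable_inner.
have := chart_small (divr_gt0 e0 Cgt) mI (fun n x => inner_ge0 g (W n) x) W0.
apply: filterS => m [Ii Ie].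
have le q : Q q -> (z (T q) - dn m (row4 q)) ^+ 2 <= C * inner g (W m) (W m) (T q).
  move=> Qq; have H := inner_component g b (@Wv m) (Tdom Qq).
  have E : (W m i (T q) *m G i (T q)) 0 b = dn m (row4 q) - z (T q).
    rewrite /W mulmxBl grad_gmx; last exact: Tdom.
    by rewrite mxE -(dn_cov m Qq) mxE.
  rewrite E in H; rewrite -sqrrN opprB; apply: le_trans H _.
  by rewrite ler_wpM2r ?inner_ge0// GC.
have mzd : measurable_fun Q (fun q => (z (T q) - dn m (row4 q)) ^+ 2).
  exact: (measurable_funX 2 (measurable_funB mz (mdn m))).
have Ci := integrable_scale mQ C Ii.
have zi : intble (fun q => (z (T q) - dn m (row4 q)) ^+ 2).
  apply: (integrable_dom mQ mzd _ Ci) => q Qq.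
  by rewrite ger0_norm ?sqr_ge0// le.
split=> //; apply: (@le_trans _ _ (\int[leb4]_(q in Q) (C * inner g (W m) (W m) (T q)))).
  by apply: le_Rintegral => //; exact: le.
by rewrite RintegralZl// -ler_pdivlMl// mulrC.
Qed.

Let z2_int : intble (fun q => z (T q) ^+ 2).
Proof.
have [N _ /(_ _ (leqnn N)) [zi _]] := dn_small ltr01.
have [_ di] := smooth_Q_int (dn_smooth N 0).
have mzd : measurable_fun Q (fun q => z (T q) - dn N (row4 q)) := measurable_funB mz (mdn N).
have := integrable_sqrD mQ mzd (mdn N) zi di.
by under eq_fun do rewrite subrK.
Qed.

(** The limit m -> oo in [by_parts]: dn m tends to z, and fn m to 0. *)
Let eta_dn_z n : \int[leb4]_(q in Q) (eta (row4 q) * dn n (row4 q) * z (T q)) = 0.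
Proof.
have oc := @open_codom _ _ A i.
have eds := Ck_onM oc (eta_smooth 0) (dn_smooth n 0).
have [med _] := smooth_Q eds; have [edi ed2] := smooth_Q_int eds.
have [men _] := smooth_Q (en_smooth n 0); have [eni en2] := smooth_Q_int (en_smooth n 0).
apply: eq0_small_norm => e2 e20.
pose e := e2 / 2; have e0 : 0 < e by rewrite divr_gt0.
have [del1 del10 D1] := integral_mul_small mQ e0 med ed2.
have [del2 del20 D2] := integral_mul_small mQ e0 men en2.
have [m [[zi zs] [fi fs]]] : exists m, (intble (fun q => (z (T q) - dn m (row4 q)) ^+ 2) /\
    \int[leb4]_(q in Q) ((z (T q) - dn m (row4 q)) ^+ 2) <= del1) /\
    (intble (fun q => fn m (row4 q) ^+ 2) /\ \int[leb4]_(q in Q) (fn m (row4 q) ^+ 2) <= del2).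
  have := filterI (dn_small del10) (fn_small del20).
  by move=> [N _ /(_ _ (leqnn N)) ?]; exists N.
have mzd : measurable_fun Q (fun q => z (T q) - dn m (row4 q)) := measurable_funB mz (mdn m).
have [mfm _] := smooth_Q (fn_smooth m 0).
have H1 := D1 _ mzd zi zs; have H2 := D2 _ mfm fi fs.
have i1 : intble (fun q => eta (row4 q) * dn n (row4 q) * (z (T q) - dn m (row4 q))).
  exact: (integrable_mul mQ med mzd ed2 zi).
have i2 : intble (fun q => eta (row4 q) * dn n (row4 q) * dn m (row4 q)).
  by have [] := smooth_Q_int (Ck_onM oc eds (dn_smooth m 0)).
have -> : \int[leb4]_(q in Q) (eta (row4 q) * dn n (row4 q) * z (T q)) =
    \int[leb4]_(q in Q) (eta (row4 q) * dn n (row4 q) * (z (T q) - dn m (row4 q))) +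
    \int[leb4]_(q in Q) (eta (row4 q) * dn n (row4 q) * dn m (row4 q)).
  rewrite -RintegralD//; apply: eq_Rintegral => q _; ring.
rewrite -[X in _ + X]opprK -by_parts (splitr e2).
apply: le_trans (ler_normD _ _) _; rewrite normrN; exact: lerD.
Qed.

(** The limit n -> oo in [eta_dn_z]. *)
Let eta_z2 : \int[leb4]_(q in Q) (eta (row4 q) * z (T q) * z (T q)) = 0.
Proof.
have oc := @open_codom _ _ A i.
have [meta [C etaC]] := smooth_Q (eta_smooth 0).
have mez : measurable_fun Q (fun q => eta (row4 q) * z (T q)) := measurable_funM meta mz.
have ez2 : intble (fun q => (eta (row4 q) * z (T q)) ^+ 2).
  apply: (integrable_dom mQ _ _ (integrable_scale mQ (C ^+ 2) z2_int)).
    exact: measurable_funX.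
  move=> q Qq; rewrite ger0_norm ?sqr_ge0// exprMn ler_wpM2r ?sqr_ge0//.
  rewrite -(real_normK (num_real (eta _))) lerXn2r ?nnegrE ?(le_trans _ (etaC q Qq))//.
apply: eq0_small_norm => e e0.
have [del del0 D] := integral_mul_small mQ e0 mez ez2.
have [N _ /(_ _ (leqnn N)) [zi zs]] := dn_small del0.
have mzd : measurable_fun Q (fun q => z (T q) - dn N (row4 q)) := measurable_funB mz (mdn N).
have i1 : intble (fun q => eta (row4 q) * z (T q) * (z (T q) - dn N (row4 q))).
  exact: (integrable_mul mQ mez mzd ez2 zi).
have [med _] := smooth_Q (Ck_onM oc (eta_smooth 0) (dn_smooth N 0)).
have [_ ed2] := smooth_Q_int (Ck_onM oc (eta_smooth 0) (dn_smooth N 0)).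
have i2 : intble (fun q => eta (row4 q) * dn N (row4 q) * z (T q)).
  exact: (integrable_mul mQ med mz ed2 z2_int).
have -> : \int[leb4]_(q in Q) (eta (row4 q) * z (T q) * z (T q)) =
    \int[leb4]_(q in Q) (eta (row4 q) * z (T q) * (z (T q) - dn N (row4 q))) +
    \int[leb4]_(q in Q) (eta (row4 q) * dn N (row4 q) * z (T q)).
  rewrite -RintegralD//; apply: eq_Rintegral => q _; ring.
by rewrite eta_dn_z addr0; exact: D.
Qed.

(** The integrand of [eta_z2] is nonnegative and eta is positive in the cube, so
    z vanishes almost everywhere there; null sets of the cube are null sets of
    the manifold. *)
Lemma component_null : {ae vol, forall x, chart_cube i a r x ->
  (Z i x *m G i x) 0 b = 0}.
Proof.
have mU : measurable (chart_cube i a r) by exact: measurable_borel_open (open_chart_cube _ _ _).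
have UD : chart_cube i a r `<=` dom i by move=> x [].
have mzU : measurable_fun (chart_cube i a r) z.
  by apply: measurable_funS (measurable_lower g b mZ) => //; exact: measurable_dom.
have mB : measurable (chart_cube i a r `&` [set x | z x != 0]).
  have -> : [set x | z x != 0] = z @^-1` (~` [set 0]).
    by apply/seteqP; split=> x /= /eqP.
  apply: mzU; first exact: mU.
  by apply: measurableC; exact: measurable_set1.
suff B0 : vol (chart_cube i a r `&` [set x | z x != 0]) = 0%E.
  exists (chart_cube i a r `&` [set x | z x != 0]); split=> // x /= H.
  have xc : chart_cube i a r x by apply: contrapT => xc; apply: H.
  by split=> //; apply/eqP => zx; apply: H.
apply: (vol_null volP r0 acodom mB); first exact: subIsetl.
have [meta _] := smooth_Q (eta_smooth 0).
have mf : measurable_fun Q (fun q => eta (row4 q) * z (T q) * z (T q)).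
  exact: (measurable_funM (measurable_funM meta mz) mz).
have eta_gt0 q : Q q -> 0 < eta (row4 q).
  move=> /(_ b) qb; rewrite /eta subr_gt0 -(real_normK (num_real (a 0 b - _))).
  by rewrite ltr_pXn2r ?nnegrE ?normr_ge0 ?(ltW r0).
have f0 q : Q q -> 0 <= eta (row4 q) * z (T q) * z (T q).
  by move=> /eta_gt0 eg; rewrite -mulrA -expr2; exact: mulr_ge0 (ltW eg) (sqr_ge0 _).
have fi : intble (fun q => eta (row4 q) * z (T q) * z (T q)).
  have [C etaC] := (smooth_Q (eta_smooth 0)).2.
  apply: (integrable_dom mQ mf _ (integrable_scale mQ C z2_int)) => q Qq.
  rewrite ger0_norm ?f0// -mulrA -expr2 ler_wpM2r ?sqr_ge0//.
  exact: le_trans (ler_norm _) (etaC q Qq).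
have ae0 := Rintegral_eq0_ae mQ mf f0 fi eta_z2.
apply: measure_negligible; first exact: (measurable_preimage_chart acodom mB).
apply: negligibleS ae0 => q [Qq [_ zq]] /(_ Qq) /eqP.
have zq' : z (T q) != 0 := zq.
by rewrite !mulf_eq0 (negbTE zq') !orbF gt_eqF// eta_gt0.
Qed.

End local_uniqueness.

(** The constant 2 is that of |x + y|^2 <= 2 (|x|^2 + |y|^2). *)
Lemma integral_cvg0_le d (T : measurableType d) (R : realType)
    (mu : {measure set T -> \bar R}) (F G H : nat -> T -> R) :
  (forall n, measurable_fun setT (F n)) -> (forall n, measurable_fun setT (G n)) ->
  (forall n, measurable_fun setT (H n)) -> (forall n x, 0 <= F n x) ->
  (forall n x, 0 <= G n x) -> (forall n x, 0 <= H n x) ->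
  (forall n x, F n x <= 2 * (G n x + H n x)) ->
  (\int[mu]_x (G n x)%:E)%E @[n --> \oo] --> 0%E ->
  (\int[mu]_x (H n x)%:E)%E @[n --> \oo] --> 0%E ->
  (\int[mu]_x (F n x)%:E)%E @[n --> \oo] --> 0%E.
Proof.
move=> mF mG mH F0 G0 H0 FGH Gc Hc.
have mE (f : T -> R) : measurable_fun setT f -> measurable_fun setT (fun x => (f x)%:E).
  by move=> mf; exact/measurable_EFinP.
have leF n : (\int[mu]_x (F n x)%:E <=
    2%:E * (\int[mu]_x (G n x)%:E + \int[mu]_x (H n x)%:E))%E.
  have E : (\int[mu]_x ((G n x)%:E + (H n x)%:E) =
      \int[mu]_x (G n x)%:E + \int[mu]_x (H n x)%:E)%E.
    by apply: ge0_integralD => //; [move=> x _; rewrite lee_fin|exact: mE|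
      move=> x _; rewrite lee_fin|exact: mE].
  have mGH : measurable_fun setT (fun x => (G n x)%:E + (H n x)%:E)%E.
    exact: (mE _ (measurable_funD (mG n) (mH n))).
  rewrite -E -ge0_integralZl//; last by move=> x _; rewrite lee_fin addr_ge0.
  apply: ge0_le_integral => //.
  - by move=> x _; rewrite lee_fin.
  - exact: mE.
  - by apply: (mE (fun x => 2 * (G n x + H n x))); apply: measurable_funM => //; exact: measurable_funD.
  - by move=> x _; rewrite -EFinD -EFinM lee_fin.
apply: (@squeeze_cvge _ _ _ _ (fun=> 0%E) _
  (fun n => (2%:E * (\int[mu]_x (G n x)%:E + \int[mu]_x (H n x)%:E))%E)).
- by near=> n; rewrite leF integral_ge0// => x _; rewrite lee_fin.
- exact: cvg_cst.
- have -> : (0 = 2%:E * (0 + 0) :> \bar R)%E by rewrite adde0 mule0.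
  by apply: cvgeZl => //; apply: cvgeD.
Unshelve. all: by end_near. Qed.

Section weak_gradient.
Context {R : realType} {M : ptopologicalType} {A : smooth_atlas R M}.
Variables (g : riemannian_metric A) (vol : {measure set (borel M) -> \bar R}).
Hypotheses (volP : is_riemannian_measure g vol) (cM : compact [set: M]).
Implicit Types X Y : chart_index A -> M -> 'rV[R]_4.

(** The cubes of charts cover the manifold, and a field vanishes where all the
    components of its covector do. *)
Lemma weak_grad0 X (v : nat -> M -> R) :
  is_vector_field X -> measurable_vector_field X -> (forall n, smooth_fun A (v n)) ->
  (\int[vol]_x ((v n x) ^+ 2)%:E)%E @[n --> \oo] --> 0%E ->
  (\int[vol]_x (inner g (fun i x => grad g (v n) i x - X i x)
                        (fun i x => grad g (v n) i x - X i x) x)%:E)%E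
    @[n --> \oo] --> 0%E ->
  {ae vol, forall x, X (chart_at A x) x = 0}.
Proof.
move=> Xv mX vs v0 W0.
have mI : measurable_fun setT (inner g X X : borel M -> R) by exact: measurable_inner.
have mN : measurable [set x : borel M | inner g X X x != 0].
  have -> : [set x : borel M | inner g X X x != 0] = setT `&` inner g X X @^-1` (~` [set 0]).
    by apply/seteqP; split=> [x /= /eqP|x [_ /= /eqP]].
  by apply: mI => //; apply: measurableC; exact: measurable_set1.
suff N0 : vol [set x : borel M | inner g X X x != 0] = 0%E.
  exists [set x : borel M | inner g X X x != 0]; split=> // x /= Xx.
  apply/negP => /eqP I0; apply: Xx; move: I0; rewrite inner_bil.
  by apply: posdef_eq0; apply: gmx_posdef; exact: mem_chart_at.
apply: (vol_local_null (A := A) cM mN) => i a r r0 acodom.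
apply: measure_negligible.
  by apply: measurableI => //; exact: measurable_borel_open (open_chart_cube _ _ _).
have : {ae vol, forall x, forall b, chart_cube i a r x ->
    (X i x *m gmx g i (chart i x)) 0 b = 0}.
  apply: (@filter_forall _ _ (fun b x => chart_cube i a r x ->
    (X i x *m gmx g i (chart i x)) 0 b = 0)) => b.
  exact: (component_null volP cM Xv mX vs v0 W0 b r0 acodom).
case=> B [mB B0 BP]; exists B; split=> // x [/= Ix xc]; apply: BP => /= H.
have X0 : X i x *m gmx g i (chart i x) = 0.
  by apply/rowP => b; rewrite H// mxE.
have [ix _] := xc; move: Ix.
by rewrite (innerE g Xv Xv ix) /bil X0 mul0mx mxE eqxx.
Qed.

(** Two gradients of the same function: the difference of the two approximating
    sequences tends to 0, while its gradients tend to X - Y. *)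
Lemma weak_grad_unique u X Y : measurable_fun setT (u : borel M -> R) ->
  is_weak_grad g vol u X -> is_weak_grad g vol u Y ->
  {ae vol, forall x, X (chart_at A x) x = Y (chart_at A x) x}.
Proof.
move=> mu [Xv mX [v [vs v0 vX]]] [Yv mY [w [ws w0 wY]]].
pose f n x := v n x + -1 * w n x.
have fs n : smooth_fun A (f n) by exact: smooth_fun_lin.
have mv n : measurable_fun setT (fun x : borel M => (v n x - u x) ^+ 2).
  exact: (measurable_funX 2 (measurable_funB (measurable_smooth (vs n)) mu)).
have mw n : measurable_fun setT (fun x : borel M => (w n x - u x) ^+ 2).
  exact: (measurable_funX 2 (measurable_funB (measurable_smooth (ws n)) mu)).
have gvX n : is_vector_field (fun i x => grad g (v n) i x - X i x).
  by apply: vector_fieldB => //; exact: grad_vector_field.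
have gwY n : is_vector_field (fun i x => grad g (w n) i x - Y i x).
  by apply: vector_fieldB => //; exact: grad_vector_field.
have mvX n : measurable_vector_field (fun i x => grad g (v n) i x - X i x).
  by apply: measurable_vector_fieldB => //; exact: measurable_grad.
have mwY n : measurable_vector_field (fun i x => grad g (w n) i x - Y i x).
  by apply: measurable_vector_fieldB => //; exact: measurable_grad.
have XYv := vector_fieldB Xv Yv; have mXY := measurable_vector_fieldB mX mY.
have gfv n : is_vector_field (fun i x => grad g (f n) i x - (X i x - Y i x)).
  by apply: vector_fieldB => //; exact: grad_vector_field.
have mgf n : measurable_vector_field (fun i x => grad g (f n) i x - (X i x - Y i x)).
  by apply: measurable_vector_fieldB => //; exact: measurable_grad.
have : {ae vol, forall x, X (chart_at A x) x - Y (chart_at A x) x = 0}.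
  apply: (weak_grad0 XYv mXY fs).
  - apply: (integral_cvg0_le _ mv mw _ _ _ _ v0 w0) => [n|n x|n x|n x|n x]; rewrite ?sqr_ge0//.
      by apply: measurable_funX; exact: measurable_smooth.
    rewrite /f; set p := v n x; set q := w n x.
    have := sqr_ge0 ((p - u x) + (q - u x)); rewrite !expr2; lra.
  - apply: (integral_cvg0_le _ _ _ _ _ _ _ vX wY) => [n|n|n|n x|n x|n x|n x]; rewrite ?inner_ge0//.
    + exact: measurable_inner.
    + exact: measurable_inner.
    + exact: measurable_inner.
    pose P i x := grad g (v n) i x - X i x; pose Q i x := grad g (w n) i x - Y i x.
    rewrite -/P -/Q (@eq_inner _ _ _ g _ (fun i x => P i x + -1 *: Q i x) _
      (fun i x => P i x + -1 *: Q i x)); last 2 first.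
    + rewrite grad_lin//; last exact: mem_chart_at.
      by rewrite /P /Q !scaleN1r !opprB addrACA [RHS]addrACA; congr (_ + _); exact: addrC.
    + rewrite grad_lin//; last exact: mem_chart_at.
      by rewrite /P /Q !scaleN1r !opprB addrACA [RHS]addrACA; congr (_ + _); exact: addrC.
    rewrite inner_sqr_lin; have := inner_ge0 g (fun i x => P i x + 1 *: Q i x) x.
    by rewrite inner_sqr_lin; set p := inner g P P x; set q := inner g Q Q x; lra.
move=> [B [mB B0 BP]]; exists B; split=> // x /= H; apply: BP => /= H0; apply: H.
by apply/eqP; rewrite -subr_eq0 H0.
Qed.

End weak_gradient.

(** * Two integral inequalities *)

Lemma measurable_inv (R : realType) : measurable_fun setT (fun x : R => x^-1).
Proof.
have -> : [set: R] = [set x : R | x != 0] `|` [set 0].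
  by apply/seteqP; split=> // x _; have [->|x0] := eqVneq x 0; [right|left].
have o0 : open [set x : R | x != 0].
  have -> : [set x : R | x != 0] = ~` [set 0].
    by apply/seteqP; split=> x /= /eqP.
  by apply: closed_openC; exact: closed_eq.
apply/measurable_funU => //; first exact: open_measurable.
split; last by apply: measurable_fun_set1.
apply: open_continuous_measurable_fun => // x /set_mem x0; exact: inv_continuous.
Qed.

Section integral_inequalities.
Context d (T : measurableType d) (R : realType) (mu : {measure set T -> \bar R}).
Implicit Types f g p q : T -> R.
Notation intble f := (mu.-integrable setT (fun x => (f x)%:E)).

Lemma measurable_funXV f n : measurable_fun setT f -> measurable_fun setT (fun x => f x ^- n).
Proof. by move=> mf; apply: (measurableT_comp (@measurable_inv R)); exact: measurable_funX. Qed.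

Lemma integrable_measurable f : intble f -> measurable_fun setT f.
Proof. by move=> /integrableP[/measurable_EFinP]. Qed.

Lemma integrable_sub f g : intble f -> intble g -> intble (fun x => f x - g x).
Proof. by move=> fi gi; apply: (integrableB measurableT fi gi). Qed.

Lemma ae_imply (P Q : T -> Prop) : (forall x, P x -> Q x) ->
  {ae mu, forall x, P x} -> {ae mu, forall x, Q x}.
Proof. by move=> PQ; apply: filterS. Qed.

Lemma ae_eq_Rintegral f g : intble f -> intble g -> {ae mu, forall x, f x = g x} ->
  \int[mu]_x f x = \int[mu]_x g x.
Proof.
move=> fi gi fg; rewrite /Rintegral; congr fine; apply: ae_eq_integral => //.
- exact: (measurable_int mu fi).
- exact: (measurable_int mu gi).
by apply: filterS fg => x /= ->.
Qed.

Lemma ae_le_Rintegral f g : intble f -> intble g -> {ae mu, forall x, f x <= g x} ->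
  \int[mu]_x f x <= \int[mu]_x g x.
Proof.
move=> fi gi fg.
have hi : intble (fun x => Num.max (f x) (g x)).
  apply: (integrable_dom measurableT _ _ (integrable_add measurableT (integrable_norm fi) (integrable_norm gi))).
    by apply: measurable_maxr; exact: integrable_measurable.
  by move=> x _ /=; case: (leP (f x) (g x)) => _; rewrite ?lerDl ?lerDr.
rewrite -(ae_eq_Rintegral hi gi); last by apply: filterS fg => x fgx; apply/max_idPr.
by apply: le_Rintegral => // x _; rewrite le_max lexx.
Qed.

(** Monotone convergence in K. *)
Lemma truncated_integral_le f g (L : R) :
  measurable_fun setT f -> measurable_fun setT g ->
  (forall x, 0 <= f x) -> (forall x, 0 <= g x) ->
  (forall K, 0 <= K -> intble (fun x => Num.min (f x) K * g x) /\
    \int[mu]_x (Num.min (f x) K * g x) <= L) ->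
  intble (fun x => f x * g x) /\ \int[mu]_x (f x * g x) <= L.
Proof.
move=> mf mg f0 g0 fgL; pose h (n : nat) x := (Num.min (f x) n%:R * g x)%:E.
have mh n : measurable_fun setT (h n).
  apply/measurable_EFinP; apply: measurable_funM => //.
  by apply: measurable_minr => //; exact: measurable_cst.
have h0 n x : setT x -> (0 <= h n x)%E.
  by move=> _; rewrite lee_fin mulr_ge0// le_min f0 ler0n.
have ndh x : setT x -> {homo h^~ x : n m / (n <= m)%N >-> (n <= m)%E}.
  move=> _ n m nm; rewrite lee_fin ler_wpM2r// le_min !ge_min lexx/=.
  by rewrite ler_nat nm orbT.
have hl x : limn (h^~ x) = (f x * g x)%:E.
  apply/cvg_lim => //; apply: cvg_near_cst.
  exists (Num.truncn (f x)).+1 => // n /= fn; rewrite /h; congr (_ * _)%:E.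
  apply/min_idPl; apply: le_trans (ltW (truncnS_gt _)) _.
  by rewrite ler_nat.
have fgE : (\int[mu]_x (f x * g x)%:E <= L%:E)%E.
  rewrite (eq_integral (fun x => limn (h^~ x))); last by move=> x _; rewrite hl.
  have cv := cvg_monotone_convergence (mu := mu) measurableT mh h0 ndh.
  rewrite -(cvg_lim _ cv)//; apply: lime_le; first by apply/cvg_ex; eexists; exact: cv.
  near=> n; have [hi hL] := fgL n%:R (ler0n _ _).
  by rewrite /h integral_EFin// lee_fin.
have fgi : intble (fun x => f x * g x).
  apply: ge0_integrableP => //; first exact: measurable_funM.
    by move=> x _; rewrite mulr_ge0.
  exact: le_lt_trans fgE (ltry _).
by split=> //; move: fgE; rewrite integral_EFin// lee_fin.
Unshelve. all: by end_near. Qed.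

End integral_inequalities.

(** With x = t q / p, this is 4 x^5 - 5 x^4 + 1 >= 0 for x > 0; the polynomial
    has a double root at 1. *)
Lemma amgm5 (R : realFieldType) (p q t : R) : 0 < p -> 0 < q -> 0 < t ->
  5 * p ^- 4 <= 4 * t * (p ^- 5 * q) + t ^- 4 * q ^- 4.
Proof.
move=> p0 q0 t0; pose x := t * q / p.
have x0 : 0 < x by rewrite divr_gt0// mulr_gt0.
have key : 0 <= 4 * x ^+ 5 - 5 * x ^+ 4 + 1.
  have -> : 4 * x ^+ 5 - 5 * x ^+ 4 + 1 =
    (x - 1) ^+ 2 * (4 * x ^+ 3 + 3 * x ^+ 2 + 2 * x + 1) by ring.
  by rewrite mulr_ge0 ?sqr_ge0// !addr_ge0// mulr_ge0// ?exprn_ge0// ltW.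
rewrite -subr_ge0.
have -> : 4 * t * (p ^- 5 * q) + t ^- 4 * q ^- 4 - 5 * p ^- 4 =
   (t * q) ^- 4 * (4 * x ^+ 5 - 5 * x ^+ 4 + 1).
  rewrite /x; field; rewrite ?gt_eqF//.
by apply: mulr_ge0 key; rewrite invr_ge0 exprn_ge0//; exact/ltW/mulr_gt0.
Qed.

(** The best choice is t = P / S. When S = 0, letting t grow contradicts P > 0;
    the value 1 + Q / P is large enough. *)
Lemma optimize_t (R : realFieldType) (P Q S : R) : 0 < P -> 0 <= Q -> 0 <= S ->
  (forall t, 0 < t -> 5 * P <= 4 * t * S + t ^- 4 * Q) -> P ^+ 5 <= S ^+ 4 * Q.
Proof.
move=> P0 Q0; rewrite le_eqVlt => /predU1P[<-|S0] h.
  have t1 : 1 <= 1 + Q / P by rewrite lerDl divr_ge0// ltW.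
  have t0 := lt_le_trans ltr01 t1.
  have := h _ t0; rewrite mulr0 add0r ler_pdivlMl ?exprn_gt0// => H.
  have : (1 + Q / P) * (5 * P) <= Q.
    apply: le_trans H; rewrite ler_pM2r ?mulr_gt0//.
    by rewrite ler_eXnr.
  have -> : (1 + Q / P) * (5 * P) = 5 * P + 5 * Q by field; rewrite gt_eqF.
  lra.
have := h _ (divr_gt0 P0 S0).
have -> : 4 * (P / S) * S = 4 * P by field; rewrite gt_eqF.
have -> : (P / S) ^- 4 * Q = S ^+ 4 * Q / P ^+ 4 by field; rewrite ?gt_eqF.
move=> H; have : P <= S ^+ 4 * Q / P ^+ 4 by lra.
by rewrite ler_pdivlMr ?exprn_gt0// -exprS.
Qed.

(** A form of Hoelder's inequality with exponents 5/4 and 5, deduced from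
    [amgm5]. *)
Lemma amgm_integral d (T : measurableType d) (R : realType)
    (mu : {measure set T -> \bar R}) (p q : T -> R) (S : R) :
  {ae mu, forall x, 0 < p x} -> {ae mu, forall x, 0 < q x} ->
  mu.-integrable setT (fun x => (p x ^- 4)%:E) ->
  mu.-integrable setT (fun x => (q x ^- 4)%:E) ->
  mu.-integrable setT (fun x => (`|p x ^- 5| * `|q x|)%:E) ->
  \int[mu]_x (`|p x ^- 5| * `|q x|) <= S ->
  0 < \int[mu]_x (p x ^- 4) ->
  (\int[mu]_x (p x ^- 4)) ^+ 5 <= S ^+ 4 * \int[mu]_x (q x ^- 4).
Proof.
move=> p0 q0 ip iq ipq pqS P0.
apply: optimize_t => //.
- apply: Rintegral_ge0 => x _; rewrite invr_ge0 exprn_even_ge0//.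
- by apply: le_trans pqS; apply: Rintegral_ge0 => x _; rewrite mulr_ge0.
move=> t t0; apply: (@le_trans _ _
  (4 * t * \int[mu]_x (`|p x ^- 5| * `|q x|) + t ^- 4 * \int[mu]_x (q x ^- 4))); last first.
  by rewrite lerD2r ler_wpM2l// mulr_ge0// ltW.
have i1 := integrable_scale measurableT (4 * t) ipq.
have i2 := integrable_scale measurableT (t ^- 4) iq.
rewrite -!RintegralZl// -RintegralD//; apply: ae_le_Rintegral.
- exact: integrable_scale.
- exact: integrable_add.
apply: filterS2 p0 q0 => x p0 q0.
rewrite (gtr0_norm q0) gtr0_norm ?invr_gt0 ?exprn_gt0//; exact: amgm5.
Qed.

(** * The energy *)

(** Evaluation at the minimum s = - q / r of the quadratic polynomial; for r = 0
    the polynomial is affine and q must vanish. *)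
Lemma discriminant_le (R : realFieldType) (p q r : R) : 0 <= r ->
  (forall s, 0 <= p + s * 2 * q + s ^+ 2 * r) -> q ^+ 2 <= p * r.
Proof.
rewrite le_eqVlt => /predU1P[<-|r0] h.
  have [->|q0] := eqVneq q 0; first by rewrite mulr0 expr0n.
  have := h (- (p + 1) / (2 * q)); rewrite mulr0 addr0.
  have -> : p + - (p + 1) / (2 * q) * 2 * q = -1 by field; rewrite q0.
  by rewrite oppr_ge0 ler10.
have := h (- q / r).
have -> : p + - q / r * 2 * q + (- q / r) ^+ 2 * r = (p * r - q ^+ 2) / r.
  by field; rewrite gt_eqF.
by rewrite pmulr_lge0 ?invr_gt0// subr_ge0.
Qed.

Section energy.
Context {R : realType} {M : ptopologicalType} {A : smooth_atlas R M}.
Variables (g : riemannian_metric A) (vol : {measure set (borel M) -> \bar R}).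
Hypotheses (volP : is_riemannian_measure g vol) (cM : compact [set: M]).
Variables (a c : M -> R).
Hypotheses (sa : smooth_fun A a) (sc : smooth_fun A c).
Implicit Types (u v phi : M -> R) (X Y : chart_index A -> M -> 'rV[R]_4).
Notation intble f := (vol.-integrable setT (fun x => (f x)%:E)).
Notation mfun u := (measurable_fun setT (u : borel M -> R)).

Definition L2_fun u := mfun u /\ intble (fun x => u x ^+ 2).

Definition L2_field X :=
  [/\ is_vector_field X, measurable_vector_field X & intble (inner g X X)].

(** The bilinear form of the energy. The gradients X and Y are arguments because
    weak gradients are only determined up to null sets. *)
Definition form u X v Y : R :=
  \int[vol]_x (a x * inner g X Y x + c x * u x * v x).

Lemma L2_fun_smooth phi : smooth_fun A phi -> L2_fun phi.
Proof. by move=> ps; split; [exact: measurable_smooth|exact: (integrable_smooth_sqr volP cM)]. Qed.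

Lemma L2_field_grad phi : smooth_fun A phi -> L2_field (grad g phi).
Proof.
move=> ps; split; [exact: grad_vector_field|exact: measurable_grad|].
exact: (integrable_grad_sqr volP cM).
Qed.

Lemma integrable_bmul phi (f : M -> R) : smooth_fun A phi -> intble f ->
  intble (fun x => phi x * f x).
Proof.
move=> ps fi; have [C PC] := bounded_continuous cM (Ck_fun_continuous (ps 0%N)).
apply: (integrable_dom measurableT _ _ (integrable_scale measurableT C (integrable_norm fi))).
  exact: (measurable_funM (measurable_smooth ps) (integrable_measurable fi)).
by move=> x _ /=; rewrite normrM ler_wpM2r.
Qed.

Lemma integrable_inner X Y : L2_field X -> L2_field Y -> intble (inner g X Y).
Proof.
move=> [Xv mX Xi] [Yv mY Yi].
apply: (integrable_dom measurableT _ _ (integrable_add measurableT Xi Yi)).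
  exact: measurable_inner.
by move=> x _; exact: inner_le.
Qed.

Lemma integrable_form u X v Y : L2_fun u -> L2_field X -> L2_fun v -> L2_field Y ->
  intble (fun x => a x * inner g X Y x + c x * u x * v x).
Proof.
move=> [mu u2] LX [mv v2] LY; apply: integrable_add => //.
  by apply: integrable_bmul => //; exact: integrable_inner.
rewrite (_ : (fun x => _) = fun x => (c x * (u x * v x))%:E); last first.
  by apply/funext => x; rewrite mulrA.
by apply: integrable_bmul => //; exact: integrable_mul.
Qed.

Lemma form_sqr_lin u X v Y s : L2_fun u -> L2_field X -> L2_fun v -> L2_field Y ->
  form (fun x => u x + s * v x) (fun i x => X i x + s *: Y i x)
       (fun x => u x + s * v x) (fun i x => X i x + s *: Y i x) =
  form u X u X + s * 2 * form u X v Y + s ^+ 2 * form v Y v Y.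
Proof.
move=> Lu LX Lv LY.
have i1 := integrable_form Lu LX Lu LX.
have i2 := integrable_scale measurableT (s * 2) (integrable_form Lu LX Lv LY).
have i3 := integrable_scale measurableT (s ^+ 2) (integrable_form Lv LY Lv LY).
rewrite /form -!RintegralZl//; [|exact: integrable_form..].
rewrite -RintegralD// -RintegralD//; last exact: integrable_add.
by apply: eq_Rintegral => x _; rewrite inner_sqr_lin; ring.
Qed.

Lemma wgradP u : H1 g vol u -> is_weak_grad g vol u (wgrad g vol u).
Proof. by case=> _ _ [X uX]; exact: (xgetPex _ (ex_intro _ X uX)). Qed.

Lemma H1_L2 u : H1 g vol u -> L2_fun u.
Proof.
case=> mu u2 _; split=> //; apply: ge0_integrableP => //.
  exact: measurable_funX.
by move=> x _; exact: sqr_ge0.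
Qed.

(** X is the difference of a gradient of a smooth function and an error term with
    finite norm. *)
Lemma weak_grad_L2 u X : is_weak_grad g vol u X -> L2_field X.
Proof.
move=> [Xv mX [v [vs _ vX]]]; split=> //.
pose Z n i x := grad g (v n) i x - X i x.
have [n _ /(_ _ (leqnn n)) [Zlty _]] := @cvg0_small _ _ _ vol setT
  (fun n => inner g (Z n) (Z n)) 1 ltr01 (fun n x _ => inner_ge0 g (Z n) x) vX.
have gv := grad_vector_field g (vs n); have mg := measurable_grad g (vs n).
have Zv : is_vector_field (Z n) by exact: vector_fieldB.
have mZ : measurable_vector_field (Z n) by exact: measurable_vector_fieldB.
have Zi := ge0_integrableP (measurable_inner g cM Zv Zv mZ mZ) (fun x _ => inner_ge0 g (Z n) x) Zlty.
have gi := integrable_grad_sqr volP cM (vs n).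
apply: (integrable_dom measurableT _ _
  (integrable_scale measurableT 2 (integrable_add measurableT gi Zi))).
  exact: measurable_inner.
move=> x _; rewrite ger0_norm ?inner_ge0//.
pose G := grad g (v n).
rewrite (@eq_inner _ _ _ g _ (fun i x => G i x + -1 *: Z n i x) _
  (fun i x => G i x + -1 *: Z n i x)); last 2 first.
- by rewrite scaleN1r opprB addrC subrK.
- by rewrite scaleN1r opprB addrC subrK.
have := inner_ge0 g (fun i x => G i x + 1 *: Z n i x) x.
rewrite !inner_sqr_lin; set p := inner g G G x; set q := inner g (Z n) (Z n) x; lra.
Qed.

(** By [weak_grad_unique], the choice of the weak gradient does not matter. *)
Lemma energyE u X : H1 g vol u -> is_weak_grad g vol u X ->
  energy g vol a c u = form u X u X.
Proof.
move=> Hu uX; have uW := wgradP Hu; have Lu := H1_L2 Hu.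
have LX := weak_grad_L2 uX; have LW := weak_grad_L2 uW.
rewrite /energy (_ : \int[vol]_x _ = form u (wgrad g vol u) u (wgrad g vol u)); last first.
  by apply: eq_Rintegral => x _; rewrite expr2 mulrA.
apply: ae_eq_Rintegral; [exact: integrable_form|exact: integrable_form|].
apply: ae_imply (weak_grad_unique volP cM Lu.1 uW uX) => x WX.
by rewrite (eq_inner g WX WX).
Qed.

Lemma grad_cst (r : R) i x : grad g (fun=> r) i x = 0.
Proof.
rewrite gradE (_ : cov _ i x = 0) ?mul0mx//; apply/rowP => b; rewrite !mxE.
by rewrite (_ : _ \o _ = fun=> r)// partial_cst.
Qed.

(** The zero field is a weak gradient of u, as the constant sequence 0 shows. *)
Lemma energy_null u : H1 g vol u -> {ae vol, forall x, u x = 0} ->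
  energy g vol a c u = 0.
Proof.
move=> Hu u0; have [mu u2] := H1_L2 Hu.
have uX : is_weak_grad g vol u (fun=> fun=> 0).
  split; first by move=> i j x _ _; rewrite mul0mx.
    by move=> i b; rewrite (_ : (fun x => _) = fun=> 0) //; apply/funext => x; rewrite mxE.
  exists (fun _ _ => 0); split.
  - by move=> n k; exact: Ck_fun_cst.
  - apply: cvg_near_cst; apply: nearW => n.
    under eq_integral do rewrite sub0r sqrrN.
    have u2i := integral_EFin measurableT u2; rewrite u2i; congr (_%:E).
    have -> : \int[vol]_x (u x ^+ 2) = \int[vol]_x (0 : R).
      apply: ae_eq_Rintegral => //; first exact: integrable0.
      by apply: ae_imply u0 => x ->; rewrite expr0n.
    by rewrite Rintegral_cst// mul0r.
  - apply: cvg_near_cst; apply: nearW => n; apply: integral0_eq => x _; congr (_%:E).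
    by rewrite inner_bil grad_cst subr0 /bil !mul0mx mxE.
rewrite (energyE Hu uX) /form.
transitivity (\int[vol]_x (0 : R)); last by rewrite Rintegral_cst// mul0r.
apply: ae_eq_Rintegral => //.
- by apply: integrable_form => //; exact: (weak_grad_L2 uX).
- exact: integrable0.
apply: ae_imply u0 => x ->.
by rewrite mulr0 addr0 inner_bil /bil !mul0mx mxE mulr0.
Qed.

Hypothesis lambda1_ge0 : (0 <= lambda1 g vol a c)%E.

(** The infimum that defines lambda_1 ranges over the functions that are not
    almost everywhere 0; the others have energy 0. *)
Lemma energy_ge0 u : H1 g vol u -> 0 <= energy g vol a c u.
Proof.
move=> Hu; have [mu u2] := H1_L2 Hu.
have [u0|u0] := pselect {ae vol, forall x, u x = 0}; first by rewrite energy_null.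
have I0 : 0 <= \int[vol]_x (u x ^+ 2) by apply: Rintegral_ge0 => x _; exact: sqr_ge0.
have Ipos : 0 < \int[vol]_x (u x ^+ 2).
  rewrite lt_def I0 andbT; apply/eqP => I00; apply: u0.
  have mu2 : mfun (fun x => u x ^+ 2) by exact: measurable_funX.
  have := Rintegral_eq0_ae measurableT mu2 (fun x _ => sqr_ge0 (u x)) u2 I00.
  by apply: ae_imply => x /(_ Logic.I) /eqP; rewrite sqrf_eq0 => /eqP.
have : (0 <= (energy g vol a c u / \int[vol]_x (u x ^+ 2))%:E)%E.
  by apply: le_trans lambda1_ge0 _; apply: ereal_inf_lbound; exists u.
by rewrite lee_fin pmulr_lge0// invr_gt0.
Qed.

Lemma weak_grad_smooth phi : smooth_fun A phi -> is_weak_grad g vol phi (grad g phi).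
Proof.
move=> ps; split; [exact: grad_vector_field|exact: measurable_grad|].
exists (fun=> phi); split=> //.
- apply: cvg_near_cst; apply: nearW => n; apply: integral0_eq => x _.
  by rewrite subrr expr0n.
- apply: cvg_near_cst; apply: nearW => n; apply: integral0_eq => x _; congr (_%:E).
  by rewrite inner_bil subrr /bil !mul0mx mxE.
Qed.

Lemma weak_grad_add_smooth u X phi (s : R) : is_weak_grad g vol u X -> smooth_fun A phi ->
  is_weak_grad g vol (fun x => u x + s * phi x) (fun i x => X i x + s *: grad g phi i x).
Proof.
move=> [Xv mX [v [vs vu vX]]] ps; split.
- by apply: vector_field_lin => //; exact: grad_vector_field.
- by apply: measurable_vector_field_lin => //; exact: measurable_grad.
exists (fun n x => v n x + s * phi x); split=> [n||].
- exact: (smooth_fun_lin s (vs n) ps).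
- move: vu; apply: cvg_trans; apply: near_eq_cvg; apply: nearW => n.
  by apply: eq_integral => x _; congr (_ ^+ 2)%:E; ring.
- move: vX; apply: cvg_trans; apply: near_eq_cvg; apply: nearW => n.
  have E x : grad g (fun y => v n y + s * phi y) (chart_at A x) x -
      (X (chart_at A x) x + s *: grad g phi (chart_at A x) x) =
      grad g (v n) (chart_at A x) x - X (chart_at A x) x.
    rewrite (grad_lin g s (vs n) ps (mem_chart_at A x)) opprD addrACA.
    by rewrite subrr addr0.
  by apply: eq_integral => x _; congr (_%:E); apply: eq_inner; rewrite E.
Qed.

Lemma H1_add_smooth u phi (s : R) : H1 g vol u -> smooth_fun A phi ->
  H1 g vol (fun x => u x + s * phi x).
Proof.
move=> Hu ps; have [mu u2] := H1_L2 Hu; have [mp p2] := L2_fun_smooth ps.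
have msp : mfun (fun x => s * phi x) by exact: (measurable_funM (measurable_cst s) mp).
have sp2 : intble (fun x => (s * phi x) ^+ 2).
  rewrite (_ : (fun x => _) = fun x => (s ^+ 2 * phi x ^+ 2)%:E).
    exact: integrable_scale.
  by apply/funext => x; rewrite exprMn.
split; first exact: measurable_funD.
  by rewrite (integral_EFin measurableT (integrable_sqrD measurableT mu msp u2 sp2)) ltry.
by eexists; exact: weak_grad_add_smooth (wgradP Hu) ps.
Qed.

Lemma H1_smooth phi : smooth_fun A phi -> H1 g vol phi.
Proof.
move=> ps; have [mp p2] := L2_fun_smooth ps; split=> //.
  by rewrite (integral_EFin measurableT p2) ltry.
by exists (grad g phi); exact: weak_grad_smooth.
Qed.

(** The energy of w + s phi is a quadratic polynomial in s, nonnegative by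
    [energy_ge0]; its discriminant is therefore nonpositive. *)
Lemma energy_CS w phi : H1 g vol w -> smooth_fun A phi ->
  form w (wgrad g vol w) phi (grad g phi) ^+ 2 <=
    energy g vol a c w * form phi (grad g phi) phi (grad g phi).
Proof.
move=> Hw ps; have wW := wgradP Hw.
have Lw := H1_L2 Hw; have LW := weak_grad_L2 wW.
have Lp := L2_fun_smooth ps; have LP := L2_field_grad ps.
rewrite (energyE Hw wW); apply: discriminant_le.
  have Hp := H1_smooth ps; rewrite -(energyE Hp (weak_grad_smooth ps)).
  exact: energy_ge0.
move=> s; rewrite -form_sqr_lin//.
have Hs := H1_add_smooth s Hw ps.
by rewrite -(energyE Hs (weak_grad_add_smooth s wW ps)) energy_ge0.
Qed.

End energy.

(** * Critical points are minimizers *)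

(** The pointwise estimate behind [approx_pos], in which u is the given function
    with gradient X, v is a smooth approximant whose gradient differs from X by Z,
    p = rpos e v, and Ip, IX, IZ, XZ stand for |grad p|^2, |X|^2, |Z|^2, <X, Z>. All
    errors are collected in one bound H whose first part is small with t and
    whose second part is small with the distance of v from u and with e. *)
Lemma perturb_le (R : realFieldType) (C t e a c IX IZ XZ Ip p u v : R) :
  0 < t -> 0 <= a <= C -> `|c| <= C -> 1 <= C ->
  0 <= IX -> 0 <= IZ -> 2 * XZ <= t * IX + t^-1 * IZ ->
  Ip <= IX + 2 * XZ + IZ -> `|p - u| <= e + `|v - u| ->
  let H := C * (t * (IX + u ^+ 2 + 1) + (1 + t^-1) * (IZ + 2 * (v - u) ^+ 2 + 2 * e ^+ 2)) in
  a * Ip + c * p * p <= a * IX + c * u * u + H /\ `|p - u| <= H.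
Proof.
move=> t0 /andP[a0 aC] cC C1 IX0 IZ0 XZle Ile.
set d := p - u; have -> : p = u + d by rewrite /d addrC subrK.
move=> dle; have ti : 0 < t^-1 by rewrite invr_gt0.
have C0 : 0 < C := lt_le_trans ltr01 C1.
have tt : t * t^-1 = 1 by rewrite mulfV// gt_eqF.
set s := t^-1 in ti tt XZle *.
have d2 : d ^+ 2 <= 2 * (v - u) ^+ 2 + 2 * e ^+ 2.
  rewrite -(real_normK (num_real d)) -(real_normK (num_real (v - u))).
  move: dle (normr_ge0 d) (normr_ge0 (v - u)); set D := `|d|; set V := `|v - u| => h D0 V0.
  have := sqr_ge0 (e - V); nra.
have young (x y : R) : 2 * x * y <= t * x ^+ 2 + s * y ^+ 2.
  have := mulr_ge0 (ltW ti) (sqr_ge0 (t * x - y)).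
  have -> : s * (t * x - y) ^+ 2 = t * (t * s) * x ^+ 2 - 2 * (t * s) * (x * y) + s * y ^+ 2.
    by ring.
  by rewrite tt; lra.
pose W := IZ + 2 * (v - u) ^+ 2 + 2 * e ^+ 2.
have W0 : IZ + d ^+ 2 <= W by rewrite /W; lra.
have d0 := sqr_ge0 d; have u0 := sqr_ge0 u.
split.
  have E1 : a * Ip <= a * IX + C * (t * IX + (1 + s) * IZ).
    have h : Ip - IX <= t * IX + (1 + s) * IZ by lra.
    have h0 : 0 <= t * IX + (1 + s) * IZ by rewrite addr_ge0// mulr_ge0// ltW// addr_gt0.
    have := ler_wpM2l a0 h; have := ler_wpM2r h0 aC; lra.
  have E2 : c * (u + d) * (u + d) <= c * u * u + C * (t * u ^+ 2 + (1 + s) * d ^+ 2).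
    have -> : c * (u + d) * (u + d) = c * u * u + c * (2 * u * d + d ^+ 2) by ring.
    rewrite lerD2l; apply: le_trans (ler_norm _) _; rewrite normrM.
    apply: ler_pM => //; rewrite ler_norml; apply/andP; split.
      by have := young u (- d); rewrite sqrrN; lra.
    by have := young u d; lra.
  have E3 : C * ((1 + s) * (IZ + d ^+ 2)) <= C * ((1 + s) * W).
    by rewrite ler_pM2l// ler_pM2l// addr_gt0.
  by rewrite -/W; have := mulr_ge0 (ltW C0) (ltW t0); lra.
have E3 : (1 + s) * d ^+ 2 <= (1 + s) * W by rewrite ler_pM2l ?addr_gt0//; lra.
have E4 : `|d| <= t * (IX + u ^+ 2 + 1) + (1 + s) * W.
  have := young 1 `|d|; rewrite real_normK ?num_real// expr1n.
  have := mulr_ge0 (ltW t0) IX0; have := mulr_ge0 (ltW t0) u0; have := normr_ge0 d; lra.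
apply: le_trans E4 _; rewrite -/W ler_peMl//.
apply: addr_ge0; first by apply: mulr_ge0 (ltW t0) _; rewrite !addr_ge0.
apply: mulr_ge0; first by rewrite addr_ge0// ltW.
by apply: le_trans W0; exact: addr_ge0.
Qed.

(** For eta = r^2 the square root of p (q + eta) is at most that of p times
    (sqrt q + r); then r tends to 0. *)
Lemma sqrt_limit (R : rcfType) (p q K mu I : R) : 0 <= p -> 0 <= q -> 0 <= K -> 0 < mu ->
  (forall eta, 0 < eta -> exists2 b, b ^+ 2 <= p * (q + eta) & I <= b / mu + K * eta) ->
  I <= Num.sqrt p * Num.sqrt q / mu.
Proof.
move=> p0 q0 K0 mu0 h; apply/ler_addgt0Pr => e e0.
pose B := Num.sqrt p / mu + K.
have B0 : 0 <= B by rewrite addr_ge0// divr_ge0 ?sqrtr_ge0// ltW.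
pose r := e / (e + B); have eB : 0 < e + B by rewrite ltr_pwDl.
have r0 : 0 < r by rewrite divr_gt0.
have r1 : r <= 1 by rewrite ler_pdivrMr// mul1r lerDl.
have rB : r * B <= e.
  by rewrite /r mulrAC ler_pdivrMr// ler_pM2l// lerDr ltW.
clearbody r.
have [b bq Ib] := h _ (exprn_gt0 2 r0); apply: le_trans Ib _.
have sp := sqrtr_ge0 p; have sq := sqrtr_ge0 q.
have bl : b <= Num.sqrt p * (Num.sqrt q + r).
  apply: le_trans (ler_norm _) _.
  rewrite -(@ler_pXn2r _ 2) ?nnegrE ?mulr_ge0 ?addr_ge0 ?(ltW r0)//.
  rewrite real_normK ?num_real// (le_trans bq)// exprMn sqr_sqrtr// ler_wpM2l//.
  by rewrite sqrrD sqr_sqrtr// lerD2r lerDl mulrn_wge0// mulr_ge0// ltW.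
have : b / mu <= Num.sqrt p * (Num.sqrt q + r) / mu by rewrite ler_pM2r ?invr_gt0.
have : K * r ^+ 2 <= K * r by rewrite ler_wpM2l// expr2 ler_piMl// ltW.
have -> : Num.sqrt p * (Num.sqrt q + r) / mu =
  Num.sqrt p * Num.sqrt q / mu + r * (Num.sqrt p / mu) by ring.
by move: rB; rewrite /B; lra.
Qed.

Section critical.
Context {R : realType} {M : ptopologicalType} {A : smooth_atlas R M}.
Variables (g : riemannian_metric A) (vol : {measure set (borel M) -> \bar R}).
Hypotheses (volP : is_riemannian_measure g vol) (cM : compact [set: M]).
Variables (a c : M -> R).
Hypotheses (sa : smooth_fun A a) (sc : smooth_fun A c) (a0 : forall x, 0 < a x).
Hypothesis lambda1_ge0 : (0 <= lambda1 g vol a c)%E.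
Implicit Types (u v w phi : M -> R) (X Y : chart_index A -> M -> 'rV[R]_4).
Notation intble f := (vol.-integrable setT (fun x => (f x)%:E)).
Notation mfun u := (measurable_fun setT (u : borel M -> R)).
Notation form := (form g vol a c).
Notation energy := (energy g vol a c).
Notation wgrad := (wgrad g vol).

Lemma integrable_cst (r : R) : intble (fun=> r).
Proof.
apply: (integrable_bounded measurableT (C := `|r|)) => //; exact: vol_lty volP cM.
Qed.

Lemma L2_fun_L1 u : L2_fun vol u -> intble u.
Proof.
move=> [mu u2].
apply: (integrable_dom measurableT mu _ (integrable_add measurableT (integrable_cst 1) u2)) => x _.
rewrite -(real_normK (num_real (u x))); have := sqr_ge0 (`|u x| - 1).
by have := normr_ge0 (u x); nra.
Qed.

(** Take phi = rpos e (v n), where v n approximates u in H^1: the slope of [rpos]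
    is at most 1, so the energy of phi exceeds that of v n by little. The
    parameters t, then e and n, are chosen such that the error term H of
    [perturb_le] has integral at most eta. *)
Lemma approx_pos u (eta : R) : H1 g vol u -> {ae vol, forall x, 0 < u x} -> 0 < eta ->
  exists phi, [/\ smooth_fun A phi, forall x, 0 < phi x,
    form phi (grad g phi) phi (grad g phi) <= energy u + eta &
    \int[vol]_x `|phi x - u x| <= eta].
Proof.
move=> Hu upos eta0; have uX := wgradP Hu; have Lu := H1_L2 Hu; have [mu u2] := Lu.
have LX := weak_grad_L2 volP cM uX; have [Xv mX Xi] := LX.
have [_ _ [v [vs vu vX]]] := uX.
set X := wgrad u in uX LX Xv mX Xi vX.
have [Ca PCa] := bounded_continuous cM (Ck_fun_continuous (sa 0%N)).
have [Cc PCc] := bounded_continuous cM (Ck_fun_continuous (sc 0%N)).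
pose C := 1 + `|Ca| + `|Cc|.
have C1 : 1 <= C by rewrite /C -addrA lerDl addr_ge0.
have C0 : 0 < C := lt_le_trans ltr01 C1.
have aC x : 0 <= a x <= C.
  rewrite (ltW (a0 x)) (le_trans (ler_norm _))// (le_trans (PCa x))//.
  by apply: le_trans (ler_norm _) _; rewrite /C -addrA addrCA lerDl addr_ge0.
have cC x : `|c x| <= C.
  apply: le_trans (PCc x) _; apply: le_trans (ler_norm _) _.
  by rewrite /C lerDr addr_ge0.
pose N x := inner g X X x + u x ^+ 2 + 1.
have Ni : intble N by apply: integrable_add => //; [exact: integrable_add|exact: integrable_cst].
have N0 : 0 <= \int[vol]_x N x.
  by apply: Rintegral_ge0 => x _; rewrite !addr_ge0 ?inner_ge0 ?sqr_ge0.
set IN := \int[vol]_x N x in N0.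
pose t := eta / (2 * C * (IN + 1)).
have t0 : 0 < t by rewrite divr_gt0// !mulr_gt0// ltr_pwDr.
have ti : 0 < t^-1 by rewrite invr_gt0.
pose sg := eta / (2 * C * (1 + t^-1)).
have sg0 : 0 < sg by rewrite divr_gt0// !mulr_gt0// addr_gt0.
pose V := fine (vol setT); have V0 : 0 <= V by exact: fine_ge0.
have V1 : 0 < V + 1 by rewrite ltr_pwDr.
pose e := Num.sqrt (sg / (6 * (V + 1))).
have e0 : 0 < e by rewrite sqrtr_gt0 divr_gt0// mulr_gt0.
have e2 : 2 * e ^+ 2 * V <= sg / 3.
  rewrite /e sqr_sqrtr; last by rewrite ltW// divr_gt0// mulr_gt0.
  have -> : 2 * (sg / (6 * (V + 1))) * V = sg / 3 * (V / (V + 1)).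
    by field; rewrite gt_eqF.
  apply: ler_piMr; first by rewrite divr_ge0// ltW.
  by rewrite ler_pdivrMr// mul1r lerDl.
pose Z n i x := grad g (v n) i x - X i x.
have [n [[Zlty Zle] [vlty vle]]] : exists n,
   ((\int[vol]_x (inner g (Z n) (Z n) x)%:E < +oo)%E /\
      \int[vol]_x inner g (Z n) (Z n) x <= sg / 3) /\
   ((\int[vol]_x ((v n x - u x) ^+ 2)%:E < +oo)%E /\
      \int[vol]_x ((v n x - u x) ^+ 2) <= sg / 6).
  have s3 : 0 < sg / 3 by rewrite divr_gt0.
  have s6 : 0 < sg / 6 by rewrite divr_gt0.
  have F1 := @cvg0_small _ _ _ vol setT (fun n => inner g (Z n) (Z n)) _ s3
    (fun n x _ => inner_ge0 g (Z n) x) vX.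
  have F2 := @cvg0_small _ _ _ vol setT (fun n x => (v n x - u x) ^+ 2) _ s6
    (fun n x _ => sqr_ge0 _) vu.
  by have [m _ /(_ _ (leqnn m)) ?] := filterI F1 F2; exists m.
have gv := grad_vector_field g (vs n); have mg := measurable_grad g (vs n).
have Zv : is_vector_field (Z n) by exact: vector_fieldB.
have mZ : measurable_vector_field (Z n) by exact: measurable_vector_fieldB.
have Zi := ge0_integrableP (measurable_inner g cM Zv Zv mZ mZ) (fun x _ => inner_ge0 g (Z n) x) Zlty.
have mvu : mfun (fun x => (v n x - u x) ^+ 2).
  exact: (measurable_funX 2 (measurable_funB (measurable_smooth (vs n)) mu)).
have vi := ge0_integrableP mvu (fun x _ => sqr_ge0 _) vlty.
pose phi x := rpos e (v n x).
have ps : smooth_fun A phi := smooth_fun_rpos e0 (vs n).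
pose W x := inner g (Z n) (Z n) x + 2 * (v n x - u x) ^+ 2 + 2 * e ^+ 2.
have v2i := integrable_scale measurableT 2 vi.
have Wi : intble W.
  by apply: integrable_add => //; [exact: integrable_add|exact: integrable_cst].
have IW : \int[vol]_x W x <= sg.
  rewrite RintegralD//; [|exact: integrable_add|exact: integrable_cst].
  rewrite RintegralD// RintegralZl// Rintegral_cst// -/V.
  have -> : sg = sg / 3 + 2 * (sg / 6) + sg / 3 by field.
  by rewrite lerD// lerD// ler_pM2l.
pose H x := C * (t * N x + (1 + t^-1) * W x).
have Hi0 : intble (fun x => t * N x + (1 + t^-1) * W x).
  by apply: integrable_add => //; exact: integrable_scale.
have Hi : intble H by exact: integrable_scale.
have IH : \int[vol]_x H x <= eta.
  rewrite RintegralZl// RintegralD//; [|exact: integrable_scale..].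
  rewrite !RintegralZl// -/IN.
  have -> : eta = C * (t * (IN + 1) + (1 + t^-1) * sg).
    have t1 : 1 + t^-1 != 0 by rewrite gt_eqF// addr_gt0.
    have N1 : IN + 1 != 0 by rewrite gt_eqF// ltr_pwDr.
    have C0' : C != 0 by rewrite gt_eqF.
    have -> : t * (IN + 1) = eta / (2 * C) by rewrite /t; field; rewrite C0' N1.
    have -> : (1 + t^-1) * sg = eta / (2 * C).
      by rewrite /sg; set s := 1 + t^-1 in t1 *; field; rewrite t1 C0'.
    by field.
  rewrite ler_pM2l// lerD// ler_pM2l ?lerDl ?ler01//; exact: addr_gt0.
have ptw x : 0 < u x ->
   a x * inner g (grad g phi) (grad g phi) x + c x * phi x * phi x <=
     a x * inner g X X x + c x * u x * u x + H x /\ `|phi x - u x| <= H x.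
  move=> ux; apply: (@perturb_le _ C t e (a x) (c x) (inner g X X x)
    (inner g (Z n) (Z n) x) (inner g X (Z n) x)) => //; rewrite ?inner_ge0//.
  - have := inner_ge0 g (fun i x => X i x + - t^-1 *: Z n i x) x.
    rewrite inner_sqr_lin => h; have := mulr_ge0 (ltW t0) h.
    set IX := inner g X X x; set XZ := inner g X _ x; set IZ := inner g _ _ x.
    have -> : t * (IX + - t^-1 * 2 * XZ + (- t^-1) ^+ 2 * IZ) =
      t * IX - 2 * XZ + t^-1 * IZ by field; rewrite gt_eqF.
    lra.
  - have -> : inner g X X x + 2 * inner g X (Z n) x + inner g (Z n) (Z n) x =
        inner g (grad g (v n)) (grad g (v n)) x.
      transitivity (inner g (fun i x => X i x + 1 *: Z n i x) (fun i x => X i x + 1 *: Z n i x) x).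
        by rewrite inner_sqr_lin mul1r expr1n mul1r.
      by apply: eq_inner; rewrite scale1r addrC subrK.
    have gE : grad g phi (chart_at A x) x = drpos e (v n x) *: grad g (v n) (chart_at A x) x.
      exact: (grad_rpos g e0 (vs n) (mem_chart_at A x)).
    rewrite (@eq_inner _ _ _ g _ (fun i y => drpos e (v n y) *: grad g (v n) i y) _
      (fun i y => drpos e (v n y) *: grad g (v n) i y)); [|exact: gE|exact: gE].
    rewrite (innerZZ g _ (fun y => drpos e (v n y))) ler_piMl ?inner_ge0//.
    by have /andP[d0 d1] := drpos_bound (v n x) e0; rewrite expr_le1.
  - exact: rpos_dist (ltW ux).
have [mp p2] := L2_fun_smooth volP cM ps.
have pui := integrable_sub (L2_fun_L1 (conj mp p2)) (L2_fun_L1 Lu).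
exists phi; split=> //.
- by move=> x; exact: rpos_gt0.
- have fi := integrable_form cM sa sc Lu LX Lu LX.
  have Lp := L2_fun_smooth volP cM ps; have LP := L2_field_grad volP cM ps.
  apply: (@le_trans _ _ (form u X u X + \int[vol]_x H x)).
    rewrite /form -RintegralD//; apply: ae_le_Rintegral.
    + exact: integrable_form.
    + exact: integrable_add.
    by apply: ae_imply upos => x /ptw[].
  by rewrite (energyE volP cM sa sc Hu uX) lerD2l.
- apply: le_trans IH; apply: ae_le_Rintegral => //; first exact: integrable_norm.
  by apply: ae_imply upos => x /ptw[].
Qed.

(** The critical point equation turns [energy_CS] into a bound of the integral of
    w^-5 phi by E(w) E(phi), for positive smooth phi. As phi tends to u, this
    bounds the integrals of min (w^-5, K) u uniformly in K. The absolute values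
    make the integrands nonnegative also on the null sets where w or u is not
    positive. *)
Lemma critical_bound w u : critical_point g vol a c w -> H1 g vol u ->
  {ae vol, forall x, 0 < u x} -> 0 < energy w -> 0 < \int[vol]_x (w x ^- 4) ->
  intble (fun x => `|w x ^- 5| * `|u x|) /\
  \int[vol]_x (`|w x ^- 5| * `|u x|) <=
    Num.sqrt (energy w) * Num.sqrt (energy u) / (energy w / \int[vol]_x (w x ^- 4)).
Proof.
move=> [[Hw wpos _] w5 weq] Hu upos E0 P0; set P := \int[vol]_x _ in P0 weq *.
have [mw w2] := H1_L2 Hw; have [mu u2] := H1_L2 Hu.
have ui := L2_fun_L1 (H1_L2 Hu); have Eu0 := energy_ge0 volP cM sa sc lambda1_ge0 Hu.
have m5 : mfun (fun x => w x ^- 5) by exact: measurable_funXV.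
have m5n : mfun (fun x => `|w x ^- 5|) by exact: measurableT_comp.
have mun : mfun (fun x => `|u x|) by exact: measurableT_comp.
apply: truncated_integral_le => // K K0.
have T0 x : 0 <= Num.min `|w x ^- 5| K by rewrite le_min normr_ge0.
have Ti : intble (fun x => Num.min `|w x ^- 5| K * `|u x|).
  apply: (integrable_dom measurableT _ _ (integrable_scale measurableT K (integrable_norm ui))).
    by apply: measurable_funM => //; apply: measurable_minr => //; exact: measurable_cst.
  move=> x _; rewrite normrM normr_id (ger0_norm (T0 x)) ler_wpM2r//.
  by rewrite ge_min lexx orbT.
split=> //; apply: (@sqrt_limit _ _ _ K); rewrite ?(ltW E0)//; first exact: divr_gt0.
move=> eta eta0; have [phi [ps ppos pE pu]] := approx_pos Hu upos eta0.
exists (form w (wgrad w) phi (grad g phi)).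
  apply: le_trans (energy_CS volP cM sa sc lambda1_ge0 Hw ps) _.
  by rewrite ler_pM2l.
have wphii := integrable_bmul cM ps w5.
have -> : form w (wgrad w) phi (grad g phi) = energy w / P * \int[vol]_x (phi x * w x ^- 5).
  rewrite /form (weq phi (ps 1%N)) /DD -/P; congr (_ * _).
    rewrite -{3}(sqr_sqrtr (ltW P0)); have : Num.sqrt P != 0 by rewrite gt_eqF ?sqrtr_gt0.
    by move=> ?; field.
  by apply: eq_Rintegral => x _; rewrite mulrC.
rewrite [energy w / P * _]mulrC mulfK; last by rewrite gt_eqF// divr_gt0.
have pui := integrable_norm (integrable_sub (L2_fun_L1 (L2_fun_smooth volP cM ps)) ui).
have Kpui := integrable_scale measurableT K pui.
apply: (@le_trans _ _ (\int[vol]_x (phi x * w x ^- 5 + K * `|phi x - u x|))).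
  apply: ae_le_Rintegral => //; first exact: integrable_add.
  apply: ae_imply wpos => x wx.
  have w5x : 0 < w x ^- 5 by rewrite invr_gt0 exprn_gt0.
  have upx : `|u x| <= phi x + `|phi x - u x|.
    rewrite -{1}(subKr (phi x) (u x)); apply: le_trans (ler_normB _ _) _.
    by rewrite gtr0_norm.
  apply: le_trans (ler_wpM2l (T0 x) upx) _; rewrite mulrDr lerD//.
    rewrite mulrC ler_pM2l// ge_min gtr0_norm// lexx//.
  by rewrite ler_wpM2r// ge_min lexx orbT.
rewrite RintegralD// RintegralZl// lerD2l ler_wpM2l//.
Qed.

Lemma HM_integrable u : HM g vol u -> intble (fun x => u x ^- 4).
Proof.
move=> [[mu _ _] _ uP]; apply: ge0_integrableP => //; first exact: measurable_funXV.
by move=> x _; rewrite invr_ge0 exprn_even_ge0.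
Qed.

Lemma critical_minimum w : critical_point g vol a c w -> minimum_point g vol a c w.
Proof.
move=> wcrit; have [Hw w5 weq] := wcrit; have [Hw1 wpos _] := Hw; split=> // u Hu.
have [Hu1 upos _] := Hu; rewrite /DD.
have Ew := energy_ge0 volP cM sa sc lambda1_ge0 Hw1.
have Eu := energy_ge0 volP cM sa sc lambda1_ge0 Hu1.
have Pge0 v : 0 <= \int[vol]_x (v x ^- 4).
  by apply: Rintegral_ge0 => x _; rewrite invr_ge0 exprn_even_ge0.
have rhs0 : 0 <= Num.sqrt (\int[vol]_x (u x ^- 4)) * energy u.
  by rewrite mulr_ge0 ?sqrtr_ge0.
move: (Ew); rewrite le_eqVlt => /predU1P[<-|Ew0]; first by rewrite mulr0.
move: (Pge0 w); rewrite le_eqVlt => /predU1P[<-|P0]; first by rewrite sqrtr0 mul0r.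
have [wui wuS] := critical_bound wcrit Hu1 upos Ew0 P0.
have := amgm_integral wpos upos (HM_integrable Hw) (HM_integrable Hu) wui wuS P0.
have := Pge0 u; set P := \int[vol]_x (w x ^- 4) in P0 *; set Q := \int[vol]_x _ => Q0.
have -> : (Num.sqrt (energy w) * Num.sqrt (energy u) / (energy w / P)) ^+ 4 =
    P ^+ 4 * (energy u ^+ 2 / energy w ^+ 2).
  rewrite !exprMn !(exprM _ 2 2) !sqr_sqrtr// exprVn exprMn exprVn.
  by rewrite !expr2; field; rewrite ?gt_eqF.
rewrite exprS -mulrA mulrC [_ / _ * Q]mulrC.
rewrite ler_pM2l ?exprn_gt0// mulrA ler_pdivlMr ?exprn_gt0// => H.
rewrite -(@ler_pXn2r _ 2) ?nnegrE ?mulr_ge0 ?sqrtr_ge0//.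
by rewrite !exprMn !sqr_sqrtr// ltW.
Qed.

End critical.

Theorem corollary4p11 (R : realType) (M : ptopologicalType)
    (A : smooth_atlas R M) (g0 : riemannian_metric A)
    (vol : {measure set (borel M) -> \bar R}) (a c : M -> R) :
  hausdorff_space M -> compact [set: M] -> connected [set: M] ->
  is_riemannian_measure g0 vol ->
  (forall x : M, weyl_nonzero_at g0 x) ->
  smooth_fun A a -> smooth_fun A c -> (forall x : M, 0 < a x) ->
  (0 <= lambda1 g0 vol a c)%E ->
  forall w : M -> R,
    critical_point g0 vol a c w -> minimum_point g0 vol a c w.

Proof.
move=> _ cM _ volP _ sa sc a0 lambda0 w; exact: critical_minimum.
Qed.
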